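(* Let $A$ and $B$ be rings, $V$ an $A$-$B$-bimodule, $U$ a $B$-$A$-bimodule, $\Lambda_{(0,0)}=\begin{pmatrix}A&V\\ U&B\end{pmatrix}$ the Morita ring with zero bimodule homomorphisms, $n\geqslant 1$ an integer, $\mathcal{C}_1,\mathcal{C}_2$ classes of left $A$-modules and $\mathcal{D}_1,\mathcal{D}_2$ classes of left $B$-modules. (1) Let $(\mathfrak{U}_{\mathcal{D}_1}^{\mathcal{C}_1},\mathfrak{J}_{\mathcal{D}_2}^{\mathcal{C}_2})$ be a hereditary left $n$-cotorsion pair in $\Lambda_{(0,0)}$-$\mathrm{Mod}$. Assume that $\mathrm{Ext}_A^i(V,\mathcal{C}_2)=0=\mathrm{Ext}_B^i(U,\mathcal{D}_2)$ for each $1\leqslant i\leqslant n$, $\mathrm{Ext}_A^1(\mathrm{Hom}_B(U,\mathcal{D}_2),\mathcal{C}_2)=0=\mathrm{Ext}_B^1(\mathrm{Hom}_A(V,\mathcal{C}_2),\mathcal{D}_2)$, $\mathrm{Hom}_A(V,\mathcal{C}_2)\subseteq\mathcal{D}_2$, $\mathrm{Hom}_B(U,\mathcal{D}_2)\subseteq\mathcal{C}_2$, and $(\mathcal{C}_2)_{n-1}^{\wedge}$ and $(\mathcal{D}_2)_{n-1}^{\wedge}$ are closed under extensions. Then $(\mathcal{C}_1,\mathcal{C}_2)$ and $(\mathcal{D}_1,\mathcal{D}_2)$ are hereditary left $n$-cotorsion pairs in $A$-$\mathrm{Mod}$ and $B$-$\mathrm{Mod}$, respectively. (2) Let $(\mathfrak{B}_{\mathcal{D}_1}^{\mathcal{C}_1},\mathfrak{U}_{\mathcal{D}_2}^{\mathcal{C}_2})$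 be a hereditary right $n$-cotorsion pair in $\Lambda_{(0,0)}$-$\mathrm{Mod}$. Assume that $\mathrm{Tor}_i^A(U,\mathcal{C}_1)=0=\mathrm{Tor}_i^B(V,\mathcal{D}_1)$ for each $1\leqslant i\leqslant n$, $\mathrm{Ext}_A^1(\mathcal{C}_1,V\otimes_B\mathcal{D}_1)=0=\mathrm{Ext}_B^1(\mathcal{D}_1,U\otimes_A\mathcal{C}_1)$, $V\otimes_B\mathcal{D}_1\subseteq\mathcal{C}_1$, $U\otimes_A\mathcal{C}_1\subseteq\mathcal{D}_1$, and $(\mathcal{C}_1)_{n-1}^{\vee}$ and $(\mathcal{D}_1)_{n-1}^{\vee}$ are closed under extensions. Then $(\mathcal{C}_1,\mathcal{C}_2)$ and $(\mathcal{D}_1,\mathcal{D}_2)$ are hereditary right $n$-cotorsion pairs in $A$-$\mathrm{Mod}$ and $B$-$\mathrm{Mod}$, respectively.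
   Context: Rings are associative with identity, modules are unitary, and $S$-$\mathrm{Mod}$ is the category of left $S$-modules. Classes of modules contain $0$ and are closed under isomorphisms. Vanishing and inclusion statements with classes as arguments are meant for all members of the classes (chosen independently). $\Lambda_{(0,0)}$ consists of matrices $\begin{pmatrix}a&v\\ u&b\end{pmatrix}$ with entrywise addition and $\begin{pmatrix}a_1&v_1\\ u_1&b_1\end{pmatrix}\begin{pmatrix}a_2&v_2\\ u_2&b_2\end{pmatrix}=\begin{pmatrix}a_1a_2&a_1v_2+v_1b_2\\ u_1a_2+b_1u_2&b_1b_2\end{pmatrix}$. A left $\Lambda_{(0,0)}$-module is identified with a tuple $(X,Y,f,g)$, where $X\in A$-$\mathrm{Mod}$, $Y\in B$-$\mathrm{Mod}$, $f:U\otimes_A X\to Y$ is $B$-linear, $g:V\otimes_B Y\to X$ is $A$-linear, $g(V\otimes_B f)=0$ and $f(U\otimes_A g)=0$; equivalently (by adjunction) with a tuple $[X,Y,f,g]$, where $f:X\to\mathrm{Hom}_B(U,Y)$ is $A$-linear, $g:Y\to\mathrm{Hom}_A(V,X)$ is $B$-linear, $\mathrm{Hom}_B(U,g)f=0$ and $\mathrm{Hom}_A(V,f)g=0$. Morphisms are pairs of linear maps compatible with the structure maps; exactness is componentwise. For a class $\mathcal{C}$ of left $A$-modules and a class $\mathcal{D}$ of left $B$-modules: $\mathfrak{U}_{\mathcal{D}}^{\mathcal{C}}$ is the class of $(X,Y,f,g)$ with $X\in\mathcal{C}$, $Y\in\mathcal{D}$; $\mathfrak{B}_{\mathcal{D}}^{\mathcal{C}}$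 is the class of $(X,Y,f,g)$ with $\mathrm{Coker}\,f\in\mathcal{D}$, $\mathrm{Coker}\,g\in\mathcal{C}$, and $V\otimes_B U\otimes_A X\xrightarrow{V\otimes_B f}V\otimes_B Y\xrightarrow{g}X$ and $U\otimes_A V\otimes_B Y\xrightarrow{U\otimes_A g}U\otimes_A X\xrightarrow{f}Y$ exact; $\mathfrak{J}_{\mathcal{D}}^{\mathcal{C}}$ is the class of $[X,Y,f,g]$ with $\mathrm{Ker}\,f\in\mathcal{C}$, $\mathrm{Ker}\,g\in\mathcal{D}$, and $X\xrightarrow{f}\mathrm{Hom}_B(U,Y)\xrightarrow{\mathrm{Hom}_B(U,g)}\mathrm{Hom}_B(U,\mathrm{Hom}_A(V,X))$ and $Y\xrightarrow{g}\mathrm{Hom}_A(V,X)\xrightarrow{\mathrm{Hom}_A(V,f)}\mathrm{Hom}_A(V,\mathrm{Hom}_B(U,Y))$ exact. For a class $\mathcal{C}$ of objects of an abelian category and $m\geqslant 0$: $\mathcal{C}_m^{\wedge}$ is the class of objects $A$ admitting an exact sequence $0\to C_k\to\cdots\to C_0\to A\to 0$ with all $C_i\in\mathcal{C}$ and some $k\leqslant m$; $\mathcal{C}_m^{\vee}$ is the class of objects $A$ admitting an exact sequence $0\to A\to C^0\to\cdots\to C^k\to 0$ with all $C^i\in\mathcal{C}$ and some $k\leqslant m$. A pair $(\mathcal{C},\mathcal{D})$ of classes of objects in an abelian category is a left $n$-cotorsion pair if (i) $\mathcal{C}$ is closed under direct summands, (ii) $\mathrm{Ext}^i(C,D)=0$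 for all $1\leqslant i\leqslant n$, $C\in\mathcal{C}$, $D\in\mathcal{D}$, and (iii) every object $A$ admits a short exact sequence $0\to K\to C\to A\to 0$ with $C\in\mathcal{C}$, $K\in\mathcal{D}_{n-1}^{\wedge}$. It is a right $n$-cotorsion pair if (i') $\mathcal{D}$ is closed under direct summands, (ii) holds, and (iii') every object $A$ admits a short exact sequence $0\to A\to D\to K\to 0$ with $D\in\mathcal{D}$, $K\in\mathcal{C}_{n-1}^{\vee}$. A left or right $n$-cotorsion pair $(\mathcal{C},\mathcal{D})$ is hereditary if $\mathrm{Ext}^{n+1}(C,D)=0$ for all $C\in\mathcal{C}$, $D\in\mathcal{D}$. *)

(* Defs.v *)
From HB Require Import structures.
From mathcomp Require Import all_boot ssralg.
From mathcomp Require Import boolp.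

Set Implicit Arguments.
Unset Strict Implicit.
Unset Printing Implicit Defensive.

Import GRing.Theory.

Local Open Scope ring_scope.
Local Open Scope quotient_scope.

(* Rings are [pzRingType]s, so that the zero ring is allowed; left S-modules
   are [lmodType S]s.  A module class is a predicate on [lmodType S]. *)

Section Modules.
Variable S : pzRingType.
Implicit Types (M N : lmodType S) (C D : lmodType S -> Prop).

Definition surjective_map (T T' : Type) (f : T -> T') : Prop :=
  forall y, exists x, f x = y.

(* Exactness of X --f--> Y --g--> Z at Y. *)
Definition exact_at (X Y Z : zmodType) (f : X -> Y) (g : Y -> Z) : Prop :=
  forall y, g y = 0 <-> exists x, f x = y.

Definition isomorphic M N : Prop := exists f : {linear M -> N}, bijective f.

Definition zero_module M : Prop := forall x : M, x = 0.

Definition module_class C : Prop :=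
  (forall M, zero_module M -> C M) /\
  (forall M N, isomorphic M N -> C M -> C N).

Record short_exact (K M N : lmodType S)
    (f : {linear K -> M}) (g : {linear M -> N}) : Prop := ShortExact {
  ses_inj : injective f;
  ses_exact : exact_at f g;
  ses_surj : surjective_map g }.

Definition closed_under_extensions C : Prop :=
  forall (K M N : lmodType S) (f : {linear K -> M}) (g : {linear M -> N}),
    short_exact f g -> C K -> C N -> C M.

Definition closed_under_summands C : Prop :=
  forall M (N N' : lmodType S), isomorphic M (N * N')%type -> C M -> C N.

(* Kernels and cokernels are only determined up to isomorphism; the classes
   used below are closed under isomorphisms. *)
Definition ker_in C (M N : lmodType S) (f : {linear M -> N}) : Prop :=
  exists (K : lmodType S) (i : {linear K -> M}),
    [/\ injective i, exact_at i f & C K].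

Definition coker_in C (M N : lmodType S) (f : {linear M -> N}) : Prop :=
  exists (Q : lmodType S) (p : {linear N -> Q}),
    [/\ surjective_map p, exact_at f p & C Q].

(* Exact sequences ... -> P_1 -> P_0 -> M -> 0. *)
Record resolution M := Resolution {
  res_obj :> nat -> lmodType S;
  res_d : forall i, {linear res_obj i.+1 -> res_obj i};
  res_aug : {linear res_obj 0%N -> M};
  res_aug_surj : surjective_map res_aug;
  res_aug_exact : exact_at (res_d 0%N) res_aug;
  res_exact : forall i, exact_at (res_d i.+1) (res_d i) }.

(* Exact sequences 0 -> M -> I^0 -> I^1 -> ... *)
Record coresolution M := Coresolution {
  cores_obj :> nat -> lmodType S;
  cores_d : forall i, {linear cores_obj i -> cores_obj i.+1};
  cores_aug : {linear M -> cores_obj 0%N};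
  cores_aug_inj : injective cores_aug;
  cores_aug_exact : exact_at cores_aug (cores_d 0%N);
  cores_exact : forall i, exact_at (cores_d i) (cores_d i.+1) }.

(* C_m^/\ and C_m^\/: finite sequences are padded with zero modules. *)
Definition wedge_class C (m : nat) M : Prop :=
  exists (k : nat) (P : resolution M),
    [/\ (k <= m)%N, forall i, (i <= k)%N -> C (P i)
      & forall i, (k < i)%N -> zero_module (P i)].

Definition vee_class C (m : nat) M : Prop :=
  exists (k : nat) (I : coresolution M),
    [/\ (k <= m)%N, forall i, (i <= k)%N -> C (I i)
      & forall i, (k < i)%N -> zero_module (I i)].

Definition projective_module (P : lmodType S) : Prop :=
  forall M N (p : {linear M -> N}) (f : {linear P -> N}),
    surjective_map p -> exists h : {linear P -> M}, forall x, p (h x) = f x.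

Definition projective_resolution M (P : resolution M) : Prop :=
  forall i, projective_module (P i).

(* Ext^i(M, N) = 0, where Ext^i(M, N) is the cohomology of the complex
   Hom(P_0, N) -> Hom(P_1, N) -> ... for projective resolutions P of M. *)
Definition Ext_eq0 (i : nat) M N : Prop :=
  forall P : resolution M, projective_resolution P ->
  match i with
  | 0%N => forall f : {linear P 0%N -> N},
      (forall x, f (res_d P 0%N x) = 0) -> forall x, f x = 0
  | j.+1 => forall f : {linear P j.+1 -> N},
      (forall x, f (res_d P j.+1 x) = 0) ->
      exists h : {linear P j -> N}, forall x, f x = h (res_d P j x)
  end.

Definition left_cotorsion_pair (n : nat) C D : Prop :=
  [/\ closed_under_summands C,
      forall i, (1 <= i <= n)%N ->
        forall M N, C M -> D N -> Ext_eq0 i M N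
    & forall M, exists (K L : lmodType S)
          (f : {linear K -> L}) (g : {linear L -> M}),
        [/\ short_exact f g, C L & wedge_class D n.-1 K]].

Definition right_cotorsion_pair (n : nat) C D : Prop :=
  [/\ closed_under_summands D,
      forall i, (1 <= i <= n)%N ->
        forall M N, C M -> D N -> Ext_eq0 i M N
    & forall M, exists (L K : lmodType S)
          (f : {linear M -> L}) (g : {linear L -> K}),
        [/\ short_exact f g, D L & vee_class C n.-1 K]].

Definition hereditary (n : nat) C D : Prop :=
  forall M N, C M -> D N -> Ext_eq0 n.+1 M N.

Definition hereditary_left_cotorsion_pair n C D : Prop :=
  left_cotorsion_pair n C D /\ hereditary n C D.

Definition hereditary_right_cotorsion_pair n C D : Prop :=
  right_cotorsion_pair n C D /\ hereditary n C D.

End Modules.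

(* A-B-bimodules: left A-modules with a compatible right action of B. *)
Record bimodule (A B : pzRingType) := Bimodule {
  bimod_sort :> lmodType A;
  ract : bimod_sort -> B -> bimod_sort;
  ract1 : forall v, ract v 1 = v;
  ractM : forall v b b', ract v (b * b') = ract (ract v b) b';
  ractDl : forall v v' b, ract (v + v') b = ract v b + ract v' b;
  ractDr : forall v b b', ract v (b + b') = ract v b + ract v b';
  ractZ : forall a v b, ract (a *: v) b = a *: ract v b }.

Section BimoduleTheory.
Variables (A B : pzRingType) (V : bimodule A B).

Lemma ract0l b : ract (0 : V) b = 0.
Proof. by apply: (addrI (ract 0 b)); rewrite -ractDl !addr0. Qed.

Lemma ract0r (v : V) : ract v 0 = 0.
Proof. by apply: (addrI (ract v 0)); rewrite -ractDr !addr0. Qed.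

Lemma ractNl (v : V) b : ract (- v) b = - ract v b.
Proof. by apply: (addrI (ract v b)); rewrite -ractDl !subrr ract0l. Qed.

End BimoduleTheory.

Section Tensor.
Variables (A B : pzRingType) (U : bimodule B A) (X : lmodType A).

Definition balanced (G : zmodType) (h : U -> X -> G) : Prop :=
  [/\ forall u u' x, h (u + u') x = h u x + h u' x,
      forall u x x', h u (x + x') = h u x + h u x'
    & forall u a x, h (ract u a) x = h u (a *: x)].

Definition tens_sum (G : zmodType) (h : U -> X -> G) (s : seq (U * X)) : G :=
  \sum_(p <- s) h p.1 p.2.

(* U (x)_A X is the quotient of the formal sums u_1 (x) x_1 + ... + u_k (x) x_k
   identifying two sums when no balanced map to an abelian group separates
   them, which is what the universal property of the tensor product
   ([tens_lift_pure], [tens_lift_unique]) forces. *)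
Definition tens_rel (s t : seq (U * X)) : bool :=
  `[< forall (G : zmodType) (h : U -> X -> G),
        balanced h -> tens_sum h s = tens_sum h t >].

Lemma tens_rel_refl : reflexive tens_rel.
Proof. by move=> s; apply/asboolP. Qed.

Lemma tens_rel_sym : symmetric tens_rel.
Proof. by move=> s t; apply/asboolP/asboolP => H G h hb; rewrite H. Qed.

Lemma tens_rel_trans : transitive tens_rel.
Proof.
move=> t s r /asboolP st /asboolP tr; apply/asboolP => G h hb.
by rewrite st // tr.
Qed.

Canonical tens_equiv :=
  EquivRel tens_rel tens_rel_refl tens_rel_sym tens_rel_trans.

Definition tensor := {eq_quot tens_rel}.
HB.instance Definition _ := Choice.on tensor.
HB.instance Definition _ := EqQuotient.on tensor.

Definition tens_lift (G : zmodType) (h : U -> X -> G) (q : tensor) : G :=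
  tens_sum h (repr q).

Lemma tens_lift_pi (G : zmodType) (h : U -> X -> G) s :
  balanced h -> tens_lift h (\pi_tensor s) = tens_sum h s.
Proof.
move=> hb; rewrite /tens_lift.
have /eqmodP/asboolP := reprK (\pi_tensor s); exact.
Qed.

Lemma tens_lift_inj (q r : tensor) :
  (forall (G : zmodType) (h : U -> X -> G),
     balanced h -> tens_lift h q = tens_lift h r) -> q = r.
Proof.
move=> H; rewrite -[q]reprK -[r]reprK; apply/eqmodP/asboolP => G h hb.
exact: H.
Qed.

Lemma balanced0l (G : zmodType) (h : U -> X -> G) x : balanced h -> h 0 x = 0.
Proof. by case=> hD _ _; apply: (addrI (h 0 x)); rewrite -hD !addr0. Qed.

Lemma balancedNl (G : zmodType) (h : U -> X -> G) u x :
  balanced h -> h (- u) x = - h u x.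
Proof.
move=> hb; case: (hb) => hD _ _.
by apply: (addrI (h u x)); rewrite -hD !subrr balanced0l.
Qed.

Definition tens_add (q r : tensor) : tensor := \pi_tensor (repr q ++ repr r).
Definition tens_zero : tensor := \pi_tensor [::].
Definition tens_opp (q : tensor) : tensor :=
  \pi_tensor [seq (- p.1, p.2) | p <- repr q].

Lemma tens_lift_add (G : zmodType) (h : U -> X -> G) q r : balanced h ->
  tens_lift h (tens_add q r) = tens_lift h q + tens_lift h r.
Proof. by move=> hb; rewrite tens_lift_pi // /tens_sum big_cat. Qed.

Lemma tens_lift_zero (G : zmodType) (h : U -> X -> G) : balanced h ->
  tens_lift h tens_zero = 0.
Proof. by move=> hb; rewrite tens_lift_pi // /tens_sum big_nil. Qed.

Lemma tens_lift_opp (G : zmodType) (h : U -> X -> G) q : balanced h ->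
  tens_lift h (tens_opp q) = - tens_lift h q.
Proof.
move=> hb; rewrite tens_lift_pi // /tens_lift /tens_sum big_map -sumrN.
by apply: eq_bigr => p _; rewrite balancedNl.
Qed.

Lemma tens_addA : associative tens_add.
Proof.
by move=> q r s; apply: tens_lift_inj => G h hb; rewrite !tens_lift_add ?addrA.
Qed.

Lemma tens_addC : commutative tens_add.
Proof.
by move=> q r; apply: tens_lift_inj => G h hb; rewrite !tens_lift_add // addrC.
Qed.

Lemma tens_add0 : left_id tens_zero tens_add.
Proof.
move=> q; apply: tens_lift_inj => G h hb.
by rewrite tens_lift_add // tens_lift_zero // add0r.
Qed.

Lemma tens_addN : left_inverse tens_zero tens_opp tens_add.
Proof.
move=> q; apply: tens_lift_inj => G h hb.
by rewrite tens_lift_add // tens_lift_zero // tens_lift_opp // addNr.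
Qed.

HB.instance Definition _ :=
  GRing.isZmodule.Build tensor tens_addA tens_addC tens_add0 tens_addN.

Lemma tens_liftD (G : zmodType) (h : U -> X -> G) : balanced h ->
  {morph tens_lift h : q r / q + r}.
Proof. by move=> hb q r; apply: tens_lift_add. Qed.

Lemma tens_lift_sum (G : zmodType) (h : U -> X -> G) I (r : seq I)
    (F : I -> tensor) : balanced h ->
  tens_lift h (\sum_(i <- r) F i) = \sum_(i <- r) tens_lift h (F i).
Proof.
move=> hb; elim: r => [|i r IHr]; first by rewrite !big_nil tens_lift_zero.
by rewrite !big_cons tens_liftD // IHr.
Qed.

Definition tpure (u : U) (x : X) : tensor := \pi_tensor [:: (u, x)].

Lemma tens_lift_pure (G : zmodType) (h : U -> X -> G) u x : balanced h ->
  tens_lift h (tpure u x) = h u x.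
Proof. by move=> hb; rewrite tens_lift_pi // /tens_sum big_seq1. Qed.

Lemma pure_balanced : balanced tpure.
Proof.
by split=> *; apply: tens_lift_inj => G h hb; case: (hb) => hDl hDr hM;
  rewrite ?tens_liftD // !tens_lift_pure.
Qed.

Lemma tens_sum_pure (q : tensor) : q = \sum_(p <- repr q) tpure p.1 p.2.
Proof.
apply: tens_lift_inj => G h hb; rewrite tens_lift_sum //.
by apply: eq_bigr => p _; rewrite tens_lift_pure.
Qed.

Lemma tens_ind (P : tensor -> Prop) :
  P 0 -> (forall q r, P q -> P r -> P (q + r)) ->
  (forall u x, P (tpure u x)) -> forall q, P q.
Proof.
move=> P0 PD Pp q; rewrite (tens_sum_pure q).
elim: (repr q) => [|p s IHs]; first by rewrite big_nil.
by rewrite big_cons; apply: PD.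
Qed.

Lemma tens_lift_unique (G : zmodType) (h : U -> X -> G) (k : tensor -> G) :
  balanced h -> {morph k : q r / q + r} ->
  (forall u x, k (tpure u x) = h u x) ->
  k =1 tens_lift h.
Proof.
move=> hb kD kp; elim/tens_ind=> [|q r IHq IHr|u x].
- by rewrite tens_lift_zero //; apply: (addrI (k 0)); rewrite -kD !addr0.
- by rewrite kD tens_liftD // IHq IHr.
- by rewrite kp tens_lift_pure.
Qed.

Definition tens_scale (b : B) : tensor -> tensor :=
  tens_lift (fun u x => tpure (b *: u) x).

Lemma tens_scale_balanced b : balanced (fun u x => tpure (b *: u) x).
Proof.
case: pure_balanced => pDl pDr pM.
by split=> *; rewrite ?scalerDr ?pDl ?pDr // -ractZ pM.
Qed.

Lemma tens_scale_pure b u x : tens_scale b (tpure u x) = tpure (b *: u) x.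
Proof.
by rewrite /tens_scale tens_lift_pure //; apply: tens_scale_balanced.
Qed.

Lemma tens_scaleDr : right_distributive tens_scale +%R.
Proof. by move=> b q r; apply/tens_liftD/tens_scale_balanced. Qed.

Lemma tens_scale0 b : tens_scale b 0 = 0.
Proof. by apply: (addrI (tens_scale b 0)); rewrite -tens_scaleDr !addr0. Qed.

Lemma tens_scaleA b b' q :
  tens_scale b (tens_scale b' q) = tens_scale (b * b') q.
Proof.
elim/tens_ind: q => [|q r IHq IHr|u x]; first by rewrite !tens_scale0.
- by rewrite !tens_scaleDr IHq IHr.
- by rewrite !tens_scale_pure scalerA.
Qed.

Lemma tens_scale1 : left_id 1 tens_scale.
Proof.
elim/tens_ind => [|q r IHq IHr|u x]; first by rewrite tens_scale0.
- by rewrite tens_scaleDr IHq IHr.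
- by rewrite tens_scale_pure scale1r.
Qed.

Lemma tens_scaleDl q : {morph tens_scale^~ q : b b' / b + b'}.
Proof.
move=> b b'; elim/tens_ind: q => [|q r IHq IHr|u x].
- by rewrite !tens_scale0 addr0.
- by rewrite !tens_scaleDr IHq IHr addrACA.
- by rewrite !tens_scale_pure scalerDl; case: pure_balanced => ->.
Qed.

HB.instance Definition _ := GRing.Zmodule_isLmodule.Build B tensor
  tens_scaleA tens_scale1 tens_scaleDr tens_scaleDl.

Lemma scale_pure (b : B) u x : b *: tpure u x = tpure (b *: u) x.
Proof. exact: tens_scale_pure. Qed.

Lemma pureDl u u' x : tpure (u + u') x = tpure u x + tpure u' x.
Proof. by case: pure_balanced. Qed.

Lemma pureDr u x x' : tpure u (x + x') = tpure u x + tpure u x'.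
Proof. by case: pure_balanced. Qed.

Lemma pure0l x : tpure 0 x = 0.
Proof. by apply: (addrI (tpure 0 x)); rewrite -pureDl !addr0. Qed.

Lemma pure0r u : tpure u 0 = 0.
Proof. by apply: (addrI (tpure u 0)); rewrite -pureDr !addr0. Qed.

Lemma pureM u a x : tpure (ract u a) x = tpure u (a *: x).
Proof. by case: pure_balanced. Qed.

End Tensor.

(* U (x)_A f. *)
Section TensorMap.
Variables (A B : pzRingType) (U : bimodule B A) (X X' : lmodType A).
Variable f : {linear X -> X'}.

Definition tens_map : tensor U X -> tensor U X' :=
  tens_lift (fun u x => tpure u (f x)).

Lemma tens_map_balanced :
  balanced (fun (u : U) x => tpure u (f x) : tensor U X').
Proof.
by split=> *; rewrite ?linearD ?pureDl ?pureDr // linearZ_LR pureM.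
Qed.

Lemma tens_map_pure u x : tens_map (tpure u x) = tpure u (f x).
Proof. by rewrite /tens_map tens_lift_pure //; apply: tens_map_balanced. Qed.

Lemma tens_map_is_linear : linear tens_map.
Proof.
move=> b q r; rewrite /tens_map (tens_liftD tens_map_balanced); congr (_ + _).
elim/tens_ind: q => [|q r' IHq IHr|u x].
- by rewrite scaler0 [LHS]tens_lift_zero ?[X in _ *: X]tens_lift_zero
    ?scaler0 //;
    apply: tens_map_balanced.
- by rewrite scalerDr !(tens_liftD tens_map_balanced) scalerDr IHq IHr.
- by rewrite scale_pure -/tens_map !tens_map_pure scale_pure.
Qed.

HB.instance Definition _ := GRing.isLinear.Build B _ _ _ tens_map
  tens_map_is_linear.

End TensorMap.

Arguments tens_map {A B} U {X X'} f.

(* Hom_B(U, Y) as a left A-module, with (a h)(u) = h(u a). *)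
Section HomModule.
Variables (A B : pzRingType) (U : bimodule B A) (Y : lmodType B).

Record hom_module := HomModule {
  hom_fun :> U -> Y; hom_linear : linear hom_fun }.

HB.instance Definition _ := gen_eqMixin hom_module.
HB.instance Definition _ := gen_choiceMixin hom_module.

HB.instance Definition _ (h : hom_module) :=
  GRing.isLinear.Build B U Y _ (hom_fun h) (@hom_linear h).

Lemma homP (h k : hom_module) : h =1 k -> h = k.
Proof.
case: h k => [h hl] [k kl] /= /funext hk; subst k.
by rewrite (Prop_irrelevance hl kl).
Qed.

Lemma hom_zero_subproof : linear (fun _ : U => 0 : Y).
Proof. by move=> b u u'; rewrite scaler0 addr0. Qed.

Lemma hom_opp_subproof (h : hom_module) : linear (fun u => - h u).
Proof. by move=> b u u'; rewrite linearP opprD scalerN. Qed.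

Lemma hom_add_subproof (h k : hom_module) : linear (fun u => h u + k u).
Proof. by move=> b u u'; rewrite !linearP scalerDr addrACA. Qed.

Lemma hom_scale_subproof (a : A) (h : hom_module) :
  linear (fun u => h (ract u a)).
Proof. by move=> b u u'; rewrite ractDl ractZ linearP. Qed.

Definition hom_zero := HomModule hom_zero_subproof.
Definition hom_opp h := HomModule (hom_opp_subproof h).
Definition hom_add h k := HomModule (hom_add_subproof h k).
Definition hom_scale a h := HomModule (hom_scale_subproof a h).

Lemma hom_addA : associative hom_add.
Proof. by move=> h k l; apply: homP => u /=; rewrite addrA. Qed.

Lemma hom_addC : commutative hom_add.
Proof. by move=> h k; apply: homP => u /=; rewrite addrC. Qed.

Lemma hom_add0 : left_id hom_zero hom_add.
Proof. by move=> h; apply: homP => u /=; rewrite add0r. Qed.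

Lemma hom_addN : left_inverse hom_zero hom_opp hom_add.
Proof. by move=> h; apply: homP => u /=; rewrite addNr. Qed.

HB.instance Definition _ :=
  GRing.isZmodule.Build hom_module hom_addA hom_addC hom_add0 hom_addN.

Lemma hom_scaleA a a' h : hom_scale a (hom_scale a' h) = hom_scale (a * a') h.
Proof. by apply: homP => u /=; rewrite ractM. Qed.

Lemma hom_scale1 : left_id 1 hom_scale.
Proof. by move=> h; apply: homP => u /=; rewrite ract1. Qed.

Lemma hom_scaleDr : right_distributive hom_scale +%R.
Proof. by move=> a h k; apply: homP. Qed.

Lemma hom_scaleDl h : {morph hom_scale^~ h : a a' / a + a'}.
Proof. by move=> a a'; apply: homP => u /=; rewrite ractDr linearD. Qed.

HB.instance Definition _ := GRing.Zmodule_isLmodule.Build A hom_module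
  hom_scaleA hom_scale1 hom_scaleDr hom_scaleDl.

End HomModule.

(* Hom_B(U, f). *)
Section HomMap.
Variables (A B : pzRingType) (U : bimodule B A) (Y Y' : lmodType B).
Variable f : {linear Y -> Y'}.

Lemma hom_map_subproof (h : hom_module U Y) : linear (fun u => f (h u)).
Proof. by move=> b u u'; rewrite !linearP. Qed.

Definition hom_map (h : hom_module U Y) : hom_module U Y' :=
  HomModule (hom_map_subproof h).

Lemma hom_map_is_linear : linear hom_map.
Proof. by move=> a h k; apply: homP => u /=; rewrite linearD. Qed.

HB.instance Definition _ := GRing.isLinear.Build A _ _ _ hom_map
  hom_map_is_linear.

End HomMap.

Arguments hom_map {A B} U {Y Y'} f.

(* The map X -> Hom_B(U, Y) adjoint to f : U (x)_A X -> Y. *)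
Section Adjoint.
Variables (A B : pzRingType) (U : bimodule B A) (X : lmodType A).
Variables (Y : lmodType B) (f : {linear tensor U X -> Y}).

Lemma adj_subproof (x : X) : linear (fun u : U => f (tpure u x)).
Proof. by move=> b u u'; rewrite pureDl -scale_pure linearP. Qed.

Definition adj (x : X) : hom_module U Y := HomModule (adj_subproof x).

Lemma adj_is_linear : linear adj.
Proof.
by move=> a x x'; apply: homP => u /=; rewrite pureDr linearD -pureM.
Qed.

HB.instance Definition _ := GRing.isLinear.Build A _ _ _ adj adj_is_linear.

End Adjoint.

(* Tor_i^A(U, X) = 0, where Tor_i^A(U, X) is the homology of the complex
   ... -> U (x)_A P_1 -> U (x)_A P_0 for projective resolutions P of X. *)
Definition Tor_eq0 (A B : pzRingType) (i : nat) (U : bimodule B A)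
    (X : lmodType A) : Prop :=
  forall P : resolution X, projective_resolution P ->
  match i with
  | 0%N => surjective_map (tens_map U (res_d P 0%N))
  | j.+1 => exact_at (tens_map U (res_d P j.+1)) (tens_map U (res_d P j))
  end.

Section MoritaRing.
Variables (A B : pzRingType) (V : bimodule A B) (U : bimodule B A).

(* Lambda_(0,0): the matrices (a v; u b). *)
Record morita := Morita { m11 : A; m12 : V; m21 : U; m22 : B }.

HB.instance Definition _ := gen_eqMixin morita.
HB.instance Definition _ := gen_choiceMixin morita.

Definition morita_zero := Morita 0 0 0 0.
Definition morita_one := Morita 1 0 0 1.
Definition morita_opp (p : morita) :=
  Morita (- m11 p) (- m12 p) (- m21 p) (- m22 p).
Definition morita_add (p q : morita) :=
  Morita (m11 p + m11 q) (m12 p + m12 q) (m21 p + m21 q) (m22 p + m22 q).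
Definition morita_mul (p q : morita) :=
  Morita (m11 p * m11 q) (m11 p *: m12 q + ract (m12 p) (m22 q))
         (ract (m21 p) (m11 q) + m22 p *: m21 q) (m22 p * m22 q).

Lemma morita_addA : associative morita_add.
Proof. by case=> ? ? ? ? [? ? ? ?] [? ? ? ?]; congr Morita; apply: addrA. Qed.

Lemma morita_addC : commutative morita_add.
Proof. by case=> ? ? ? ? [? ? ? ?]; congr Morita; apply: addrC. Qed.

Lemma morita_add0 : left_id morita_zero morita_add.
Proof. by case=> ? ? ? ?; congr Morita; apply: add0r. Qed.

Lemma morita_addN : left_inverse morita_zero morita_opp morita_add.
Proof. by case=> ? ? ? ?; congr Morita; apply: addNr. Qed.

HB.instance Definition _ :=
  GRing.isZmodule.Build morita morita_addA morita_addC morita_add0 morita_addN.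

Lemma morita_mulA : associative morita_mul.
Proof.
case=> a1 v1 u1 b1 [a2 v2 u2 b2] [a3 v3 u3 b3]; congr Morita => /=;
  rewrite ?mulrA // ?scalerDr ?ractDl scalerA ractM ractZ addrA //.
Qed.

Lemma morita_mul1l : left_id morita_one morita_mul.
Proof.
by case=> a v u b; congr Morita;
  rewrite /= ?mul1r // ?scale1r ract0l ?addr0 ?add0r.
Qed.

Lemma morita_mul1r : right_id morita_one morita_mul.
Proof.
by case=> a v u b; congr Morita;
  rewrite /= ?mulr1 // ?ract1 scaler0 ?addr0 ?add0r.
Qed.

Lemma morita_mulDl : left_distributive morita_mul morita_add.
Proof.
case=> a1 v1 u1 b1 [a2 v2 u2 b2] [a3 v3 u3 b3]; congr Morita => /=;
  by rewrite ?mulrDl // ractDl scalerDl addrACA.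
Qed.

Lemma morita_mulDr : right_distributive morita_mul morita_add.
Proof.
case=> a1 v1 u1 b1 [a2 v2 u2 b2] [a3 v3 u3 b3]; congr Morita => /=;
  by rewrite ?mulrDr // ractDr scalerDr addrACA.
Qed.

HB.instance Definition _ := GRing.Zmodule_isPzRing.Build morita
  morita_mulA morita_mul1l morita_mul1r morita_mulDl morita_mulDr.

(* The tuples (X, Y, f, g); the corresponding [X, Y, f, g] has structure maps
   [adj (tup_f T)] and [adj (tup_g T)]. *)
Record morita_tuple := MoritaTuple {
  tup_X : lmodType A;
  tup_Y : lmodType B;
  tup_f : {linear tensor U tup_X -> tup_Y};
  tup_g : {linear tensor V tup_Y -> tup_X};
  tup_gf : forall z, tup_g (tens_map V tup_f z) = 0;
  tup_fg : forall z, tup_f (tens_map U tup_g z) = 0 }.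

(* The left module of column vectors (x, y) attached to a tuple. *)
Section TupleModule.
Variable T : morita_tuple.
Let X := tup_X T.
Let Y := tup_Y T.

Definition tuple_module := (X * Y)%type.

HB.instance Definition _ := GRing.Zmodule.on tuple_module.

Definition tuple_scale (p : morita) (z : tuple_module) : tuple_module :=
  (m11 p *: z.1 + tup_g T (tpure (m12 p) z.2),
   tup_f T (tpure (m21 p) z.1) + m22 p *: z.2).

Lemma tup_gf_pure v u x : tup_g T (tpure v (tup_f T (tpure u x))) = 0.
Proof. by rewrite -tens_map_pure tup_gf. Qed.

Lemma tup_fg_pure u v y : tup_f T (tpure u (tup_g T (tpure v y))) = 0.
Proof. by rewrite -tens_map_pure tup_fg. Qed.

Lemma tuple_scaleA p q z :
  tuple_scale p (tuple_scale q z) = tuple_scale (p * q) z.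
Proof.
congr pair => /=.
- rewrite !pureDr linearD /= tup_gf_pure add0r -pureM scalerDr scalerA.
  by rewrite -[_ *: tup_g _ _]linearZ_LR scale_pure pureDl linearD addrA.
- rewrite !pureDr linearD /= tup_fg_pure addr0 -pureM scalerDr scalerA.
  by rewrite -[_ *: tup_f _ _]linearZ_LR scale_pure pureDl linearD addrA.
Qed.

Lemma tuple_scale1 : left_id 1 tuple_scale.
Proof.
case=> x y; rewrite /tuple_scale /= !pure0l !linear0.
by rewrite !scale1r addr0 add0r.
Qed.

Lemma tuple_scaleDr : right_distributive tuple_scale +%R.
Proof.
by move=> p [x y] [x' y']; rewrite /tuple_scale /=; congr pair => /=;
  rewrite pureDr linearD scalerDr addrACA.
Qed.

Lemma tuple_scaleDl z : {morph tuple_scale^~ z : p q / p + q}.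
Proof.
by move=> p q; congr pair; rewrite /= pureDl linearD scalerDl addrACA.
Qed.

HB.instance Definition _ := GRing.Zmodule_isLmodule.Build morita tuple_module
  tuple_scaleA tuple_scale1 tuple_scaleDr tuple_scaleDl.

End TupleModule.

Section Classes.
Variables (C : lmodType A -> Prop) (D : lmodType B -> Prop).

Definition class_U (M : lmodType morita) : Prop :=
  exists T : morita_tuple,
    [/\ isomorphic M (tuple_module T), C (tup_X T) & D (tup_Y T)].

Definition class_B (M : lmodType morita) : Prop :=
  exists T : morita_tuple,
    [/\ isomorphic M (tuple_module T),
        coker_in D (tup_f T), coker_in C (tup_g T),
        exact_at (tens_map V (tup_f T)) (tup_g T)
      & exact_at (tens_map U (tup_g T)) (tup_f T)].

Definition class_J (M : lmodType morita) : Prop :=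
  exists T : morita_tuple,
    [/\ isomorphic M (tuple_module T),
        ker_in C (adj (tup_f T)), ker_in D (adj (tup_g T)),
        exact_at (adj (tup_f T)) (hom_map U (adj (tup_g T)))
      & exact_at (adj (tup_g T)) (hom_map V (adj (tup_f T)))].

End Classes.

End MoritaRing.

Arguments class_U {A B} V U C D M.
Arguments class_B {A B} V U C D M.
Arguments class_J {A B} V U C D M.

(* Every module over the Morita ring comes from a tuple. *)
Section Corner.
Variables (S R : pzRingType) (M : lmodType S) (phi : R -> S).
Hypothesis phiD : {morph phi : a b / a + b}.
Hypothesis phiM : {morph phi : a b / a * b}.

Definition corner_pred of {morph phi : a b / a + b}
  & {morph phi : a b / a * b} : {pred M} := fun m => phi 1 *: m == m.

Lemma corner_closed : zmod_closed (corner_pred phiD phiM).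
Proof.
split=> [|m m']; rewrite !unfold_in ?scaler0 // => /eqP em /eqP em'.
by rewrite scalerBr em em'.
Qed.

HB.instance Definition _ :=
  GRing.isZmodClosed.Build M (corner_pred phiD phiM) corner_closed.

Record corner := Corner {
  corner_val : M; corner_valP : corner_val \in corner_pred phiD phiM }.

HB.instance Definition _ := [isSub for corner_val].
HB.instance Definition _ := [Choice of corner by <:].
HB.instance Definition _ := [SubChoice_isSubZmodule of corner by <:].

Lemma cornerE (x : corner) : phi 1 *: corner_val x = corner_val x.
Proof. by apply/eqP; case: x. Qed.

Lemma corner_in (m : M) : phi 1 *: m \in corner_pred phiD phiM.
Proof. by rewrite unfold_in scalerA -phiM mulr1. Qed.

Lemma corner_scale_subproof a (x : corner) :
  phi a *: corner_val x \in corner_pred phiD phiM.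
Proof. by rewrite unfold_in scalerA -phiM mul1r. Qed.

Definition corner_scale a x := Corner (corner_scale_subproof a x).

Lemma corner_scaleA a b x :
  corner_scale a (corner_scale b x) = corner_scale (a * b) x.
Proof. by apply: val_inj; rewrite /= scalerA phiM. Qed.

Lemma corner_scale1 : left_id 1 corner_scale.
Proof. by move=> x; apply: val_inj; rewrite /= cornerE. Qed.

Lemma corner_scaleDr : right_distributive corner_scale +%R.
Proof. by move=> a x y; apply: val_inj; rewrite /= scalerDr. Qed.

Lemma corner_scaleDl x : {morph corner_scale^~ x : a b / a + b}.
Proof. by move=> a b; apply: val_inj; rewrite /= phiD scalerDl. Qed.

HB.instance Definition _ := GRing.Zmodule_isLmodule.Build R corner
  corner_scaleA corner_scale1 corner_scaleDr corner_scaleDl.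

Lemma corner_valZ a (x : corner) : corner_val (a *: x) = phi a *: corner_val x.
Proof. by []. Qed.

End Corner.

Section TupleOfModule.
Variables (A B : pzRingType) (V : bimodule A B) (U : bimodule B A).
Variable M : lmodType (morita V U).

Let i11 (a : A) : morita V U := Morita a 0 0 0.
Let i12 (v : V) : morita V U := Morita 0 v 0 0.
Let i21 (u : U) : morita V U := Morita 0 0 u 0.
Let i22 (b : B) : morita V U := Morita 0 0 0 b.

Let i11D : {morph i11 : a b / a + b}.
Proof. by move=> a b; congr Morita; rewrite /= addr0. Qed.
Let i22D : {morph i22 : a b / a + b}.
Proof. by move=> a b; congr Morita; rewrite /= addr0. Qed.
Let i12D : {morph i12 : a b / a + b}.
Proof. by move=> a b; congr Morita; rewrite /= addr0. Qed.
Let i21D : {morph i21 : a b / a + b}.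
Proof. by move=> a b; congr Morita; rewrite /= addr0. Qed.

Let simp := (mulr0, mul0r, scaler0, scale0r, @ract0l, @ract0r, addr0, add0r,
             mulr1, mul1r, scale1r, @ract1).

Let mE (p q : morita V U) : p * q = morita_mul p q. Proof. by []. Qed.

Let i11M : {morph i11 : a b / a * b}.
Proof. by move=> a b; rewrite mE /morita_mul /= !simp. Qed.
Let i22M : {morph i22 : a b / a * b}.
Proof. by move=> a b; rewrite mE /morita_mul /= !simp. Qed.

Let X := corner M i11D i11M.
Let Y := corner M i22D i22M.

Let f0P (u : U) (x : X) : i21 u *: corner_val x
  \in corner_pred (M := M) i22D i22M.
Proof. by rewrite unfold_in scalerA mE /morita_mul /= !simp. Qed.
Let g0P (v : V) (y : Y) : i12 v *: corner_val y
  \in corner_pred (M := M) i11D i11M.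
Proof. by rewrite unfold_in scalerA mE /morita_mul /= !simp. Qed.

Let f0 (u : U) (x : X) : Y := Corner (f0P u x).
Let g0 (v : V) (y : Y) : X := Corner (g0P v y).

Let f0B : balanced f0.
Proof.
split=> [u u' x|u x x'|u a x]; apply: val_inj => /=.
- by rewrite i21D scalerDl.
- by rewrite scalerDr.
- by rewrite scalerA mE /morita_mul /= !simp.
Qed.

Let g0B : balanced g0.
Proof.
split=> [u u' x|u x x'|u a x]; apply: val_inj => /=.
- by rewrite i12D scalerDl.
- by rewrite scalerDr.
- by rewrite scalerA mE /morita_mul /= !simp.
Qed.

Let f := tens_lift f0 : tensor U X -> Y.
Let g := tens_lift g0 : tensor V Y -> X.

Let f_lin : linear f.
Proof.
move=> b q r; rewrite /f tens_liftD //; congr (_ + _).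
elim/tens_ind: q => [|q r' IHq IHr|u x].
- by rewrite scaler0 !tens_lift_zero // scaler0.
- by rewrite scalerDr !tens_liftD // scalerDr IHq IHr.
- rewrite scale_pure !tens_lift_pure //; apply: val_inj => /=.
  by rewrite scalerA mE /morita_mul /= !simp.
Qed.

Let g_lin : linear g.
Proof.
move=> b q r; rewrite /g tens_liftD //; congr (_ + _).
elim/tens_ind: q => [|q r' IHq IHr|u x].
- by rewrite scaler0 !tens_lift_zero // scaler0.
- by rewrite scalerDr !tens_liftD // scalerDr IHq IHr.
- rewrite scale_pure !tens_lift_pure //; apply: val_inj => /=.
  by rewrite scalerA mE /morita_mul /= !simp.
Qed.

Let fL : {linear tensor U X -> Y} :=
  HB.pack f (GRing.isLinear.Build _ _ _ _ f f_lin).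
Let gL : {linear tensor V Y -> X} :=
  HB.pack g (GRing.isLinear.Build _ _ _ _ g g_lin).

Let f_pure u x : f (tpure u x) = f0 u x. Proof. exact: tens_lift_pure. Qed.
Let g_pure v y : g (tpure v y) = g0 v y. Proof. exact: tens_lift_pure. Qed.

Let gf z : gL (tens_map V fL z) = 0.
Proof.
elim/tens_ind: z => [|q r IHq IHr|v z]; rewrite ?linear0 //.
  by rewrite !linearD IHq IHr addr0.
rewrite tens_map_pure; elim/tens_ind: z => [|q r IHq IHr|u x].
- by rewrite linear0 pure0r linear0.
- by rewrite linearD pureDr linearD IHq IHr addr0.
- rewrite /= f_pure g_pure; apply: val_inj => /=.
  by rewrite scalerA mE /morita_mul /= !simp.
Qed.

Let fg z : fL (tens_map U gL z) = 0.
Proof.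
elim/tens_ind: z => [|q r IHq IHr|v z]; rewrite ?linear0 //.
  by rewrite !linearD IHq IHr addr0.
rewrite tens_map_pure; elim/tens_ind: z => [|q r IHq IHr|u x].
- by rewrite linear0 pure0r linear0.
- by rewrite linearD pureDr linearD IHq IHr addr0.
- rewrite /= g_pure f_pure; apply: val_inj => /=.
  by rewrite scalerA mE /morita_mul /= !simp.
Qed.

Let T : morita_tuple V U := MoritaTuple gf fg.

Let phi (m : M) : tuple_module T :=
  (Corner (corner_in i11D i11M m), Corner (corner_in i22D i22M m)).

Let phi_lin : linear phi.
Proof.
move=> p m m'; congr pair; apply: val_inj => /=.
- rewrite g_pure /= scalerDr !scalerA -scalerDl; congr (_ *: _ + _).
  by case: p => a v u b; rewrite !mE /morita_mul /=;
    congr Morita; rewrite /= !simp.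
- rewrite f_pure /= scalerDr !scalerA -scalerDl; congr (_ *: _ + _).
  by case: p => a v u b; rewrite !mE /morita_mul /=;
    congr Morita; rewrite /= !simp.
Qed.

Lemma tuple_of_module :
  exists T : morita_tuple V U, isomorphic M (tuple_module T).
Proof.
pose phiL : {linear M -> tuple_module T} :=
  HB.pack phi (GRing.isLinear.Build _ _ _ _ phi phi_lin).
exists T; exists phiL.
exists (fun z => corner_val z.1 + corner_val z.2) => [m|[x y]] /=.
- rewrite -scalerDl -[RHS]scale1r; congr (_ *: _).
  by congr Morita; rewrite /= !simp.
- congr pair; apply: val_inj => /=; rewrite scalerDr.
  + rewrite (cornerE x) -(cornerE y) scalerA.
    by rewrite mE /morita_mul /= !simp.
  + rewrite (cornerE y) -(cornerE x) scalerA.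
    by rewrite mE /morita_mul /= !simp.
Qed.

End TupleOfModule.

(* Main.v *)
From HB Require Import structures.
Require Import Defs.
From mathcomp Require Import all_boot ssralg ring_quotient.
From mathcomp Require Import boolp.

(** Write Z(X) = (X, 0) for an A-module X regarded as a module over the Morita
    ring, T(X) = (X, U (x) X) for the module induced from X, and
    H(X) = [X, Hom(V, X)] for the coinduced one.  The functors T and H are the
    left and the right adjoint of the exact functor sending (X, Y) to X.

    Vanishing of Ext.  By adjunction Ext^i(M, H(C)) and Ext^i(X, C) agree for a
    module M with A-component X as long as Ext^j(V, C) = 0 for 1 <= j <= i,
    because the A-component of a free module over the Morita ring is a direct
    sum of copies of A and V ([coind_Ext]).  For M = Z(X) the first term of a
    projective resolution can be taken to be T(P) with P projective, whose
    A-component is projective; this gains the degree n + 1 needed for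
    heredity ([coind_Ext_top]).  As Z(X) is in the class U and H(C) is in the
    class J, the vanishing of Ext passes from the Morita ring to A.  Dually,
    Ext^i(T(X), Z(C)) = 0 implies Ext^i(X, C) = 0 as soon as
    Tor_j(U, X) = 0 for 1 <= j < i, since T then preserves the exactness of
    the beginning of a projective resolution of X ([ind_Ext]).

    Approximations.  Approximate Z(M) over the Morita ring and take
    A-components.  The point is to control the A-component of a module K with
    a finite resolution by members of J.  If J' -> J -> K is a short exact
    sequence with J' and J in the class J, then Ext^1(U, Ker g') = 0 makes the
    kernels of the structure maps form short exact sequences and puts K in the
    class J ([kerf_ses], [coind_exact]).  By induction Ker f and Ker g have
    finite resolutions by members of C_2 and D_2 ([coind_wedge]).  Finally
    X is an extension of Hom(U, Ker g) by Ker f ([coind_extension]), and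
    Hom(U, Ker g) has a finite C_2-resolution because Hom(U, -) keeps the
    resolution of Ker g exact; closure under extensions concludes.  Part (2)
    is dual, with cokernels, U (x) - and Tor ([ind_vee], [ind_extension]).

    Symmetry.  Everything is proved for the A-component over a ring S with an
    isomorphism onto the Morita ring.  The B-component is the same statement
    for the exchange of the two corners.

    Ext and Tor are handled through one inductive notion of vanishing
    ([vanishing]), in which the long exact sequences needed reduce to the
    horseshoe lemma and to pullbacks, so that no derived functor is ever
    constructed. *)

Set Implicit Arguments.
Unset Strict Implicit.
Unset Printing Implicit Defensive.

Import GRing.Theory.

Local Open Scope ring_scope.
Local Open Scope quotient_scope.

(** * Linear maps, kernels and short exact sequences *)

Section LinearMaps.
Variable S : pzRingType.
Implicit Types K L M N : lmodType S.

Definition mklin M N (f : M -> N) (h : linear f) : {linear M -> N} :=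
  HB.pack f (GRing.isLinear.Build _ _ _ _ f h).

Lemma factor_surj L M N (p : {linear L -> M}) (f : {linear L -> N}) :
  surjective_map p -> (forall x, p x = 0 -> f x = 0) ->
  exists h : {linear M -> N}, forall x, h (p x) = f x.
Proof.
move=> /choice[s sK] pf.
have hp x : f (s (p x)) = f x.
  by apply/eqP; rewrite -subr_eq0 -linearB pf // linearB sK subrr.
have hlin : linear (fun y => f (s y)).
  by move=> a y y'; rewrite -[y in LHS]sK -[y' in LHS]sK -linearP hp linearP.
by exists (mklin hlin).
Qed.

Lemma factor_inj K L M (i : {linear K -> L}) (f : {linear M -> L}) :
  injective i -> (forall x, exists k, i k = f x) ->
  exists h : {linear M -> K}, forall x, i (h x) = f x.
Proof.
move=> i_inj /choice[s sK].
have hlin : linear s.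
  by move=> a x y; apply: i_inj; rewrite linearP !sK linearP.
by exists (mklin hlin).
Qed.

Lemma linear_bij M N (f : {linear M -> N}) :
  injective f -> surjective_map f -> bijective f.
Proof.
move=> f_inj /choice[s sK]; exists s => // x; exact/f_inj/sK.
Qed.

Lemma iso_inverse M N (f : {linear M -> N}) : bijective f ->
  exists g : {linear N -> M}, cancel f g /\ cancel g f.
Proof.
move=> fb; have [g fK gK] := fb.
have [h hE] := @factor_inj _ _ _ f (idfun : {linear N -> N}) (bij_inj fb)
  (fun y => ex_intro _ (g y) (gK y)).
by exists h; split=> // x; apply: (bij_inj fb); rewrite hE.
Qed.

Lemma iso_refl M : isomorphic M M.
Proof. by exists (idfun : {linear M -> M}); exists id. Qed.

Lemma iso_sym M N : isomorphic M N -> isomorphic N M.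
Proof. by case=> f /iso_inverse[g [fK gK]]; exists g; exists f. Qed.

Lemma iso_trans M N L : isomorphic M N -> isomorphic N L -> isomorphic M L.
Proof.
case=> f fb [g gb]; exists (g \o f : {linear M -> L}); exact: bij_comp.
Qed.

Lemma exact_at0 K L M (f : {linear K -> L}) (g : {linear L -> M}) x :
  exact_at f g -> g (f x) = 0.
Proof. by move=> e; apply/e; exists x. Qed.

Lemma exact_at_comp (Q K L M : lmodType S) (p : {linear Q -> K}) (f : {linear K -> L})
    (g : {linear L -> M}) :
  surjective_map p -> exact_at f g -> exact_at (f \o p : {linear Q -> L}) g.
Proof.
move=> ps e x; split=> [/e[k <-]|[q <-]]; last exact: (exact_at0 (p q) e).
by have [q <-] := ps k; exists q.
Qed.

Lemma exact_at_inj (K L M N : lmodType S) (f : {linear K -> L}) (g : {linear L -> M})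
    (h : {linear M -> N}) :
  injective h -> exact_at f g -> exact_at f (h \o g : {linear L -> N}).
Proof.
move=> hi e x; split=> [hgx|/e /= ->]; last exact: linear0.
by apply/e/hi; rewrite linear0.
Qed.

Definition ker_pred M N (f : {linear M -> N}) : {pred M} := fun x => f x == 0.

Section Kernel.
Variables (M N : lmodType S) (f : {linear M -> N}).

Lemma ker_pred_closed : submod_closed (ker_pred f).
Proof.
split=> [|a x y]; rewrite !unfold_in ?linear0 // => /eqP fx /eqP fy.
by rewrite linearP fx fy scaler0 addr0.
Qed.

HB.instance Definition _ :=
  GRing.isSubmodClosed.Build S M (ker_pred f) ker_pred_closed.

Record ker_module := KerModule { ker_val : M; ker_valP : ker_val \in ker_pred f }.

HB.instance Definition _ := [isSub for ker_val].
HB.instance Definition _ := [Choice of ker_module by <:].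
HB.instance Definition _ := [SubChoice_isSubLmodule of ker_module by <:].

Lemma ker_val_linear : linear ker_val. Proof. by []. Qed.
HB.instance Definition _ := GRing.isLinear.Build _ _ _ _ ker_val ker_val_linear.

Lemma ker_valE k : f (ker_val k) = 0.
Proof. by apply/eqP; exact: ker_valP. Qed.

Lemma ker_intro x : f x = 0 -> exists k, ker_val k = x.
Proof. by move=> /eqP fx; exists (KerModule (fx : x \in ker_pred f)). Qed.

Lemma ker_val_inj : injective ker_val. Proof. exact: val_inj. Qed.

Lemma ker_exact : exact_at ker_val f.
Proof. by move=> x; split=> [/ker_intro|[k <-]] //; exact: ker_valE. Qed.

Lemma ker_ses : surjective_map f -> short_exact ker_val f.
Proof. by split=> //; [exact: ker_val_inj|exact: ker_exact]. Qed.

End Kernel.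

Lemma ses_comp0 K L M (f : {linear K -> L}) (g : {linear L -> M}) x :
  short_exact f g -> g (f x) = 0.
Proof. by move=> h; apply/(ses_exact h); exists x. Qed.

Lemma ses_iso_r K L M M' (f : {linear K -> L}) (g : {linear L -> M})
    (e : {linear M -> M'}) : short_exact f g -> bijective e ->
  short_exact f (e \o g : {linear L -> M'}).
Proof.
move=> h eb; split; first exact: ses_inj h.
- move=> x; split=> /=; last first.
    by case=> k <-; rewrite (ses_comp0 _ h) linear0.
  move=> egx; apply/(ses_exact h)/(bij_inj eb); by rewrite egx linear0.
- move=> y; have [e' eK e'K] := eb; have [x xE] := ses_surj h (e' y).
  by exists x; rewrite /= xE e'K.
Qed.

End LinearMaps.

Section DirectSum.
Variables (S : pzRingType) (M N : lmodType S).

Lemma inl_linear : linear (fun x : M => (x, 0) : (M * N)%type).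
Proof. by move=> a x y; congr pair => /=; rewrite ?scaler0 ?addr0. Qed.
Definition inl_lin : {linear M -> (M * N)%type} := mklin inl_linear.

Lemma inr_linear : linear (fun y : N => (0, y) : (M * N)%type).
Proof. by move=> a x y; congr pair => /=; rewrite ?scaler0 ?addr0. Qed.
Definition inr_lin : {linear N -> (M * N)%type} := mklin inr_linear.

Lemma prod_ses : short_exact inl_lin (snd : {linear (M * N)%type -> N}).
Proof.
split; last by move=> y; exists (0, y).
- by move=> x y [].
- by case=> x y; split=> /= [->|[k [_ <-]] //]; exists x.
Qed.

Lemma prod_ses_sym : short_exact inr_lin (fst : {linear (M * N)%type -> M}).
Proof.
split; last by move=> x; exists (x, 0).
- by move=> x y [].
- by case=> x y; split=> /= [->|[k [<- _]] //]; exists y.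
Qed.

End DirectSum.

Section PairMaps.
Variables (S : pzRingType) (L M N : lmodType S).
Variables (f : {linear L -> M}) (g : {linear L -> N}).
Lemma pair_linear : linear (fun x => (f x, g x) : (M * N)%type).
Proof. by move=> a x y; congr pair; rewrite /= linearP. Qed.
Definition pair_lin : {linear L -> (M * N)%type} := mklin pair_linear.
End PairMaps.

(** * Projective covers *)

Section FiniteSupport.
Variables (S : pzRingType) (I : choiceType) (M : lmodType S).

(** The direct sum of copies of M indexed by I. *)
Record fsum := Fsum {
  fs_fun :> I -> M;
  fs_fin : exists s : seq I, forall i, i \notin s -> fs_fun i = 0 }.

HB.instance Definition _ := gen_eqMixin fsum.
HB.instance Definition _ := gen_choiceMixin fsum.

Lemma fsumP (x y : fsum) : x =1 y -> x = y.
Proof.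
case: x y => [x xf] [y yf] /= /funext xy; subst y.
by rewrite (Prop_irrelevance xf yf).
Qed.

Lemma fs0_subproof : exists s : seq I, forall i, i \notin s -> 0 = 0 :> M.
Proof. by exists [::]. Qed.
Lemma fsN_subproof (x : fsum) :
  exists s : seq I, forall i, i \notin s -> - x i = 0.
Proof. by case: (fs_fin x) => s sP; exists s => i /sP ->; rewrite oppr0. Qed.
Lemma fsD_subproof (x y : fsum) :
  exists s : seq I, forall i, i \notin s -> x i + y i = 0.
Proof.
case: (fs_fin x) (fs_fin y) => s sP [t tP]; exists (s ++ t) => i.
by rewrite mem_cat negb_or => /andP[/sP -> /tP ->]; rewrite addr0.
Qed.
Lemma fsZ_subproof (a : S) (x : fsum) :
  exists s : seq I, forall i, i \notin s -> a *: x i = 0.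
Proof. by case: (fs_fin x) => s sP; exists s => i /sP ->; rewrite scaler0. Qed.

Definition fs0 := Fsum fs0_subproof.
Definition fsN x := Fsum (fsN_subproof x).
Definition fsD x y := Fsum (fsD_subproof x y).
Definition fsZ a x := Fsum (fsZ_subproof a x).

Lemma fsDA : associative fsD.
Proof. by move=> x y z; apply: fsumP => i /=; rewrite addrA. Qed.
Lemma fsDC : commutative fsD.
Proof. by move=> x y; apply: fsumP => i /=; rewrite addrC. Qed.
Lemma fs0D : left_id fs0 fsD.
Proof. by move=> x; apply: fsumP => i /=; rewrite add0r. Qed.
Lemma fsND : left_inverse fs0 fsN fsD.
Proof. by move=> x; apply: fsumP => i /=; rewrite addNr. Qed.

HB.instance Definition _ := GRing.isZmodule.Build fsum fsDA fsDC fs0D fsND.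

Lemma fsZA a b x : fsZ a (fsZ b x) = fsZ (a * b) x.
Proof. by apply: fsumP => i /=; rewrite scalerA. Qed.
Lemma fs1Z : left_id 1 fsZ.
Proof. by move=> x; apply: fsumP => i /=; rewrite scale1r. Qed.
Lemma fsZDr : right_distributive fsZ +%R.
Proof. by move=> a x y; apply: fsumP => i /=; rewrite scalerDr. Qed.
Lemma fsZDl x : {morph fsZ^~ x : a b / a + b}.
Proof. by move=> a b; apply: fsumP => i /=; rewrite scalerDl. Qed.

HB.instance Definition _ := GRing.Zmodule_isLmodule.Build S fsum
  fsZA fs1Z fsZDr fsZDl.

Definition supports (s : seq I) (x : fsum) :=
  uniq s /\ forall i, i \notin s -> x i = 0.

Lemma supports_exists x : exists s, supports s x.
Proof.
case: (fs_fin x) => s sP; exists (undup s); split; first exact: undup_uniq.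
by move=> i; rewrite mem_undup => /sP.
Qed.

Lemma supports_exists2 x y : exists s, supports s x /\ supports s y.
Proof.
case: (supports_exists x) (supports_exists y) => s [_ sP] [t [_ tP]].
exists (undup (s ++ t)); split; split; rewrite ?undup_uniq // => i;
  by rewrite mem_undup mem_cat negb_or => /andP[/sP ? /tP ?].
Qed.

Section Lift.
Variables (N : lmodType S) (h : I -> {linear M -> N}).

(** Both sums reduce to the indices common to the two lists. *)
Lemma supports_sum s t x : supports s x -> supports t x ->
  \sum_(i <- s) h i (x i) = \sum_(i <- t) h i (x i).
Proof.
have aux (u v : seq I) : supports v x ->
    \sum_(i <- u) h i (x i) = \sum_(i <- u | i \in v) h i (x i).
  case=> _ vP; rewrite [RHS]big_mkcond; apply: eq_bigr => i _.
  by case: ifPn => // /vP ->; rewrite linear0.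
move=> sx tx; rewrite (aux s t) // (aux t s) // -[LHS]big_filter -[RHS]big_filter.
apply/perm_big/uniq_perm; rewrite ?filter_uniq ?sx.1 ?tx.1 // => i.
by rewrite !mem_filter andbC.
Qed.

Definition fsum_lift_fun (x : fsum) : N :=
  \sum_(i <- projT1 (cid (supports_exists x))) h i (x i).

Lemma fsum_lift_funE s x : supports s x ->
  fsum_lift_fun x = \sum_(i <- s) h i (x i).
Proof.
by rewrite /fsum_lift_fun; case: cid => t tx sx /=; apply: supports_sum.
Qed.

Lemma fsum_lift_linear : linear fsum_lift_fun.
Proof.
move=> a x y; have [s [sx sy]] := supports_exists2 x y.
rewrite (fsum_lift_funE sx) (fsum_lift_funE sy) (@fsum_lift_funE s).
  rewrite scaler_sumr -big_split; apply: eq_bigr => i _ /=.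
  by rewrite linearP.
split=> [|i si]; first exact: sx.1.
by rewrite /= sx.2 // sy.2 // scaler0 addr0.
Qed.

Definition fsum_lift : {linear fsum -> N} := mklin fsum_lift_linear.

End Lift.

Lemma fdelta_subproof i (m : M) :
  exists s : seq I, forall j, j \notin s -> (if j == i then m else 0) = 0.
Proof. by exists [:: i] => j; rewrite inE => /negPf ->. Qed.

Lemma fdelta_linear i : linear (fun m => Fsum (fdelta_subproof i m)).
Proof.
move=> a m m'; apply: fsumP => j /=.
by case: eqP => // _; rewrite scaler0 addr0.
Qed.

Definition fdelta i : {linear M -> fsum} := mklin (fdelta_linear i).

Lemma fdeltaE i m j : fdelta i m j = if j == i then m else 0.
Proof. by []. Qed.

Lemma fsum_sumE J (s : seq J) (F : J -> fsum) i :
  (\sum_(j <- s) F j) i = \sum_(j <- s) F j i.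
Proof. by elim/big_rec2: _ => // j y x _ <-. Qed.

Lemma fsum_decomp s x : supports s x -> x = \sum_(i <- s) fdelta i (x i).
Proof.
case=> us sP; apply: fsumP => j; rewrite fsum_sumE.
have [js|js] := boolP (j \in s).
  rewrite (bigD1_seq j) //= eqxx big1 ?addr0 // => i.
  by rewrite eq_sym => /negPf ->.
rewrite sP // big_seq big1 // => i si.
by rewrite fdeltaE; case: eqP => // ji; rewrite ji si in js.
Qed.

Lemma fsum_lift_delta (N : lmodType S) (h : I -> {linear M -> N}) i m :
  fsum_lift h (fdelta i m) = h i m.
Proof.
rewrite [LHS](@fsum_lift_funE _ _ [:: i]); first by rewrite big_seq1 fdeltaE eqxx.
by split=> // j; rewrite inE fdeltaE => /negPf ->.
Qed.

Lemma fsum_ext (N : lmodType S) (h h' : {linear fsum -> N}) :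
  (forall i m, h (fdelta i m) = h' (fdelta i m)) -> h =1 h'.
Proof.
move=> hh' x; have [s sx] := supports_exists x.
rewrite (fsum_decomp sx) !linear_sum; apply: eq_bigr => i _; exact: hh'.
Qed.

Lemma fsum_projective : projective_module M -> projective_module fsum.
Proof.
move=> PM L N p f ps.
have /choice[h hE] i : exists h : {linear M -> L},
    forall m, p (h m) = f (fdelta i m) by exact: (PM _ _ p (f \o fdelta i)).
exists (fsum_lift h).
apply: (@fsum_ext _ (p \o fsum_lift h : {linear _ -> _})) => i m /=.
by rewrite -hE; congr (p _); exact: fsum_lift_delta.
Qed.

End FiniteSupport.

Section FsumMap.
Variables (S : pzRingType) (I : choiceType) (M N : lmodType S).
Variable f : {linear M -> N}.

Lemma fsum_map_subproof (x : fsum I M) :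
  exists s : seq I, forall i, i \notin s -> f (x i) = 0.
Proof. by case: (fs_fin x) => s sP; exists s => i /sP ->; rewrite linear0. Qed.

Lemma fsum_map_linear : linear (fun x => Fsum (fsum_map_subproof x)).
Proof. by move=> a x y; apply: fsumP => i /=; rewrite linearP. Qed.

Definition fsum_map : {linear fsum I M -> fsum I N} := mklin fsum_map_linear.

Lemma fsum_mapE x i : fsum_map x i = f (x i). Proof. by []. Qed.

Lemma fsum_preimage (y : fsum I N) : (forall i, exists m, f m = y i) ->
  exists x, fsum_map x = y.
Proof.
move=> /choice[s sE].
have sf : exists t : seq I, forall i, i \notin t ->
    (if y i == 0 then 0 else s i) = 0.
  by case: (fs_fin y) => t tP; exists t => i /tP ->; rewrite eqxx.
exists (Fsum sf); apply: fsumP => i /=.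
by case: eqP => [->|_]; rewrite ?linear0 ?sE.
Qed.

End FsumMap.

Arguments fsum_map {S} I {M N} f.
Arguments fdelta {S I M} i.

Lemma fsum_ses (S : pzRingType) (I : choiceType) (K L M : lmodType S)
    (f : {linear K -> L}) (g : {linear L -> M}) :
  short_exact f g -> short_exact (fsum_map I f) (fsum_map I g).
Proof.
move=> h; split.
- move=> x y xy; apply: fsumP => i; apply: (ses_inj h).
  by rewrite -!fsum_mapE xy.
- move=> y; split=> [gy|[x <-]]; last by apply: fsumP => i /=; rewrite (ses_comp0 _ h).
  apply: fsum_preimage => i; apply/(ses_exact h).
  by rewrite -fsum_mapE gy.
- by move=> y; apply: fsum_preimage => i; apply: (ses_surj h).
Qed.

Section ProjectiveCover.
Variable S : pzRingType.
Implicit Types M N : lmodType S.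

Lemma scale_linear M (m : M) : linear (fun a : S^o => (a : S) *: m).
Proof. by move=> a b c; rewrite scalerDl -scalerA. Qed.

Lemma regular_projective : projective_module (S^o : lmodType S).
Proof.
move=> M N p f ps; have [m pm] := ps (f 1).
exists (mklin (scale_linear m)) => a /=.
by rewrite linearZ_LR pm -linearZ_LR /= [a *: _]mulr1.
Qed.

Definition free_cover M : lmodType S := fsum M (S^o : lmodType S).

Lemma free_cover_projective M : projective_module (free_cover M).
Proof. exact/fsum_projective/regular_projective. Qed.

Definition cover_map M : {linear free_cover M -> M} :=
  fsum_lift (fun m => mklin (scale_linear m)).

Lemma cover_map_surj M : surjective_map (cover_map M).
Proof.
move=> m; exists (fdelta m (1 : S^o)).
by rewrite [LHS](fsum_lift_delta (fun m => mklin (scale_linear m))) /= scale1r.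
Qed.

Definition syzygy M : lmodType S := ker_module (cover_map M).

Lemma syzygy_ses M :
  short_exact (@ker_val _ _ _ (cover_map M) : {linear syzygy M -> _})
    (cover_map M).
Proof. exact/ker_ses/cover_map_surj. Qed.

Definition std_syz M i := iter i syzygy M.

Definition std_res M : resolution M.
refine (@Resolution S M (fun i => free_cover (std_syz M i))
  (fun i => (@ker_val _ _ _ (cover_map (std_syz M i))
     \o cover_map (std_syz M i.+1) : {linear _ -> _}))
  (cover_map M) (cover_map_surj (M := M)) _ _).
- exact: exact_at_comp (cover_map_surj (M := _)) (ker_exact _).
- move=> i; apply: exact_at_inj (@ker_val_inj _ _ _ _) _.
  exact: exact_at_comp (cover_map_surj (M := _)) (ker_exact _).
Defined.

Lemma std_res_projective M : projective_resolution (std_res M).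
Proof. by move=> i; apply: free_cover_projective. Qed.

Lemma prod_projective M N : projective_module M -> projective_module N ->
  projective_module (M * N)%type.
Proof.
move=> PM PN L L' p f ps.
have [h hE] := PM _ _ p (f \o @inl_lin _ M N : {linear _ -> _}) ps.
have [k kE] := PN _ _ p (f \o @inr_lin _ M N : {linear _ -> _}) ps.
exists ((h \o fst) \+ (k \o snd) : {linear _ -> _}) => -[x y] /=.
rewrite linearD hE kE /= -linearD; congr (f _).
by congr pair; rewrite ?addr0 ?add0r.
Qed.

End ProjectiveCover.

Global Opaque fdelta fsum_lift fsum_map cover_map.

(** * Splicing and truncating resolutions *)

Section Resolutions.
Variable S : pzRingType.
Implicit Types K L M N : lmodType S.

Section Splice.
Variables (K L M : lmodType S) (f : {linear K -> L}) (g : {linear L -> M}).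
Hypothesis h : short_exact f g.

Definition splice_obj (Q : nat -> lmodType S) i : lmodType S :=
  if i is j.+1 then Q j else L.

Definition splice_d (Q : resolution K) i :
    {linear splice_obj Q i.+1 -> splice_obj Q i} :=
  match i with
  | 0%N => f \o res_aug Q : {linear Q 0%N -> L}
  | j.+1 => res_d Q j
  end.
Arguments splice_d Q i : clear implicits.

Lemma splice_exact (Q : resolution K) i :
  exact_at (splice_d Q i.+1) (splice_d Q i).
Proof.
case: i => [|i] /=; last exact: res_exact.
exact: exact_at_inj (ses_inj h) (@res_aug_exact _ _ Q).
Qed.

Definition splice (Q : resolution K) : resolution M :=
  @Resolution S M (splice_obj Q) (splice_d Q) g (ses_surj h)
    (exact_at_comp (@res_aug_surj _ _ Q) (ses_exact h)) (@splice_exact Q).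

Lemma splice_projective (Q : resolution K) : projective_module L ->
  projective_resolution Q -> projective_resolution (splice Q).
Proof. by move=> PL PQ [|i]; [exact: PL | exact: PQ]. Qed.

End Splice.

Section Cosplice.
Variables (M L K : lmodType S) (f : {linear M -> L}) (g : {linear L -> K}).
Hypothesis h : short_exact f g.

Definition cosplice_d (I : coresolution K) i :
    {linear splice_obj L I i -> splice_obj L I i.+1} :=
  match i with
  | 0%N => cores_aug I \o g : {linear L -> I 0%N}
  | j.+1 => cores_d I j
  end.
Arguments cosplice_d I i : clear implicits.

Lemma cosplice_exact (I : coresolution K) i :
  exact_at (cosplice_d I i) (cosplice_d I i.+1).
Proof.
case: i => [|i] /=; last exact: cores_exact.
exact: exact_at_comp (ses_surj h) (@cores_aug_exact _ _ I).
Qed.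

Definition cosplice (I : coresolution K) : coresolution M :=
  @Coresolution S M (splice_obj L I) (cosplice_d I) f (ses_inj h)
    (exact_at_inj (@cores_aug_inj _ _ I) (ses_exact h)) (@cosplice_exact I).

End Cosplice.

Section Tail.
Variables (M : lmodType S) (P : resolution M).

Lemma tail_aug_exists : exists a : {linear P 1%N -> ker_module (res_aug P)},
  forall x, ker_val (a x) = res_d P 0%N x.
Proof.
apply: factor_inj; first exact: ker_val_inj.
by move=> x; apply/ker_intro/(exact_at0 _ (@res_aug_exact _ _ P)).
Qed.

Definition tail_aug := projT1 (cid tail_aug_exists).
Lemma tail_augE x : ker_val (tail_aug x) = res_d P 0%N x.
Proof. by rewrite /tail_aug; case: cid. Qed.

Lemma tail_aug_surj : surjective_map tail_aug.
Proof.
move=> k; have /(@res_aug_exact _ _ P)[x xE] := ker_valE k.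
by exists x; apply: ker_val_inj; rewrite tail_augE.
Qed.

Lemma tail_aug_exact : exact_at (res_d P 1%N) tail_aug.
Proof.
move=> x; split=> [x0|/(@res_exact _ _ P 0%N) x0].
  by apply/(@res_exact _ _ P 0%N); rewrite -tail_augE x0 linear0.
by apply: ker_val_inj; rewrite tail_augE x0 linear0.
Qed.

Definition tail : resolution (ker_module (res_aug P)) :=
  @Resolution S _ (fun i => P i.+1) (fun i => res_d P i.+1) tail_aug
    tail_aug_surj tail_aug_exact (fun i => @res_exact _ _ P i.+1).

Lemma tail_ses : short_exact (@ker_val _ _ _ (res_aug P)) (res_aug P).
Proof. exact/ker_ses/res_aug_surj. Qed.

End Tail.

Section Cotail.
Variables (M : lmodType S) (I : coresolution M).

Lemma cotail_map_exists : exists a : {linear I 0%N -> ker_module (cores_d I 1%N)},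
  forall x, ker_val (a x) = cores_d I 0%N x.
Proof.
apply: factor_inj; first exact: ker_val_inj.
by move=> x; apply/ker_intro/(exact_at0 _ (@cores_exact _ _ I 0%N)).
Qed.

Lemma cotail_ses : exists a : {linear I 0%N -> ker_module (cores_d I 1%N)},
  short_exact (cores_aug I) a.
Proof.
have [a aE] := cotail_map_exists; exists a; split; first exact: cores_aug_inj.
- move=> x; split=> [x0|/(@cores_aug_exact _ _ I) x0].
    by apply/(@cores_aug_exact _ _ I); rewrite -aE x0 linear0.
  by apply: ker_val_inj; rewrite aE x0 linear0.
- move=> k; have /(@cores_exact _ _ I 0%N)[x xE] := ker_valE k.
  by exists x; apply: ker_val_inj; rewrite aE.
Qed.

Definition cotail : coresolution (ker_module (cores_d I 1%N)) :=
  @Coresolution S _ (fun i => I i.+1) (fun i => cores_d I i.+1)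
    (@ker_val _ _ _ (cores_d I 1%N)) (@ker_val_inj _ _ _ _)
    (@ker_exact _ _ _ _) (fun i => @cores_exact _ _ I i.+1).

End Cotail.

Definition zero_mod : lmodType S := {ffun void -> S^o}.

Lemma zero_modP : zero_module zero_mod.
Proof. by move=> x; apply/ffunP => -[]. Qed.

Lemma zero_linear_inj M N (f : {linear M -> N}) : zero_module M -> injective f.
Proof. by move=> M0 x y _; rewrite (M0 x) (M0 y). Qed.

Definition zero_res : resolution zero_mod.
refine (@Resolution S zero_mod (fun=> zero_mod)
  (fun=> (\0 : {linear zero_mod -> zero_mod})) (\0 : {linear _ -> _}) _ _ _).
- by move=> y; exists 0; rewrite (zero_modP y).
- by move=> y; split=> // _; exists 0; rewrite (zero_modP y).
- by move=> i y; split=> // _; exists 0; rewrite (zero_modP y).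
Defined.

Definition zero_cores : coresolution zero_mod.
refine (@Coresolution S zero_mod (fun=> zero_mod)
  (fun=> (\0 : {linear zero_mod -> zero_mod})) (\0 : {linear _ -> _}) _ _ _).
- by apply/zero_linear_inj/zero_modP.
- by move=> y; split=> // _; exists 0; rewrite (zero_modP y).
- by move=> i y; split=> // _; exists 0; rewrite (zero_modP y).
Defined.

Lemma id_ses_l M :
  short_exact (\0 : {linear zero_mod -> M}) (idfun : {linear M -> M}).
Proof.
split; first exact/zero_linear_inj/zero_modP.
- by move=> x; split=> /= [->|[k <-]] //; exists 0.
- by move=> x; exists x.
Qed.

Lemma id_ses_r M :
  short_exact (idfun : {linear M -> M}) (\0 : {linear M -> zero_mod}).
Proof.
split=> //; first by move=> x; split=> // _; exists x.
by move=> x; exists 0; rewrite (zero_modP x).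
Qed.

Section WedgeVee.
Variable C : lmodType S -> Prop.

Lemma wedge_base m M : C M -> wedge_class C m M.
Proof.
move=> CM; exists 0%N; exists (splice (id_ses_l M) zero_res); split=> // -[|i] //.
by move=> _; apply: zero_modP.
Qed.

Lemma wedge_step m K L M (f : {linear K -> L}) (g : {linear L -> M}) :
  short_exact f g -> C L -> wedge_class C m K -> wedge_class C m.+1 M.
Proof.
move=> h CL [k [Q [km CQ Q0]]]; exists k.+1; exists (splice h Q).
by split=> // -[|i] //; [exact: CQ | exact: Q0].
Qed.

(** A member of C^/\ either is isomorphic to a member of C or is the end of a
    short exact sequence whose kernel term has a shorter resolution.  The index
    of W bounds the length, so the base case is required at every index. *)
Lemma wedge_ind (W : nat -> lmodType S -> Prop) :
  (forall M N, isomorphic M N -> C M -> C N) ->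
  (forall m M, C M -> W m M) ->
  (forall m K L M (f : {linear K -> L}) (g : {linear L -> M}),
     short_exact f g -> C L -> wedge_class C m K -> W m K -> W m.+1 M) ->
  forall m M, wedge_class C m M -> W m M.
Proof.
move=> isoC W0 WS; elim=> [|m IH] M [k [P [km CP P0]]].
all: case: k km CP P0 => [|k] km CP P0 //.
1,2: apply/W0/isoC/(CP 0%N) => //; exists (res_aug P); apply: linear_bij;
  last exact: res_aug_surj.
1,2: move=> x y xy; apply/eqP; rewrite -subr_eq0; apply/eqP.
1,2: have /(@res_aug_exact _ _ P)[z <-] : res_aug P (x - y) = 0
    by rewrite linearB xy subrr.
1,2: by rewrite (P0 1%N _ z) ?linear0.
have wt : wedge_class C m (ker_module (res_aug P)).
  exists k; exists (tail P); split=> // i ik; first exact: CP.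
  exact: P0.
exact: WS (tail_ses P) (CP 0%N isT) wt (IH _ wt).
Qed.

Lemma vee_base m M : C M -> vee_class C m M.
Proof.
move=> CM; exists 0%N; exists (cosplice (id_ses_r M) zero_cores).
by split=> // -[|i] // _; apply: zero_modP.
Qed.

Lemma vee_step m K L M (f : {linear M -> L}) (g : {linear L -> K}) :
  short_exact f g -> C L -> vee_class C m K -> vee_class C m.+1 M.
Proof.
move=> h CL [k [Q [km CQ Q0]]]; exists k.+1; exists (cosplice h Q).
by split=> // -[|i] //; [exact: CQ | exact: Q0].
Qed.

Lemma vee_ind (W : nat -> lmodType S -> Prop) :
  (forall M N, isomorphic M N -> C M -> C N) ->
  (forall m M, C M -> W m M) ->
  (forall m K L M (f : {linear M -> L}) (g : {linear L -> K}),
     short_exact f g -> C L -> vee_class C m K -> W m K -> W m.+1 M) ->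
  forall m M, vee_class C m M -> W m M.
Proof.
move=> isoC W0 WS; elim=> [|m IH] M [k [P [km CP P0]]].
all: case: k km CP P0 => [|k] km CP P0 //.
1,2: apply/W0/isoC/(CP 0%N) => //; apply: iso_sym; exists (cores_aug P).
1,2: apply: linear_bij; first exact: cores_aug_inj.
1,2: by move=> x; apply/(@cores_aug_exact _ _ P)/(P0 1%N).
have wt : vee_class C m (ker_module (cores_d P 1%N)).
  exists k; exists (cotail P); split=> // i ik; first exact: CP.
  exact: P0.
have [a ha] := cotail_ses P.
exact: WS ha (CP 0%N isT) wt (IH _ wt).
Qed.

End WedgeVee.

End Resolutions.

Arguments splice_projective {S K L M f g} h {Q}.

(** * Vanishing of derived functors by dimension shifting *)

Section Derived.
Variable S : pzRingType.
Implicit Types E K L M N P Q : lmodType S.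

Section Pullback.
Variables (L P M : lmodType S) (g : {linear L -> M}) (q : {linear P -> M}).

Definition pb_diff : {linear (L * P)%type -> M} := (g \o fst) \- (q \o snd).
Definition pullback : lmodType S := ker_module pb_diff.
Definition pb_l : {linear pullback -> L} := fst \o @ker_val _ _ _ pb_diff.
Definition pb_r : {linear pullback -> P} := snd \o @ker_val _ _ _ pb_diff.

Lemma pb_intro l p : g l = q p -> exists w, pb_l w = l /\ pb_r w = p.
Proof.
move=> e; have /ker_intro[w wE] : pb_diff (l, p) = 0.
  by rewrite [LHS](_ : _ = g l - q p) // e subrr.
by exists w; rewrite /pb_l /pb_r /= wE.
Qed.

Lemma pb_eq w : g (pb_l w) = q (pb_r w).
Proof.
apply/eqP; rewrite -subr_eq0; apply/eqP; exact: (@ker_valE _ _ _ pb_diff w).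
Qed.

Lemma pb_ext w w' : pb_l w = pb_l w' -> pb_r w = pb_r w' -> w = w'.
Proof.
move=> e1 e2; apply: ker_val_inj; rewrite [LHS]surjective_pairing.
by rewrite [(_ w).1]e1 [(_ w).2]e2 -surjective_pairing.
Qed.

Lemma pb_pair N (a : {linear N -> L}) (b : {linear N -> P}) :
  (forall x, g (a x) = q (b x)) ->
  exists c : {linear N -> pullback},
    forall x, pb_l (c x) = a x /\ pb_r (c x) = b x.
Proof.
move=> ab; have [c cE] : exists c : {linear N -> pullback},
    forall x, ker_val (c x) = pair_lin a b x.
  apply: factor_inj => [|x]; first exact: ker_val_inj.
  by apply: ker_intro; rewrite [LHS](_ : _ = g (a x) - q (b x)) // ab subrr.
by exists c => x; rewrite /pb_l /pb_r /= cE.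
Qed.

Lemma pb_ses_r K (f : {linear K -> L}) : short_exact f g ->
  exists i : {linear K -> pullback},
    short_exact i pb_r /\ forall k, pb_l (i k) = f k.
Proof.
move=> h; have [|i iE] := @pb_pair K f (\0 : {linear _ -> _}).
  by move=> x /=; rewrite (ses_comp0 _ h) linear0.
exists i; split=> [|k]; last by case: (iE k).
split.
- by move=> x y xy; apply: (ses_inj h); rewrite -!(iE _).1 xy.
- move=> w; split=> [w0|[x <-]]; last by case: (iE x).
  have [k kE] : exists k, f k = pb_l w.
    by apply/(ses_exact h); rewrite pb_eq w0 linear0.
  by exists k; apply: pb_ext; rewrite ?(iE k).1 ?(iE k).2 ?w0.
- move=> p; have [l lE] := ses_surj h (q p).
  by have [w [_ wE]] := pb_intro lE; exists w.
Qed.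

Lemma pb_ses_l E (k : {linear E -> P}) : short_exact k q ->
  exists j : {linear E -> pullback},
    short_exact j pb_l /\ forall x, pb_r (j x) = k x.
Proof.
move=> h; have [|i iE] := @pb_pair E (\0 : {linear _ -> _}) k.
  by move=> x /=; rewrite (ses_comp0 _ h) linear0.
exists i; split=> [|x]; last by case: (iE x).
split.
- by move=> x y xy; apply: (ses_inj h); rewrite -!(iE _).2 xy.
- move=> w; split=> [w0|[x <-]]; last by case: (iE x).
  have [x xE] : exists x, k x = pb_r w.
    by apply/(ses_exact h); rewrite -pb_eq w0 linear0.
  by exists x; apply: pb_ext; rewrite ?(iE x).1 ?(iE x).2 ?w0.
- move=> l; have [p pE] := ses_surj h (g l).
  by have [w [wE _]] := pb_intro (esym pE); exists w.
Qed.

End Pullback.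

(** The lift of P'' -> M'' to M makes P' + P'' cover M. *)
Lemma horseshoe M' M M'' K' P' K'' P''
    (f : {linear M' -> M}) (g : {linear M -> M''})
    (k' : {linear K' -> P'}) (p' : {linear P' -> M'})
    (k'' : {linear K'' -> P''}) (p'' : {linear P'' -> M''}) :
  short_exact f g -> short_exact k' p' -> short_exact k'' p'' ->
  projective_module P' -> projective_module P'' ->
  exists (K P : lmodType S) (k : {linear K -> P}) (p : {linear P -> M})
      (a : {linear K' -> K}) (b : {linear K -> K''}) (c : {linear P' -> P}),
    [/\ short_exact k p, projective_module P, short_exact a b
      & forall x, k (a x) = c (k' x)].
Proof.
move=> h h' h'' PP' PP''.
have [l lE] := PP'' _ _ g p'' (ses_surj h).
pose p : {linear (P' * P'')%type -> M} := (f \o p' \o fst) \+ (l \o snd).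
have pE x y : p (x, y) = f (p' x) + l y by [].
have ps : surjective_map p.
  move=> m; have [y yE] := ses_surj h'' (g m).
  have [m' mE] : exists m', f m' = m - l y.
    by apply/(ses_exact h); rewrite linearB lE yE subrr.
  have [x xE] := ses_surj h' m'; exists (x, y).
  by apply: (etrans (pE _ _)); rewrite xE mE subrK.
pose K := ker_module p.
have [a aE] : exists a : {linear K' -> K}, forall x,
    ker_val (a x) = inl_lin _ _ (k' x).
  apply: (factor_inj (f := inl_lin _ _ \o k')); first exact: ker_val_inj.
  move=> x; apply: ker_intro; apply: (etrans (pE _ _)).
  by rewrite (ses_comp0 _ h') !linear0 addr0.
have pK (x : K) : f (p' (ker_val x).1) + l (ker_val x).2 = 0.
  exact: (ker_valE (f := p) x).
have [b bE] : exists b : {linear K -> K''}, forall x, k'' (b x) = (ker_val x).2.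
  apply: (factor_inj (f := snd \o @ker_val _ _ _ p)); first exact: ses_inj h''.
  move=> x; apply/(ses_exact h'') => /=; rewrite -lE.
  by rewrite -[l _](addKr (f (p' (ker_val x).1))) pK addr0 linearN
    (ses_comp0 _ h) oppr0.
exists K, (P' * P'')%type, (@ker_val _ _ _ p), p, a, b, (inl_lin _ _).
split; [exact: ker_ses|exact: prod_projective| |exact: aE].
split.
- move=> x y xy; apply: (ses_inj h').
  by have := congr1 (fun w => (ker_val w).1) xy; rewrite !aE.
- move=> x; split=> [x0|[y <-]]; last first.
    by apply: (ses_inj h''); rewrite bE aE linear0.
  have x20 : (ker_val x).2 = 0 by rewrite -bE x0 linear0.
  have [y yE] : exists y, k' y = (ker_val x).1.
    apply/(ses_exact h')/(ses_inj h); rewrite linear0.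
    by have := pK x; rewrite x20 linear0 addr0.
  exists y; apply: ker_val_inj; rewrite aE /= yE -x20.
  by case: (ker_val x).
- move=> y; have [m' mE] : exists m', f m' = - l (k'' y).
    by apply/(ses_exact h); rewrite linearN lE (ses_comp0 _ h'') oppr0.
  have [x xE] := ses_surj h' m'.
  have [z zE] : exists z : K, ker_val z = (x, k'' y).
    by apply/ker_intro/(etrans (pE _ _)); rewrite xE mE addNr.
  by exists z; apply: (ses_inj h''); rewrite bE zE.
Qed.

(** [good] abstracts the condition on a monomorphism K -> L that says that the
    first derived functor of its cokernel vanishes when L is projective:
    restriction Hom(L, N) -> Hom(K, N) is onto for Ext(-, N), and
    U (x) K -> U (x) L is injective for Tor(U, -). *)
Variable good : forall K L, {linear K -> L} -> Prop.
Hypothesis good_id : forall K, good (idfun : {linear K -> K}).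
Hypothesis good_comp : forall K L M (f : {linear K -> L}) (g : {linear L -> M})
  (h : {linear K -> M}), (forall x, h x = g (f x)) -> good f -> good g -> good h.
Hypothesis good_cancel : forall K L M (f : {linear K -> L})
  (g : {linear L -> M}) (h : {linear K -> M}),
  (forall x, h x = g (f x)) -> good h -> good f.
(** A sequence ending in M is a pushout of any projective cover of M, so this
    passes from covers to all short exact sequences. *)
Hypothesis good_pushout : forall E P K L M (e : {linear E -> P})
  (p : {linear P -> M}) (f : {linear K -> L}) (g : {linear L -> M})
  (a : {linear E -> K}) (b : {linear P -> L}),
  short_exact e p -> short_exact f g ->
  (forall x, g (b x) = p x) -> (forall x, f (a x) = b (e x)) ->
  good e -> good f.

(** [vanishing i M] is the vanishing at M of the derived functor of degree
    i + 1. *)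
Fixpoint vanishing i M : Prop :=
  forall K P (f : {linear K -> P}) (g : {linear P -> M}),
    projective_module P -> short_exact f g ->
    if i is j.+1 then vanishing j K else good f.

(** A projective cover of M maps to any short exact sequence ending in M. *)
Lemma vanishing_good K L M (f : {linear K -> L}) (g : {linear L -> M}) :
  vanishing 0 M -> short_exact f g -> good f.
Proof.
move=> vM h.
have [b bE] := free_cover_projective (cover_map M) (ses_surj h).
have [a aE] : exists a : {linear syzygy M -> K}, forall x,
    f (a x) = b (ker_val x).
  apply: (factor_inj (f := b \o @ker_val _ _ _ (cover_map M)));
    first exact: ses_inj h.
  by move=> x; apply/(ses_exact h); rewrite /= bE ker_valE.
have hs := syzygy_ses M.
exact: good_pushout hs h bE aE (vM _ _ _ _ (@free_cover_projective _ M) hs).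
Qed.

Lemma vanishing_iso i M N : isomorphic M N -> vanishing i M -> vanishing i N.
Proof.
move=> /iso_sym[e eb]; case: i => [|i] vM K P f g PP h.
all: exact: vM _ _ _ _ PP (ses_iso_r h eb).
Qed.

(** The horseshoe lemma lowers the degree.  In the lowest degree the composite
    K' -> K -> P of good maps is also K' -> P' -> P, and cancelling P' -> P
    leaves a good map. *)
Lemma vanishing_ker i M' M M'' (f : {linear M' -> M}) (g : {linear M -> M''}) :
  short_exact f g -> vanishing i M -> vanishing i.+1 M'' -> vanishing i M'.
Proof.
elim: i M' M M'' f g => [|i IH] M' M M'' f g h vM vM'' K' P' k' p' PP' h'.
all: have h'' := syzygy_ses M''.
all: have PP'' := @free_cover_projective _ M''.
all: have [K [P [k [p [a [b [c [hk PP hab e]]]]]]]] := horseshoe h h' h'' PP' PP''.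
  apply: (@good_cancel _ _ _ k' c (c \o k' : {linear K' -> P})) => //.
  apply: (good_comp (f := a) (g := k)) => [x||]; first by rewrite /= e.
  - by apply: vanishing_good hab; apply: vM'' PP'' h''.
  - exact: vM _ _ _ _ PP hk.
exact: IH hab (vM _ _ _ _ PP hk) (vM'' _ _ _ _ PP'' h'').
Qed.

(** Compares a cover of N, seen as a cover of the quotient L, with the kernel
    M of N -> L. *)
Lemma composite_ker K L M N P (f : {linear M -> N}) (g : {linear N -> L})
    (k : {linear K -> P}) (p : {linear P -> N}) :
  short_exact f g -> short_exact k p ->
  exists (a : {linear K -> ker_module (g \o p : {linear P -> L})})
      (b : {linear ker_module (g \o p : {linear P -> L}) -> M}),
    short_exact a b /\ forall x, ker_val (a x) = k x.
Proof.
move=> h hk; set q := (g \o p : {linear P -> L}).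
have [a aE] : exists a : {linear K -> ker_module q}, forall x,
    ker_val (a x) = k x.
  apply: factor_inj; first exact: ker_val_inj.
  by move=> x; apply: ker_intro; rewrite /q /= (ses_comp0 _ hk) linear0.
have [b bE] : exists b : {linear ker_module q -> M}, forall x,
    f (b x) = p (ker_val x).
  apply: (factor_inj (f := p \o @ker_val _ _ _ q)); first exact: ses_inj h.
  by move=> x; apply/(ses_exact h)/(ker_valE x).
exists a, b; split=> //; split.
- by move=> x y xy; apply: (ses_inj hk); rewrite -!aE xy.
- move=> x; split=> [x0|[y <-]]; last first.
    by apply: (ses_inj h); rewrite bE aE (ses_comp0 _ hk) linear0.
  have [y yE] : exists y, k y = ker_val x.
    by apply/(ses_exact hk); rewrite -bE x0 linear0.
  by exists y; apply: ker_val_inj; rewrite aE.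
- move=> m; have [x xE] := ses_surj hk (f m).
  have [y yE] : exists y : ker_module q, ker_val y = x.
    by apply: ker_intro; rewrite /q /= xE (ses_comp0 _ h).
  by exists y; apply: (ses_inj h); rewrite bE yE.
Qed.

Lemma vanishing_mid i M' M M'' (f : {linear M' -> M}) (g : {linear M -> M''}) :
  short_exact f g -> vanishing i M' -> vanishing i M'' -> vanishing i M.
Proof.
move=> h v' v''; case: i v' v'' => [|i] v' v'' K P k p PP hk.
all: have [a [b [hab aE]]] := composite_ker h hk.
all: have ps : surjective_map (g \o p)
  by move=> x; have [y <-] := ses_surj h x; have [z <-] := ses_surj hk y; exists z.
all: have hL := ker_ses ps.
  apply: (good_comp (f := a) (fun x => esym (aE x))).
  - exact: vanishing_good v' hab.
  - exact: v'' _ _ _ _ PP hL.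
exact: vanishing_ker hab (v'' _ _ _ _ PP hL) v'.
Qed.

Lemma vanishing_projective i M : projective_module M -> vanishing i M.
Proof.
elim: i M => [|i IH] M PM K P f g PP h.
all: have [s sE] := PM _ _ g (idfun : {linear M -> M}) (ses_surj h).
all: have [r rE] : exists r : {linear P -> K}, forall x, f (r x) = x - s (g x)
  by apply: (factor_inj (f := idfun \- (s \o g))); [exact: ses_inj h |
     move=> x; apply/(ses_exact h); rewrite /= linearB sE subrr].
all: have rf x : r (f x) = x
  by apply: (ses_inj h); rewrite rE (ses_comp0 _ h) linear0 subr0.
  exact: (@good_cancel _ _ _ f r idfun (fun x => esym (rf x)) (good_id K)).
apply: IH => L N p t ps.
have [u uE] := PP _ _ p (t \o r : {linear _ -> _}) ps.
by exists (u \o f : {linear _ -> _}) => x /=; rewrite uE /= rf.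
Qed.

(** The pullback of M and a cover of M'' is an extension in two ways: its
    projections have kernels M' and the syzygy of M''. *)
Lemma vanishing_coker i M' M M'' (f : {linear M' -> M}) (g : {linear M -> M''}) :
  short_exact f g -> vanishing i M' -> vanishing i.+1 M -> vanishing i.+1 M''.
Proof.
move=> h v' v K P k p PP hk.
have [j [hj _]] := pb_ses_r p h.
have [a [ha _]] := pb_ses_l g hk.
apply: vanishing_ker ha _ v.
exact: vanishing_mid hj v' (vanishing_projective i PP).
Qed.

End Derived.

Global Opaque pb_l pb_r.

(** * Tensor products are right exact *)

Definition im_pred (X Y : zmodType) (f : {additive X -> Y}) : {pred Y} :=
  fun y => `[< exists x, f x = y >].

Lemma im_pred_closed (X Y : zmodType) (f : {additive X -> Y}) :
  zmod_closed (im_pred f).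
Proof.
split=> [|x y]; first by apply/asboolP; exists 0; rewrite raddf0.
move=> /asboolP[a <-] /asboolP[b <-]; apply/asboolP; exists (a - b).
by rewrite raddfB.
Qed.

HB.instance Definition _ (X Y : zmodType) (f : {additive X -> Y}) :=
  GRing.isZmodClosed.Build Y (im_pred f) (im_pred_closed f).

Section TensorExact.
Variables (A B : pzRingType) (U : bimodule B A).
Implicit Types K L M N X : lmodType A.

Lemma pureBr X (u : U) (x y : X) : tpure u (x - y) = tpure u x - tpure u y.
Proof.
have -> : tpure u y = - tpure u (- y); last by rewrite opprK pureDr.
by apply/eqP; rewrite -addr_eq0 -pureDr subrr pure0r.
Qed.

Lemma tmapD L M (f : {linear L -> M}) q r :
  tens_map U f (q + r) = tens_map U f q + tens_map U f r.
Proof. exact: linearD. Qed.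

Lemma tmap0 L M (f : {linear L -> M}) : tens_map U f 0 = 0.
Proof. exact: linear0. Qed.

Lemma tens_map_comp L M N (f : {linear L -> M}) (g : {linear M -> N})
    (h : {linear L -> N}) : (forall x, h x = g (f x)) ->
  forall t, tens_map U h t = tens_map U g (tens_map U f t).
Proof.
move=> hE; elim/tens_ind=> [|q r IHq IHr|u x].
- by rewrite !tmap0.
- by rewrite !tmapD IHq IHr.
- by rewrite !tens_map_pure hE.
Qed.

Lemma tens_map_id M (h : {linear M -> M}) : (forall x, h x = x) ->
  forall t, tens_map U h t = t.
Proof.
move=> hE; elim/tens_ind=> [|q r IHq IHr|u x]; rewrite ?tmap0 //.
- by rewrite tmapD IHq IHr.
- by rewrite tens_map_pure hE.
Qed.

Lemma tens_map0 L M (h : {linear L -> M}) : (forall x, h x = 0) ->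
  forall t, tens_map U h t = 0.
Proof.
move=> hE; elim/tens_ind=> [|q r IHq IHr|u x]; rewrite ?tmap0 //.
- by rewrite tmapD IHq IHr addr0.
- by rewrite tens_map_pure hE pure0r.
Qed.

Lemma tens_map_surj L M (p : {linear L -> M}) :
  surjective_map p -> surjective_map (tens_map U p).
Proof.
move=> ps; elim/tens_ind=> [|q r [q' <-] [r' <-]|u x].
- by exists 0; rewrite linear0.
- by exists (q' + r'); rewrite linearD.
- by have [y <-] := ps x; exists (tpure u y); rewrite tens_map_pure.
Qed.

(** An element killed by U (x) p is separated from the image of U (x) f by no
    balanced map: sending u (x) p x to the class of u (x) x is well defined with
    values in the quotient by that image. *)
Lemma tens_exact K L M (f : {linear K -> L}) (p : {linear L -> M}) :
  surjective_map p -> exact_at f p -> exact_at (tens_map U f) (tens_map U p).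
Proof.
move=> ps e t; split=> [pt|[k <-]]; last first.
  by rewrite -(@tens_map_comp _ _ _ f p \0) ?tens_map0 // => x /=;
    rewrite (exact_at0 _ e).
pose I := im_pred (tens_map U f : {additive tensor U K -> tensor U L}).
have modI (x y : tensor U L) : (exists z, tens_map U f z = x - y) ->
    \pi_(Quotient.quot I) x = \pi_(Quotient.quot I) y.
  by move=> h; apply/eqP; rewrite -Quotient.idealrBE; apply/asboolP.
have piD (x y : tensor U L) : \pi_(Quotient.quot I) (x + y)
    = \pi_(Quotient.quot I) x + \pi_(Quotient.quot I) y.
  by rewrite !piE.
have imf u x : p x = 0 -> exists z, tens_map U f z = tpure u x.
  by move=> /e[k <-]; exists (tpure u k); rewrite tens_map_pure.
have [s sK] := choice ps.
pose h (u : U) (m : M) : Quotient.quot I :=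
  \pi_(Quotient.quot I) (tpure u (s m) : tensor U L).
have hb : balanced h.
  split=> [u u' x|u x x'|u a x]; rewrite /h.
  - by rewrite pureDl piD.
  - rewrite -piD -pureDr; apply: modI; rewrite -pureBr; apply: imf.
    by rewrite linearB linearD !sK subrr.
  - rewrite pureM; apply: modI; rewrite -pureBr; apply: imf.
    by rewrite linearB linearZ_LR !sK subrr.
have hE (x : tensor U L) : tens_lift h (tens_map U p x) =
    \pi_(Quotient.quot I) x.
  elim/tens_ind: x => [|q r IHq IHr|u x].
  - by rewrite linear0 tens_lift_zero // piE.
  - by rewrite linearD tens_liftD // IHq IHr piD.
  - rewrite tens_map_pure tens_lift_pure // /h; apply: modI.
    by rewrite -pureBr; apply: imf; rewrite linearB sK subrr.
have := hE t; rewrite pt tens_lift_zero // => t0.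
have : t - 0 \in I.
  by rewrite Quotient.idealrBE -t0; apply/eqP; rewrite !piE.
by rewrite subr0 => /asboolP.
Qed.

End TensorExact.

Arguments tens_exact {A B} U {K L M f p}.
Arguments tens_map_surj {A B} U {L M p}.

(** * Extension groups *)

Section ExtVanishing.
Variable S : pzRingType.
Implicit Types E K L M N P Q : lmodType S.

Definition extends_to N K L (f : {linear K -> L}) : Prop :=
  forall phi : {linear K -> N}, exists psi : {linear L -> N},
    forall x, psi (f x) = phi x.

Section Fixed.
Variable N : lmodType S.

Lemma extends_id K : extends_to N (idfun : {linear K -> K}).
Proof. by move=> phi; exists phi. Qed.

Lemma extends_comp K L M (f : {linear K -> L}) (g : {linear L -> M})
  (h : {linear K -> M}) : (forall x, h x = g (f x)) ->
  extends_to N f -> extends_to N g -> extends_to N h.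
Proof.
move=> hE ef eg phi; have [psi psiE] := ef phi; have [chi chiE] := eg psi.
by exists chi => x; rewrite hE chiE psiE.
Qed.

Lemma extends_cancel K L M (f : {linear K -> L}) (g : {linear L -> M})
  (h : {linear K -> M}) : (forall x, h x = g (f x)) ->
  extends_to N h -> extends_to N f.
Proof.
move=> hE eh phi; have [psi psiE] := eh phi.
by exists (psi \o g : {linear _ -> _}) => x /=; rewrite -hE psiE.
Qed.

Lemma pushout_ses E P K L M (e : {linear E -> P}) (p : {linear P -> M})
  (f : {linear K -> L}) (g : {linear L -> M})
  (a : {linear E -> K}) (b : {linear P -> L}) :
  short_exact e p -> short_exact f g ->
  (forall x, g (b x) = p x) -> (forall x, f (a x) = b (e x)) ->
  exists (i : {linear E -> (K * P)%type}) (q : {linear (K * P)%type -> L}),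
    [/\ short_exact i q, forall x, i x = (- a x, e x)
      & forall k x, q (k, x) = f k + b x].
Proof.
move=> he hf gb fa.
exists (pair_lin (\- a : {linear _ -> _}) e).
exists ((f \o fst) \+ (b \o snd) : {linear _ -> _}); split=> //; split.
- by move=> x y [_ /(ses_inj he)].
- move=> [k x]; split=> /= [fb|[y [<- <-]]]; last by rewrite linearN fa addNr.
  have [y yE] : exists y, e y = x.
    apply/(ses_exact he); rewrite -gb; apply: (etrans _ (linear0 g)).
    by rewrite -fb linearD (ses_comp0 _ hf) add0r.
  exists y; congr pair => //; apply: (ses_inj hf); apply/eqP.
  by rewrite linearN fa yE eq_sym -addr_eq0 fb.
- move=> y; have [x xE] := ses_surj he (g y).
  have [k kE] : exists k, f k = y - b x.
    by apply/(ses_exact hf); rewrite linearB gb xE subrr.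
  by exists (k, x); rewrite /= kE subrK.
Qed.

(** L is the quotient of K + P by E. *)
Lemma extends_pushout E P K L M (e : {linear E -> P}) (p : {linear P -> M})
  (f : {linear K -> L}) (g : {linear L -> M})
  (a : {linear E -> K}) (b : {linear P -> L}) :
  short_exact e p -> short_exact f g ->
  (forall x, g (b x) = p x) -> (forall x, f (a x) = b (e x)) ->
  extends_to N e -> extends_to N f.
Proof.
move=> he hf gb fa ee phi.
have [psi psiE] := ee (phi \o a : {linear _ -> _}).
have [i [q [h iE qE]]] := pushout_ses he hf gb fa.
have [|chi chiE] := @factor_surj _ _ _ _ q
    ((phi \o fst) \+ (psi \o snd) : {linear _ -> _}) (ses_surj h).
  move=> x /(ses_exact h)[y <-]; rewrite iE /=.
  by rewrite psiE /= linearN addNr.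
exists chi => k; rewrite -[f k]addr0 -(linear0 b) -qE chiE /=.
by rewrite linear0 addr0.
Qed.

End Fixed.

Definition ext_vanishing N i M := vanishing (@extends_to N) i M.

Lemma ext_vanishing_mid N i K L M (f : {linear K -> L}) (g : {linear L -> M}) :
  short_exact f g -> ext_vanishing N i K -> ext_vanishing N i M ->
  ext_vanishing N i L.
Proof.
exact: (vanishing_mid (@extends_comp N) (@extends_cancel N) (@extends_pushout N)).
Qed.

Lemma ext_vanishing_projective N i M :
  projective_module M -> ext_vanishing N i M.
Proof. exact: (vanishing_projective (@extends_id N) (@extends_cancel N)). Qed.

Lemma ext_vanishing_coker N i K L M (f : {linear K -> L}) (g : {linear L -> M}) :
  short_exact f g -> ext_vanishing N i K -> ext_vanishing N i.+1 L ->
  ext_vanishing N i.+1 M.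
Proof.
exact: (vanishing_coker (@extends_id N) (@extends_comp N) (@extends_cancel N)
  (@extends_pushout N)).
Qed.

Lemma ext_vanishing_extends N K L M (f : {linear K -> L}) (g : {linear L -> M}) :
  short_exact f g -> ext_vanishing N 0 M -> extends_to N f.
Proof. by move=> h v; apply: (vanishing_good (@extends_pushout N) v h). Qed.

(** The analogue of [vanishing_coker] in the lowest degree, where surjectivity of
    Hom(L, N) -> Hom(K, N) takes the place of a vanishing Ext group of K. *)
Lemma ext_vanishing_coker0 N K L M (f : {linear K -> L}) (g : {linear L -> M}) :
  short_exact f g -> extends_to N f -> ext_vanishing N 0 L ->
  ext_vanishing N 0 M.
Proof.
move=> h ef v E P e p PP he phi.
have [i [hi iE]] := pb_ses_r p h; have [j [hj jE]] := pb_ses_l g he.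
have [psi psiE] := ext_vanishing_extends hj v phi.
have [chi chiE] := ef (psi \o i : {linear _ -> _}).
(* Correcting psi by an extension of its restriction to K makes it vanish on
   K, hence factor through the projection to P. *)
have [|rho rhoE] := @factor_surj _ _ _ _ (pb_r g p)
    (psi \- (chi \o pb_l g p) : {linear _ -> _}) (ses_surj hi).
  by move=> x /(ses_exact hi)[y <-]; rewrite /= iE chiE /= subrr.
exists rho => x; rewrite -jE rhoE /= psiE.
by rewrite (ses_comp0 _ hj) linear0 subr0.
Qed.

Lemma Ext_shift i N K P M (f : {linear K -> P}) (g : {linear P -> M}) :
  projective_module P -> short_exact f g -> Ext_eq0 i.+2 M N -> Ext_eq0 i.+1 K N.
Proof. by move=> PP h v Q PQ; apply: (v (splice h Q)); apply: splice_projective. Qed.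

Lemma Ext1_vanishing N M : Ext_eq0 1 M N <-> ext_vanishing N 0 M.
Proof.
split=> [v K P f g PP h phi|v P PP f fd].
  have PQ := @std_res_projective _ K; set Q := std_res K in PQ.
  have [|psi psiE] := v _ (splice_projective h PP PQ)
      (phi \o res_aug Q : {linear Q 0%N -> N}).
    move=> x; apply: (etrans (y := phi (res_aug Q (res_d Q 0%N x)))) => //.
    by rewrite (exact_at0 _ (@res_aug_exact _ _ Q)) linear0.
  exists psi => x; have [y <-] := @res_aug_surj _ _ Q x.
  exact: esym (psiE y).
have [|phi phiE] := @factor_surj _ _ _ _ (tail_aug P) f (tail_aug_surj (P := P)).
  by move=> x /(@tail_aug_exact _ _ P)[y <-].
have [psi psiE] := v _ _ _ _ (PP 0%N) (tail_ses P) phi.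
by exists psi => x; rewrite -tail_augE psiE phiE.
Qed.

(** A resolution of a syzygy is spliced with a projective cover in one
    direction, and a resolution is truncated in the other. *)
Lemma Ext_vanishing i N M : Ext_eq0 i.+1 M N <-> ext_vanishing N i M.
Proof.
elim: i M => [|i IH] M; first exact: Ext1_vanishing.
split=> [v K P f g PP h|v P PP].
  by apply/IH; apply: Ext_shift PP h v.
exact: (proj2 (IH _) (v _ _ _ _ (PP 0%N) (tail_ses P)) (tail P)
  (fun j => PP j.+1)).
Qed.

(** The long exact sequence of Ext(M, -), read off the cochains on one
    projective resolution of M. *)
Lemma Ext_coker i M K L N (f : {linear K -> L}) (g : {linear L -> N}) :
  short_exact f g -> Ext_eq0 i.+1 M L -> Ext_eq0 i.+2 M K -> Ext_eq0 i.+1 M N.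
Proof.
move=> h vL vK P PP phi phid.
have [psi psiE] := PP _ _ _ g phi (ses_surj h).
have [theta thetaE] : exists theta : {linear P i.+2 -> K},
    forall x, f (theta x) = psi (res_d P i.+1 x).
  apply: (factor_inj (f := psi \o res_d P i.+1)); first exact: ses_inj h.
  by move=> x; apply/(ses_exact h); rewrite /= psiE phid.
have [|chi chiE] := vK P PP theta.
  move=> x; apply: (ses_inj h); rewrite thetaE.
  by rewrite (exact_at0 _ (@res_exact _ _ P i.+1)) !linear0.
have [|om omE] := vL P PP (psi \- (f \o chi) : {linear _ -> _}).
  by move=> x /=; rewrite -thetaE chiE subrr.
exists (g \o om : {linear _ -> _}) => x /=.
by rewrite -omE /= linearB (ses_comp0 _ h) subr0 psiE.
Qed.

(** Split the pullback of the sequence along a map out of M. *)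
Lemma Ext1_lift M K L N (f : {linear K -> L}) (g : {linear L -> N})
    (q : {linear M -> N}) :
  short_exact f g -> Ext_eq0 1 M K -> exists h : {linear M -> L},
    forall x, g (h x) = q x.
Proof.
move=> h /Ext1_vanishing v; have [i [hi iE]] := pb_ses_r q h.
have [r rE] := ext_vanishing_extends hi v (idfun : {linear K -> K}).
have [|s sE] := @factor_surj _ _ _ _ (pb_r g q)
    (pb_l g q \- (f \o r) : {linear _ -> _}) (ses_surj hi).
  by move=> x /(ses_exact hi)[k <-] /=; rewrite iE rE subrr.
exists s => x; have [w <-] := ses_surj hi x.
by rewrite sE /= linearB (ses_comp0 _ h) subr0 pb_eq.
Qed.

End ExtVanishing.

Arguments ext_vanishing {S} N i M.

(** * Torsion groups *)

Section TorVanishing.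
Variables (A B : pzRingType) (U : bimodule B A).
Implicit Types E K L M N P : lmodType A.

Definition tens_inj K L (f : {linear K -> L}) : Prop := injective (tens_map U f).

Lemma linear_inj0 (R : pzRingType) (X Y : lmodType R) (f : {linear X -> Y}) :
  (forall x, f x = 0 -> x = 0) -> injective f.
Proof.
move=> f0 x y xy; apply/eqP; rewrite -subr_eq0; apply/eqP/f0.
by rewrite linearB xy subrr.
Qed.

Lemma tens_inj_comp K L M (f : {linear K -> L}) (g : {linear L -> M})
  (h : {linear K -> M}) : (forall x, h x = g (f x)) ->
  tens_inj f -> tens_inj g -> tens_inj h.
Proof. by move=> /tens_map_comp hE fi gi x y; rewrite !hE => /gi/fi. Qed.

Lemma tens_inj_cancel K L M (f : {linear K -> L}) (g : {linear L -> M})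
  (h : {linear K -> M}) : (forall x, h x = g (f x)) -> tens_inj h -> tens_inj f.
Proof. by move=> /tens_map_comp hE hi x y xy; apply: hi; rewrite !hE xy. Qed.

(** By right exactness of U (x) - on E -> K + P -> L, an element of U (x) K that
    dies in U (x) L comes from an element of U (x) E that dies in U (x) P. *)
Lemma tens_inj_pushout E P K L M (e : {linear E -> P}) (p : {linear P -> M})
  (f : {linear K -> L}) (g : {linear L -> M})
  (a : {linear E -> K}) (b : {linear P -> L}) :
  short_exact e p -> short_exact f g ->
  (forall x, g (b x) = p x) -> (forall x, f (a x) = b (e x)) ->
  tens_inj e -> tens_inj f.
Proof.
move=> he hf gb fa ei; apply: linear_inj0 => t ft.
have [i [q [h iE qE]]] := pushout_ses he hf gb fa.
have [|z zE] := proj1 (tens_exact U (ses_surj h) (ses_exact h)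
    (tens_map U (inl_lin K P) t)).
  rewrite -(tens_map_comp (h := f)) // => x.
  by rewrite qE linear0 addr0.
have z0 : z = 0.
  apply: ei; rewrite linear0.
  rewrite (tens_map_comp (f := i) (g := snd)) => [|x]; last by rewrite iE.
  by rewrite zE -(tens_map_comp (h := \0)) ?tens_map0.
rewrite -[t](@tens_map_id _ _ _ _ (idfun : {linear K -> K})) //.
rewrite (tens_map_comp (f := inl_lin K P) (g := fst)) //.
by rewrite -zE z0 !linear0.
Qed.

Definition tor_vanishing i M := vanishing tens_inj i M.

Lemma tor_vanishing_ker i K L M (f : {linear K -> L}) (g : {linear L -> M}) :
  short_exact f g -> tor_vanishing i L -> tor_vanishing i.+1 M ->
  tor_vanishing i K.
Proof. exact: (vanishing_ker tens_inj_comp tens_inj_cancel tens_inj_pushout). Qed.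

Lemma tor_vanishing_ses K L M (f : {linear K -> L}) (g : {linear L -> M}) :
  short_exact f g -> tor_vanishing 0 M ->
  short_exact (tens_map U f) (tens_map U g).
Proof.
move=> h v; split; first exact: (vanishing_good tens_inj_pushout v h).
- exact: tens_exact (ses_surj h) (ses_exact h).
- exact: tens_map_surj (ses_surj h).
Qed.

(** The standard resolution of K, spliced with P, computes the kernel of
    U (x) K -> U (x) P. *)
Lemma Tor_vanishing i M : Tor_eq0 i.+1 U M -> tor_vanishing i M.
Proof.
elim: i M => [|i IH] M v K P f g PP h; last first.
  apply: IH => Q PQ.
  exact: (v (splice h Q) (splice_projective h PP PQ)).
have PQ := @std_res_projective _ K; set Q := std_res K in PQ.
have hQ := v _ (splice_projective h PP PQ).
apply: linear_inj0 => t ft.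
have [s sE] := tens_map_surj U (@res_aug_surj _ _ Q) t.
have /hQ[r rE] : tens_map U (splice_d f Q 0) s = 0.
  by rewrite (tens_map_comp (f := res_aug Q) (g := f)) // sE.
rewrite -sE -rE -(tens_map_comp (h := \0)) ?tens_map0 // => x.
apply: esym; exact: (exact_at0 x (@res_aug_exact _ _ Q)).
Qed.

End TorVanishing.

(** * Direct sums of copies of a bimodule *)

Section FsumExt.
Variables (S : pzRingType) (I : choiceType) (C : lmodType S).

Lemma fsum_extends (K L : lmodType S) (f : {linear K -> L}) :
  extends_to C f -> extends_to C (fsum_map I f).
Proof.
move=> ef phi.
have /choice[psi psiE] i := ef (phi \o fdelta i : {linear _ -> _}).
exists (fsum_lift psi).
apply: (@fsum_ext _ _ _ _ (fsum_lift psi \o fsum_map I f : {linear _ -> _})).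
move=> i m /=; have -> : fsum_map I f (fdelta i m) = fdelta i (f m).
  apply: fsumP => j; rewrite fsum_mapE !fdeltaE.
  by case: eqP => // _; rewrite linear0.
by rewrite [LHS]fsum_lift_delta psiE.
Qed.

(** A sum of copies of a projective cover of M is a projective cover of the sum
    of copies of M, and maps extend one summand at a time. *)
Lemma fsum_ext_vanishing i (M : lmodType S) :
  ext_vanishing C i M -> ext_vanishing C i (fsum I M).
Proof.
elim: i M => [|i IH] M v.
all: have h := syzygy_ses M.
all: have PP := @free_cover_projective _ M.
all: have hI := fsum_ses I h.
  apply: ext_vanishing_coker0 hI (fsum_extends (v _ _ _ _ PP h)) _.
  exact/ext_vanishing_projective/fsum_projective.
apply: ext_vanishing_coker hI (IH _ (v _ _ _ _ PP h)) _.
exact/ext_vanishing_projective/fsum_projective.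
Qed.

End FsumExt.

Section TensorFree.
Variables (A B : pzRingType) (V : bimodule A B) (I : choiceType).

Let R := fsum I (B^o : lmodType B).

Lemma tens_free_subproof (v : V) (r : R) :
  exists s : seq I, forall i, i \notin s -> ract v (r i) = 0.
Proof. by case: (fs_fin r) => s sP; exists s => i /sP ->; rewrite ract0r. Qed.

Definition tens_free_fun v r : fsum I V := Fsum (tens_free_subproof v r).

Lemma tens_free_balanced : balanced tens_free_fun.
Proof.
split=> [v v' r|v r r'|v b r]; apply: fsumP => i /=.
- by rewrite ractDl.
- by rewrite ractDr.
- by rewrite ractM.
Qed.

Lemma tens_free_linear : linear (tens_lift tens_free_fun).
Proof.
move=> a q r; rewrite (tens_liftD tens_free_balanced); congr (_ + _).
have tZ := tens_free_balanced.
elim/tens_ind: q => [|q r' IHq IHr|u x].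
- by rewrite scaler0 [LHS]tens_lift_zero // [X in _ *: X]tens_lift_zero // scaler0.
- by rewrite scalerDr !(tens_liftD tZ) scalerDr IHq IHr.
- rewrite scale_pure !tens_lift_pure //.
  by apply: fsumP => i /=; rewrite ractZ.
Qed.

Lemma tens_delta_linear i : linear (fun v : V => tpure v (fdelta i (1 : B^o) : R)).
Proof. by move=> a v v'; rewrite pureDl scale_pure. Qed.

(** V (x) - sends the free module on I to the sum of copies of V: the inverse
    map multiplies v by the coordinates of r. *)
Lemma tens_free_iso : isomorphic (fsum I V) (tensor V R).
Proof.
pose h := fsum_lift (fun i => mklin (tens_delta_linear i)).
pose k := mklin tens_free_linear.
have hd i v : h (fdelta i v) = tpure v (fdelta i (1 : B^o) : R).
  exact: (fsum_lift_delta (fun i => mklin (tens_delta_linear i))).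
exists h; exists k => [x|t].
  apply: (@fsum_ext _ _ _ _ (k \o h : {linear _ -> _}) idfun) => i v.
  rewrite /= -/h hd; apply: (etrans (tens_lift_pure _ _ tens_free_balanced)).
  apply: fsumP => j; rewrite fdeltaE /= fdeltaE.
  by case: eqP; rewrite ?ract1 ?ract0r.
elim/tens_ind: t => [|q r IHq IHr|v r]; first by rewrite !linear0.
  by rewrite !linearD IHq IHr.
have -> : k (tpure v r) = tens_free_fun v r.
  exact: tens_lift_pure tens_free_balanced.
have [s sr] := supports_exists r.
have sv : supports s (tens_free_fun v r).
  by split=> [|i si]; [exact: sr.1 | rewrite /= sr.2 // ract0r].
rewrite [in RHS](fsum_decomp sr) (fsum_decomp sv) linear_sum.
elim/big_rec2: _ => [|i y x _ IH]; first by rewrite pure0r.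
rewrite pureDr -IH hd /= pureM; congr (tpure v _ + _).
apply: fsumP => j /=; rewrite !fdeltaE; case: eqP => // _; rewrite ?scaler0 //.
by rewrite [_ *: _]mulr1.
Qed.

End TensorFree.

(** * Classes of modules with finite resolutions *)

Section ClassLemmas.
Variable S : pzRingType.
Implicit Types K L M N : lmodType S.
Variable C : lmodType S -> Prop.
Hypothesis isoC : forall M N, isomorphic M N -> C M -> C N.

Lemma wedge_iso m M N : isomorphic M N -> wedge_class C m M -> wedge_class C m N.
Proof.
case=> e eb [k [P [km CP P0]]]; exists k.
have [e' eK e'K] := eb.
have sur : surjective_map (e \o res_aug P : {linear _ -> _}).
  move=> y; have [x xE] := @res_aug_surj _ _ P (e' y); exists x.
  by rewrite /= xE e'K.
exists (@Resolution S N P (@res_d _ _ P) (e \o res_aug P : {linear _ -> _}) sur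
  (exact_at_inj (bij_inj eb) (@res_aug_exact _ _ P)) (@res_exact _ _ P)).
by split.
Qed.

Lemma ker_inP M N (f : {linear M -> N}) : ker_in C f <-> C (ker_module f).
Proof.
split=> [[K [i [i_inj e CK]]]|CK]; last first.
  exists (ker_module f), (@ker_val _ _ _ f).
  by split=> //; [exact: ker_val_inj | exact: ker_exact].
have [a aE] : exists a : {linear K -> ker_module f}, forall x, ker_val (a x) = i x.
  apply: factor_inj; first exact: ker_val_inj.
  by move=> x; apply/ker_intro/(exact_at0 _ e).
apply: isoC CK; exists a; apply: linear_bij => [x y xy|y].
  by apply: i_inj; rewrite -!aE xy.
have /e[x xE] := ker_valE y.
by exists x; apply: ker_val_inj; rewrite aE.
Qed.

End ClassLemmas.

(** Dimension shifting along a finite C-resolution. *)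
Lemma Ext_wedge (S : pzRingType) (C : lmodType S -> Prop) (U : lmodType S) n :
  (forall M N, isomorphic M N -> C M -> C N) ->
  (forall i, (1 <= i <= n)%N -> forall Y, C Y -> Ext_eq0 i U Y) ->
  forall m Y, wedge_class C m Y -> forall i, (i.+1 + m <= n)%N -> Ext_eq0 i.+1 U Y.
Proof.
move=> isoC v; apply: wedge_ind => //.
  by move=> m M CM i im; apply: v => //=; apply: leq_trans (leq_addr _ _) im.
move=> m K L M f g h CL _ IH i im; apply: Ext_coker h _ _.
  by apply: v => //=; apply: leq_trans (leq_addr _ _) im.
by apply: IH; rewrite addSnnS.
Qed.

Lemma Tor_vee (A B : pzRingType) (C : lmodType A -> Prop) (U : bimodule B A) n :
  (forall M N, isomorphic M N -> C M -> C N) ->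
  (forall i, (1 <= i <= n)%N -> forall X, C X -> Tor_eq0 i U X) ->
  forall m X, vee_class C m X -> forall i, (i.+1 + m <= n)%N -> tor_vanishing U i X.
Proof.
move=> isoC v; have v' i X : (i.+1 <= n)%N -> C X -> tor_vanishing U i X.
  by move=> im CX; apply/Tor_vanishing/v.
apply: vee_ind => //.
  by move=> m M CM i im; apply: v' => //=; apply: leq_trans (leq_addr _ _) im.
move=> m K L M f g h CL _ IH i im; apply: tor_vanishing_ker h _ _.
  by apply: v' => //=; apply: leq_trans (leq_addr _ _) im.
by apply: IH; rewrite addSnnS.
Qed.

Section HomExact.
Variables (A B : pzRingType) (U : bimodule B A).
Implicit Types K L M : lmodType B.

Lemma hom_ses K L M (f : {linear K -> L}) (g : {linear L -> M}) :
  short_exact f g -> Ext_eq0 1 U K -> short_exact (hom_map U f) (hom_map U g).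
Proof.
move=> h v; split.
- move=> x y xy; apply: homP => u; apply: (ses_inj h).
  by have := congr1 (fun z : hom_module U L => z u) xy; apply.
- move=> y; split=> [gy|[x <-]]; last first.
    by apply: homP => u; apply: (ses_comp0 _ h).
  have [|k kE] := @factor_inj _ _ _ _ f (y : {linear U -> L}) (ses_inj h).
    move=> u; apply/(ses_exact h).
    by have := congr1 (fun z : hom_module U M => z u) gy; apply.
  by exists (HomModule (linearP k)); apply: homP => u; apply: kE.
- move=> y; have [k kE] := Ext1_lift (y : {linear U -> M}) h v.
  by exists (HomModule (linearP k)); apply: homP => u; apply: kE.
Qed.

(** [Ext_wedge] keeps the sequences exact under Hom(U, -). *)
Lemma hom_wedge (C : lmodType A -> Prop) (D : lmodType B -> Prop) n :
  (forall M N, isomorphic M N -> D M -> D N) ->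
  (forall i, (1 <= i <= n)%N -> forall Y, D Y -> Ext_eq0 i U Y) ->
  (forall Y, D Y -> C (hom_module U Y)) ->
  forall m Y, wedge_class D m Y -> (m <= n)%N -> wedge_class C m (hom_module U Y).
Proof.
move=> isoD v DC; apply: wedge_ind => // [m M DM _|m K L M f g h DL wK IH mn].
  by apply/wedge_base/DC.
apply: wedge_step (hom_ses h _) (DC _ DL) (IH (ltnW mn)).
exact: (Ext_wedge isoD v wK).
Qed.

(** [Tor_vee] keeps the sequences exact under U (x) -. *)
Lemma tens_vee (C : lmodType A -> Prop) (D : lmodType B -> Prop) n :
  (forall X X', isomorphic X X' -> C X -> C X') ->
  (forall i, (1 <= i <= n)%N -> forall X, C X -> Tor_eq0 i U X) ->
  (forall X, C X -> D (tensor U X)) ->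
  forall m X, vee_class C m X -> (m <= n)%N -> vee_class D m (tensor U X).
Proof.
move=> isoC v CD; apply: vee_ind => // [m M CM _|m K L M f g h CL wK IH mn].
  by apply/vee_base/CD.
apply: vee_step (tor_vanishing_ses h _) (CD _ CL) (IH (ltnW mn)).
exact: (Tor_vee isoC v wK).
Qed.

End HomExact.

(** * Modules over the Morita ring as tuples *)

(** Restriction of scalars.  The morphism is an argument of the type so that
    the type determines the S-module structure. *)
Definition restrict (S R : pzRingType) (s : {rmorphism S -> R})
  (M : lmodType R) : Type := M.

Section Restriction.
Variables (S R : pzRingType) (s : {rmorphism S -> R}) (M : lmodType R).
Local Notation N := (restrict s M).

HB.instance Definition _ := GRing.Zmodule.on N.

Definition restrict_scale (a : S) (x : N) : N := s a *: (x : M).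

Lemma restrict_scaleA a b x :
  restrict_scale a (restrict_scale b x) = restrict_scale (a * b) x.
Proof. by rewrite /restrict_scale scalerA rmorphM. Qed.
Lemma restrict_scale1 : left_id 1 restrict_scale.
Proof. by move=> x; rewrite /restrict_scale rmorph1 scale1r. Qed.
Lemma restrict_scaleDr : right_distributive restrict_scale +%R.
Proof. by move=> a x y; rewrite /restrict_scale scalerDr. Qed.
Lemma restrict_scaleDl x : {morph restrict_scale^~ x : a b / a + b}.
Proof. by move=> a b; rewrite /restrict_scale rmorphD scalerDl. Qed.

HB.instance Definition _ := GRing.Zmodule_isLmodule.Build S N
  restrict_scaleA restrict_scale1 restrict_scaleDr restrict_scaleDl.

End Restriction.

Section Tuples.
Variables (A B : pzRingType) (V : bimodule A B) (U : bimodule B A).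
Implicit Types T : morita_tuple V U.

Record tmor T T' := Tmor {
  tm1 : {linear tup_X T -> tup_X T'};
  tm2 : {linear tup_Y T -> tup_Y T'};
  tm_f : forall u x, tup_f T' (tpure u (tm1 x)) = tm2 (tup_f T (tpure u x));
  tm_g : forall v y, tup_g T' (tpure v (tm2 y)) = tm1 (tup_g T (tpure v y)) }.

Definition tuple_ses TK T T' (i : tmor TK T) (p : tmor T T') : Prop :=
  short_exact (tm1 i) (tm1 p) /\ short_exact (tm2 i) (tm2 p).

Lemma tm_ft T T' (p : tmor T T') t :
  tup_f T' (tens_map U (tm1 p) t) = tm2 p (tup_f T t).
Proof.
elim/tens_ind: t => [|q r IHq IHr|u x]; first by rewrite !linear0.
- by rewrite tmapD !linearD IHq IHr.
- by rewrite tens_map_pure tm_f.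
Qed.

Lemma tm_gt T T' (p : tmor T T') t :
  tup_g T' (tens_map V (tm2 p) t) = tm1 p (tup_g T t).
Proof.
elim/tens_ind: t => [|q r IHq IHr|u x]; first by rewrite !linear0.
- by rewrite tmapD !linearD IHq IHr.
- by rewrite tens_map_pure tm_g.
Qed.

(** The tuple (X + V (x) Y, U (x) X + Y) induced from (X, Y) along
    A x B -> Lambda. *)
Section Induced.
Variables (X : lmodType A) (Y : lmodType B).

Definition ind_f : {linear tensor U (X * tensor V Y)%type ->
    (tensor U X * Y)%type} :=
  inl_lin _ _ \o tens_map U (fst : {linear (X * tensor V Y)%type -> X}).
Definition ind_g : {linear tensor V (tensor U X * Y)%type ->
    (X * tensor V Y)%type} :=
  inr_lin _ _ \o tens_map V (snd : {linear (tensor U X * Y)%type -> Y}).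

Lemma ind_gf z : ind_g (tens_map V ind_f z) = 0.
Proof.
rewrite /ind_g /= -(tens_map_comp (f := ind_f) (g := snd) (h := \0)) //.
by rewrite tens_map0.
Qed.

Lemma ind_fg z : ind_f (tens_map U ind_g z) = 0.
Proof.
rewrite /ind_f /= -(tens_map_comp (f := ind_g) (g := fst) (h := \0)) //.
by rewrite tens_map0.
Qed.

Definition ind : morita_tuple V U := MoritaTuple ind_gf ind_fg.

Lemma ind_fE u x : tup_f ind (tpure u x) = (tpure u x.1, 0).
Proof. by rewrite /= tens_map_pure. Qed.

Lemma ind_gE v y : tup_g ind (tpure v y) = (0, tpure v y.2).
Proof. by rewrite /= tens_map_pure. Qed.

Section Hom.
Variables (T : morita_tuple V U).
Variables (a : {linear X -> tup_X T}) (b : {linear Y -> tup_Y T}).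

Definition ind_hom1 : {linear tup_X ind -> tup_X T} :=
  (a \o fst) \+ (tup_g T \o tens_map V b \o snd).
Definition ind_hom2 : {linear tup_Y ind -> tup_Y T} :=
  (tup_f T \o tens_map U a \o fst) \+ (b \o snd).

Lemma ind_hom_f u x :
  tup_f T (tpure u (ind_hom1 x)) = ind_hom2 (tup_f ind (tpure u x)).
Proof.
rewrite ind_fE /ind_hom1 /ind_hom2 /= pureDr linearD linear0 addr0.
rewrite tens_map_pure -[tpure u (tup_g _ _)](tens_map_pure (tup_g T)).
by rewrite tup_fg addr0.
Qed.

Lemma ind_hom_g v y :
  tup_g T (tpure v (ind_hom2 y)) = ind_hom1 (tup_g ind (tpure v y)).
Proof.
rewrite ind_gE /ind_hom1 /ind_hom2 /= pureDr linearD linear0 add0r.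
rewrite tens_map_pure -[tpure v (tup_f _ _)](tens_map_pure (tup_f T)).
by rewrite tup_gf add0r.
Qed.

Definition ind_hom : tmor ind T := Tmor ind_hom_f ind_hom_g.

Lemma ind_hom1E x : tm1 ind_hom (x, 0) = a x.
Proof. by rewrite /= !linear0 addr0. Qed.
Lemma ind_hom2E y : tm2 ind_hom (0, y) = b y.
Proof. by rewrite /= !linear0 add0r. Qed.

End Hom.

(** X and Y generate the induced tuple. *)
Lemma ind_ext T (p q : tmor ind T) :
  (forall x, tm1 p (x, 0) = tm1 q (x, 0)) ->
  (forall y, tm2 p (0, y) = tm2 q (0, y)) ->
  tm1 p =1 tm1 q /\ tm2 p =1 tm2 q.
Proof.
move=> e1 e2.
have s1 (x : tup_X ind) : x = (x.1, 0) + tup_g ind (tens_map V (inr_lin _ _) x.2).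
  rewrite /= -(tens_map_comp (h := idfun)) // tens_map_id //.
  by case: x => x w; congr pair; rewrite /= ?addr0 ?add0r.
have s2 (y : tup_Y ind) : y = tup_f ind (tens_map U (inl_lin _ _) y.1) + (0, y.2).
  rewrite /= -(tens_map_comp (h := idfun)) // tens_map_id //.
  by case: y => w y; congr pair; rewrite /= ?addr0 ?add0r.
have c1 (r : tmor ind T) (w : tensor V Y) :
    tm1 r (tup_g ind (tens_map V (inr_lin _ _) w)) =
    tup_g T (tens_map V (tm2 r \o inr_lin _ _) w).
  by rewrite -tm_gt; congr (tup_g T _); apply/esym/tens_map_comp.
have c2 (r : tmor ind T) (w : tensor U X) :
    tm2 r (tup_f ind (tens_map U (inl_lin _ _) w)) =
    tup_f T (tens_map U (tm1 r \o inl_lin _ _) w).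
  by rewrite -tm_ft; congr (tup_f T _); apply/esym/tens_map_comp.
split=> [x|y].
  rewrite (s1 x) !linearD e1 !c1; congr (_ + tup_g T _).
  elim/tens_ind: (x.2) => [|q' r IHq IHr|v y]; first by rewrite !tmap0.
    by rewrite !tmapD IHq IHr.
  by rewrite !tens_map_pure /= e2.
rewrite (s2 y) !linearD e2 !c2; congr (tup_f T _ + _).
elim/tens_ind: (y.1) => [|q' r IHq IHr|u x]; first by rewrite !tmap0.
  by rewrite !tmapD IHq IHr.
by rewrite !tens_map_pure /= e1.
Qed.

End Induced.

Lemma ind_hom_surj T (X : lmodType A) (Y : lmodType B)
    (a : {linear X -> tup_X T}) (b : {linear Y -> tup_Y T}) :
  surjective_map a -> surjective_map b ->
  surjective_map (tm1 (ind_hom a b)) /\ surjective_map (tm2 (ind_hom a b)).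
Proof.
move=> sa sb; split=> [x|y].
  by have [w <-] := sa x; exists (w, 0); rewrite ind_hom1E.
by have [w <-] := sb y; exists (0, w); rewrite ind_hom2E.
Qed.

Section Evaluation.
Variables (R R' : pzRingType) (W : bimodule R' R).

Lemma ev_balanced (Y : lmodType R') :
  balanced (fun (u : W) (h : hom_module W Y) => h u).
Proof. by split=> // u u' h; rewrite linearD. Qed.

Lemma ev_linear (Y : lmodType R') :
  linear (tens_lift (fun (u : W) (h : hom_module W Y) => h u)).
Proof.
have hb := ev_balanced Y.
move=> a q r; rewrite (tens_liftD hb); congr (_ + _).
elim/tens_ind: q => [|q r' IHq IHr|u x].
- by rewrite scaler0 [LHS]tens_lift_zero // [X in _ *: X]tens_lift_zero // scaler0.
- by rewrite scalerDr !(tens_liftD hb) scalerDr IHq IHr.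
- by rewrite scale_pure !tens_lift_pure // linearZ_LR.
Qed.

Definition ev (Y : lmodType R') : {linear tensor W (hom_module W Y) -> Y} :=
  mklin (@ev_linear Y).

Lemma evE (Y : lmodType R') u (h : hom_module W Y) : ev Y (tpure u h) = h u.
Proof. exact: tens_lift_pure (ev_balanced Y). Qed.

End Evaluation.

Opaque ev.

(** The tuple [X + Hom(U, Y), Hom(V, X) + Y] coinduced from (X, Y). *)
Section Coinduced.
Variables (X : lmodType A) (Y : lmodType B).

Definition coind_f : {linear tensor U (X * hom_module U Y)%type ->
    (hom_module V X * Y)%type} :=
  inr_lin _ _ \o ev U Y
    \o tens_map U (snd : {linear (X * hom_module U Y)%type -> hom_module U Y}).
Definition coind_g : {linear tensor V (hom_module V X * Y)%type ->
    (X * hom_module U Y)%type} :=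
  inl_lin _ _ \o ev V X
    \o tens_map V (fst : {linear (hom_module V X * Y)%type -> hom_module V X}).

Lemma coind_gf z : coind_g (tens_map V coind_f z) = 0.
Proof.
rewrite /coind_g /= -(tens_map_comp (f := coind_f) (g := fst) (h := \0)) //.
by rewrite tens_map0 ?linear0.
Qed.

Lemma coind_fg z : coind_f (tens_map U coind_g z) = 0.
Proof.
rewrite /coind_f /= -(tens_map_comp (f := coind_g) (g := snd) (h := \0)) //.
by rewrite tens_map0 ?linear0.
Qed.

Definition coind : morita_tuple V U := MoritaTuple coind_gf coind_fg.

Lemma coind_fE u x : tup_f coind (tpure u x) = (0, x.2 u).
Proof. by rewrite /= tens_map_pure evE. Qed.

Lemma coind_gE v y : tup_g coind (tpure v y) = (y.1 v, 0).
Proof. by rewrite /= tens_map_pure evE. Qed.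

Section Hom.
Variables (T : morita_tuple V U).
Variables (a : {linear tup_X T -> X}) (b : {linear tup_Y T -> Y}).

Definition coind_hom1 : {linear tup_X T -> tup_X coind} :=
  pair_lin a (hom_map U b \o adj (tup_f T) : {linear _ -> hom_module U Y}).
Definition coind_hom2 : {linear tup_Y T -> tup_Y coind} :=
  pair_lin (hom_map V a \o adj (tup_g T) : {linear _ -> hom_module V X}) b.

Lemma coind_hom_f u x :
  tup_f coind (tpure u (coind_hom1 x)) = coind_hom2 (tup_f T (tpure u x)).
Proof.
rewrite coind_fE; congr pair; apply: homP => v /=.
by rewrite -[tpure v _](tens_map_pure (tup_f T)) tup_gf linear0.
Qed.

Lemma coind_hom_g v y :
  tup_g coind (tpure v (coind_hom2 y)) = coind_hom1 (tup_g T (tpure v y)).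
Proof.
rewrite coind_gE; congr pair; apply: homP => u /=.
by rewrite -[tpure u _](tens_map_pure (tup_g T)) tup_fg linear0.
Qed.

Definition coind_hom : tmor T coind := Tmor coind_hom_f coind_hom_g.

End Hom.
End Coinduced.

Definition triv (X : lmodType A) (Y : lmodType B) : morita_tuple V U :=
  @MoritaTuple A B V U X Y (\0 : {linear _ -> _}) (\0 : {linear _ -> _})
    (fun=> erefl) (fun=> erefl).

End Tuples.

Definition swap (A B : pzRingType) (V : bimodule A B) (U : bimodule B A)
    (T : morita_tuple V U) : morita_tuple U V :=
  MoritaTuple (@tup_fg _ _ _ _ T) (@tup_gf _ _ _ _ T).

Definition swap_tmor (A B : pzRingType) (V : bimodule A B) (U : bimodule B A)
    (T T' : morita_tuple V U) (p : tmor T T') : tmor (swap T) (swap T') :=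
  @Tmor _ _ _ _ (swap T) (swap T') (tm2 p) (tm1 p) (tm_g p) (tm_f p).

Lemma swap_ses (A B : pzRingType) (V : bimodule A B) (U : bimodule B A)
    (TK T T' : morita_tuple V U) (i : tmor TK T) (p : tmor T T') :
  tuple_ses i p -> tuple_ses (swap_tmor i) (swap_tmor p).
Proof. by case. Qed.

(** * The two structure maps and their kernels and cokernels *)

Lemma adj_comp0 (A B : pzRingType) (V : bimodule A B) (U : bimodule B A)
    (T : morita_tuple V U) x :
  hom_map U (adj (tup_g T)) (adj (tup_f T) x) = 0.
Proof. by apply: homP => u; apply: homP => v; apply: tup_gf_pure. Qed.

Section Coinduction.
Variables (A B : pzRingType) (V : bimodule A B) (U : bimodule B A).
Variables (TK TL TM : morita_tuple V U) (i : tmor TK TL) (p : tmor TL TM).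
Hypothesis ip : tuple_ses i p.

Local Notation kerf T := (ker_module (adj (tup_f T))).
Local Notation kerg T := (ker_module (adj (tup_g T))).

Lemma adj0 (R R' : pzRingType) (W : bimodule R' R) (X : lmodType R)
    (Y : lmodType R') (f : {linear tensor W X -> Y}) x :
  adj f x = 0 -> forall u, f (tpure u x) = 0.
Proof. by move=> fx u; have := congr1 (fun h : hom_module W Y => h u) fx. Qed.

(** The only issue is that Ker f_L -> Ker f_M is onto.  If x lifts an element
    killed by f_M, then f_L x takes values in Y_K, exactness for TK writes it as
    f_K x', and x - x' is the lift sought. *)
Lemma kerf_ses : exact_at (adj (tup_f TK)) (hom_map U (adj (tup_g TK))) ->
  exists (a : {linear kerf TK -> kerf TL}) (b : {linear kerf TL -> kerf TM}),
    short_exact a b /\ forall x, ker_val (b x) = tm1 p (ker_val x).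
Proof.
case: ip => ip1 ip2 eK.
have [a aE] : exists a : {linear kerf TK -> kerf TL}, forall x,
    ker_val (a x) = tm1 i (ker_val x).
  apply: (factor_inj (f := tm1 i \o @ker_val _ _ _ _)); first exact: ker_val_inj.
  move=> x; apply: ker_intro; apply: homP => u /=.
  by rewrite tm_f (adj0 (ker_valE x)) linear0.
have [b bE] : exists b : {linear kerf TL -> kerf TM}, forall x,
    ker_val (b x) = tm1 p (ker_val x).
  apply: (factor_inj (f := tm1 p \o @ker_val _ _ _ _)); first exact: ker_val_inj.
  move=> x; apply: ker_intro; apply: homP => u /=.
  by rewrite tm_f (adj0 (ker_valE x)) linear0.
exists a, b; split=> //; split.
- by move=> x y xy; apply/ker_val_inj/(ses_inj ip1); rewrite -!aE xy.
- move=> x; split=> [x0|[y <-]]; last first.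
    by apply: ker_val_inj; rewrite bE aE (ses_comp0 _ ip1).
  have [y yE] : exists y, tm1 i y = ker_val x.
    by apply/(ses_exact ip1); rewrite -bE x0.
  have [z zE] : exists z : kerf TK, ker_val z = y.
    apply: ker_intro; apply: homP => u; apply: (ses_inj ip2) => /=.
    by rewrite -tm_f yE (adj0 (ker_valE x)) linear0.
  by exists z; apply: ker_val_inj; rewrite aE zE.
- move=> k; have [x xE] := ses_surj ip1 (ker_val k).
  (* h is f_L x with values in Y_K, and x' corrects x. *)
  have [h hE] : exists h : {linear U -> tup_Y TK},
      forall u, tm2 i (h u) = adj (tup_f TL) x u.
    apply: (factor_inj (ses_inj ip2)) => u; apply/(ses_exact ip2).
    by rewrite /= -tm_f xE (adj0 (ker_valE k)).
  have [|x' x'E] := proj1 (eK (HomModule (linearP h))).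
    apply: homP => u; apply: homP => v /=; apply: (ses_inj ip1).
    rewrite -tm_g hE /= -[tpure v _](tens_map_pure (tup_f TL)) tup_gf.
    by rewrite linear0.
  have [z zE] : exists z : kerf TL, ker_val z = x - tm1 i x'.
    apply: ker_intro; apply: homP => u.
    rewrite /= pureBr linearB tm_f; apply/eqP; rewrite subr_eq0; apply/eqP.
    have := congr1 (fun h : hom_module U _ => tm2 i (h u)) x'E.
    by rewrite /= hE => ->.
  exists z; apply: ker_val_inj.
  by rewrite bE zE linearB (ses_comp0 _ ip1) subr0 xE.
Qed.

(** A map U -> ker g of the quotient lifts to the middle term as Ext^1 of U
    vanishes on the kernel term. *)
Lemma coind_exact (a : {linear kerg TK -> kerg TL}) (b : {linear kerg TL -> kerg TM}) :
  short_exact a b -> (forall x, ker_val (b x) = tm2 p (ker_val x)) ->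
  exact_at (adj (tup_f TL)) (hom_map U (adj (tup_g TL))) ->
  Ext_eq0 1 U (kerg TK) ->
  exact_at (adj (tup_f TM)) (hom_map U (adj (tup_g TM))).
Proof.
move=> hab bE eL v h; split=> [gh|[x <-]]; last exact: adj_comp0.
have [k kE] : exists k : {linear U -> kerg TM}, forall u, ker_val (k u) = h u.
  apply: (factor_inj (f := (h : {linear U -> tup_Y TM}))); first exact: ker_val_inj.
  move=> u; apply: ker_intro.
  by have := congr1 (fun z : hom_module U _ => z u) gh.
have [l lE] := Ext1_lift k hab v.
have [|x xE] := proj1 (eL (HomModule (linearP (@ker_val _ _ _ _ \o l)))).
  by apply: homP => u /=; rewrite ker_valE.
exists (tm1 p x); apply: homP => u; rewrite /= tm_f.
have := congr1 (fun z : hom_module U _ => tm2 p (z u)) xE.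
by rewrite /= -bE lE kE.
Qed.

End Coinduction.

(** Left exactness of Hom(U, -) identifies the kernel of Hom(U, g), which is the
    image of f, with Hom(U, Ker g). *)
Lemma coind_extension (A B : pzRingType) (V : bimodule A B) (U : bimodule B A)
    (T : morita_tuple V U) :
  exact_at (adj (tup_f T)) (hom_map U (adj (tup_g T))) ->
  exists b : {linear tup_X T -> hom_module U (ker_module (adj (tup_g T)))},
    short_exact (@ker_val _ _ _ (adj (tup_f T))) b.
Proof.
move=> e.
have kinj : injective (hom_map U (@ker_val _ _ _ (adj (tup_g T)))).
  move=> h k hk; apply: homP => u; apply: ker_val_inj.
  by have := congr1 (fun z : hom_module U _ => z u) hk.
have kim h : hom_map U (adj (tup_g T)) h = 0 ->
    exists k, hom_map U (@ker_val _ _ _ (adj (tup_g T))) k = h.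
  move=> gh; have [|k kE] := @factor_inj _ _ _ _
      (@ker_val _ _ _ (adj (tup_g T))) (h : {linear U -> tup_Y T})
      (@ker_val_inj _ _ _ _).
    move=> u; apply: ker_intro.
    by have := congr1 (fun z : hom_module U _ => z u) gh.
  by exists (HomModule (linearP k)); apply: homP => u; apply: kE.
have [b bE] := factor_inj kinj (fun x => kim _ (exact_at0 x e)).
exists b; split; first exact: ker_val_inj.
- move=> x; split=> [x0|[k <-]].
    by apply: ker_intro; rewrite -bE x0 linear0.
  by apply: kinj; rewrite bE ker_valE linear0.
- move=> k; have [|x xE] := proj1 (e (hom_map U (@ker_val _ _ _ _) k)).
    by apply: homP => u /=; rewrite ker_valE.
  by exists x; apply: kinj; rewrite bE.
Qed.

Section Induction.
Variables (A B : pzRingType) (V : bimodule A B) (U : bimodule B A).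
Variables (TK TL TM : morita_tuple V U) (i : tmor TK TL) (p : tmor TL TM).
Hypothesis ip : tuple_ses i p.
Variables (FL FM : lmodType A).
Variables (cL : {linear tup_X TL -> FL}) (cM : {linear tup_X TM -> FM}).
Hypotheses (cLs : surjective_map cL) (cMs : surjective_map cM).
Hypotheses (cLe : exact_at (tup_g TL) cL) (cMe : exact_at (tup_g TM) cM).

Lemma coker_map : exists q : {linear FL -> FM},
  surjective_map q /\ forall x, q (cL x) = cM (tm1 p x).
Proof.
have [|q qE] := @factor_surj _ _ _ _ cL (cM \o tm1 p : {linear _ -> _}) cLs.
  move=> x /cLe[w <-] /=; rewrite -tm_gt; exact: exact_at0 cMe.
exists q; split=> // y; have [x <-] := cMs y.
by have [z <-] := ses_surj ip.1 x; exists (cL z); rewrite qE.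
Qed.

(** The snake argument: z = cL x maps to zero in FM, so p x = g_M w'', and
    subtracting from x the image of a lift of w'' moves x into X_K. *)
Lemma coker_ker (q : {linear FL -> FM}) :
  (forall x, q (cL x) = cM (tm1 p x)) ->
  exists c : {linear tup_X TK -> ker_module q},
    surjective_map c /\ forall x, ker_val (c x) = cL (tm1 i x).
Proof.
case: ip => ip1 ip2 qE.
have [c cE] : exists c : {linear tup_X TK -> ker_module q},
    forall x, ker_val (c x) = cL (tm1 i x).
  apply: (factor_inj (f := cL \o tm1 i)); first exact: ker_val_inj.
  by move=> x; apply: ker_intro; rewrite /= qE (ses_comp0 _ ip1) linear0.
exists c; split=> // z; have [x xE] := cLs (ker_val z).
have /cMe[w'' w''E] : cM (tm1 p x) = 0 by rewrite -qE xE ker_valE.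
have [w wE] := tens_map_surj V (ses_surj ip2) w''.
have [k kE] : exists k, tm1 i k = x - tup_g TL w.
  by apply/(ses_exact ip1); rewrite linearB -tm_gt wE w''E subrr.
exists k; apply: ker_val_inj.
by rewrite cE kE linearB (exact_at0 _ cLe) subr0.
Qed.

Variables (GL GM : lmodType B).
Variables (dL : {linear tup_Y TL -> GL}) (dM : {linear tup_Y TM -> GM}).
Variables (r : {linear GL -> GM}) (d : {linear tup_Y TK -> ker_module r}).
Hypotheses (dLs : surjective_map dL) (dLe : exact_at (tup_f TL) dL).
Hypotheses (dMe : exact_at (tup_f TM) dM).
Hypothesis rs : surjective_map r.
Hypothesis rE : forall y, r (dL y) = dM (tm2 p y).
Hypothesis ds : surjective_map d.
Hypothesis dE : forall y, ker_val (d y) = dL (tm2 i y).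
Hypothesis eL : exact_at (tens_map V (tup_f TL)) (tup_g TL).
Hypothesis eM : exact_at (tens_map V (tup_f TM)) (tup_g TM).

(** If k in X_K dies in FL, then k = g_L w.  The class of w in V (x) GL dies in
    V (x) GM, so it comes from V (x) Y_K, and g_L sees only this class. *)
Lemma coker_exact (q : {linear FL -> FM}) (c : {linear tup_X TK -> ker_module q}) :
  (forall x, ker_val (c x) = cL (tm1 i x)) -> exact_at (tup_g TK) c.
Proof.
case: ip => ip1 ip2 cE k; split=> [ck|[w <-]]; last first.
  by apply: ker_val_inj; rewrite cE -tm_gt (exact_at0 _ cLe).
have /cLe[w wE] : cL (tm1 i k) = 0 by rewrite -cE ck.
have /eM[s sE] : tup_g TM (tens_map V (tm2 p) w) = 0.
  by rewrite tm_gt wE (ses_comp0 _ ip1).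
have : tens_map V r (tens_map V dL w) = 0.
  rewrite -(tens_map_comp (h := dM \o tm2 p)) => [|y] /=; last by rewrite rE.
  rewrite (tens_map_comp (f := tm2 p) (g := dM)) // -sE.
  rewrite -(tens_map_comp (h := \0)) ?tens_map0 // => x /=.
  by rewrite (exact_at0 _ dMe).
move=> /(tens_exact V rs (@ker_exact _ _ _ r))[y yE].
have [wK wKE] := tens_map_surj V ds y.
have : tens_map V dL (w - tens_map V (tm2 i) wK) = 0.
  rewrite linearB; apply/eqP; rewrite subr_eq0; apply/eqP.
  rewrite [LHS](esym yE) -wKE.
  rewrite -(tens_map_comp (h := dL \o tm2 i)) => [|z] /=; last by rewrite dE.
  exact: tens_map_comp.
move=> /(tens_exact V dLs dLe)/eL.
rewrite linearB tm_gt wE => /eqP; rewrite subr_eq0 => /eqP/(ses_inj ip1) ->.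
by exists wK.
Qed.

(** An element w of V (x) Y_K killed by g dies in V (x) GL.  As Tor_1(V, GM)
    vanishes, it dies already in V (x) Ker r, and Y_K covers Ker r with kernel
    the image of f. *)
Lemma ind_exact : exact_at (tup_f TK) d -> tor_vanishing V 0 GM ->
  exact_at (tens_map V (tup_f TK)) (tup_g TK).
Proof.
case: ip => ip1 ip2 eK v w; split=> [gw|[t <-]]; last exact: tup_gf.
have /eL[s sE] : tup_g TL (tens_map V (tm2 i) w) = 0 by rewrite tm_gt gw linear0.
apply/(tens_exact V ds eK).
apply: (ses_inj (tor_vanishing_ses (ker_ses rs) v)).
rewrite /= -(tens_map_comp (h := dL \o tm2 i)) => [|z] /=; last by rewrite dE.
rewrite (tens_map_comp (f := tm2 i) (g := dL)) // -sE tmap0.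
rewrite -(tens_map_comp (h := \0)) ?tens_map0 // => x /=.
by rewrite (exact_at0 _ dLe).
Qed.

End Induction.

(** The map g factors through V (x) Coker f, and exactness at V (x) Y says that
    the induced map is injective. *)
Lemma ind_extension (A B : pzRingType) (V : bimodule A B) (U : bimodule B A)
    (T : morita_tuple V U) (F : lmodType A) (G : lmodType B)
    (c : {linear tup_X T -> F}) (d : {linear tup_Y T -> G}) :
  surjective_map c -> exact_at (tup_g T) c ->
  surjective_map d -> exact_at (tup_f T) d ->
  exact_at (tens_map V (tup_f T)) (tup_g T) ->
  exists b : {linear tensor V G -> tup_X T}, short_exact b c.
Proof.
move=> cs ce ds de e.
have kerE x : tens_map V d x = 0 <-> tup_g T x = 0.
  split=> [/(tens_exact V ds de)/e|/e/(tens_exact V ds de)] //.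
have [|b bE] := @factor_surj _ _ _ _ (tens_map V d) (tup_g T) (tens_map_surj V ds).
  by move=> x /kerE.
exists b; split=> //.
- apply: linear_inj0 => x bx; have [w wE] := tens_map_surj V ds x.
  by rewrite -wE; apply/kerE; rewrite -bE; apply: etrans bx; congr (b _).
- move=> x; split=> [/ce[w <-]|[w <-]]; first by exists (tens_map V d w); rewrite bE.
  have [z <-] := tens_map_surj V ds w.
  by rewrite bE (exact_at0 _ ce).
Qed.

(** * Cotorsion pairs over the Morita ring *)

(** The ring S stands for the Morita ring, s for an isomorphism onto it; taking
    for s the exchange of the two corners gives the statements about B from
    those about A. *)
Section Pairs.
Variables (A B : pzRingType) (V : bimodule A B) (U : bimodule B A).
Variables (S : pzRingType) (s : {rmorphism S -> morita V U}).
Hypothesis ss : surjective_map s.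

Definition tmod (T : morita_tuple V U) : lmodType S :=
  restrict s (tuple_module T).

Hypothesis ess_surj : forall M : lmodType S, exists T, isomorphic M (tmod T).

Implicit Types T : morita_tuple V U.

Lemma tmodZ T a (z : tmod T) : a *: z = tuple_scale (s a) z.
Proof. by []. Qed.

Lemma tfun_linear T T' (p : tmor T T') :
  linear (fun z : tmod T => (tm1 p z.1, tm2 p z.2) : tmod T').
Proof.
move=> a [x y] [x' y']; rewrite !tmodZ /tuple_scale /=.
congr pair; rewrite /= !linearD linearZ_LR /=; congr (_ + _).
  by rewrite tm_g.
by rewrite tm_f.
Qed.

Definition tfun T T' (p : tmor T T') : {linear tmod T -> tmod T'} :=
  mklin (tfun_linear p).

Lemma tfunE T T' (p : tmor T T') x y : tfun p (x, y) = (tm1 p x, tm2 p y).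
Proof. by []. Qed.

(** The idempotents of the two corners split a linear map into two
    components. *)
Lemma tmod_hom T T' (f : {linear tmod T -> tmod T'}) :
  exists p : tmor T T', forall z, f z = tfun p z.
Proof.
have [e1 e1E] := ss (Morita 1 0 0 0); have [e2 e2E] := ss (Morita 0 0 0 1).
have f1 x : (f (x, 0)).2 = 0.
  have -> : (x, 0) = e1 *: ((x, 0) : tmod T).
    by rewrite tmodZ e1E /tuple_scale /= !pure0l !linear0 scale1r addr0 scale0r addr0.
  by rewrite linearZ_LR tmodZ e1E /= pure0l linear0 scale0r addr0.
have f2 y : (f (0, y)).1 = 0.
  have -> : (0, y) = e2 *: ((0, y) : tmod T).
    by rewrite tmodZ e2E /tuple_scale /= !pure0l !linear0 scale1r add0r scale0r addr0.
  by rewrite linearZ_LR tmodZ e2E /= pure0l linear0 scale0r addr0.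
have l1 : linear (fun x : tup_X T => (f (x, 0)).1).
  move=> a x x'; have [e eE] := ss (Morita a 0 0 0).
  have -> : (a *: x + x', 0) = e *: ((x, 0) : tmod T) + ((x', 0) : tmod T).
    rewrite tmodZ eE; congr pair;
      by rewrite /= !pure0l !linear0 ?scale0r !addr0.
  by rewrite linearP tmodZ eE /= pure0l linear0 addr0.
have l2 : linear (fun y : tup_Y T => (f (0, y)).2).
  move=> a y y'; have [e eE] := ss (Morita 0 0 0 a).
  have -> : (0, a *: y + y') = e *: ((0, y) : tmod T) + ((0, y') : tmod T).
    rewrite tmodZ eE; congr pair;
      by rewrite /= ?pure0l ?linear0 ?scale0r ?add0r ?addr0.
  by rewrite linearP tmodZ eE /= pure0l linear0 add0r.
have cf u x : tup_f T' (tpure u (f (x, 0)).1) = (f (0, tup_f T (tpure u x))).2.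
  have [e eE] := ss (Morita 0 0 u 0).
  have -> : (0, tup_f T (tpure u x)) = e *: ((x, 0) : tmod T).
    by rewrite tmodZ eE; congr pair;
      rewrite /= ?pure0l ?linear0 ?scale0r ?add0r ?addr0.
  by rewrite linearZ_LR tmodZ eE /= scale0r addr0.
have cg v y : tup_g T' (tpure v (f (0, y)).2) = (f (tup_g T (tpure v y), 0)).1.
  have [e eE] := ss (Morita 0 v 0 0).
  have -> : (tup_g T (tpure v y), 0) = e *: ((0, y) : tmod T).
    by rewrite tmodZ eE; congr pair;
      rewrite /= ?pure0l ?linear0 ?scale0r ?add0r ?addr0.
  by rewrite linearZ_LR tmodZ eE /= scale0r add0r.
exists (@Tmor _ _ _ _ T T' (mklin l1) (mklin l2) cf cg) => -[x y].
have -> : (x, y) = ((x, 0) : tmod T) + ((0, y) : tmod T).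
  by congr pair; rewrite /= ?addr0 ?add0r.
rewrite linearD tfunE [LHS]surjective_pairing; congr pair => /=.
  by rewrite f2 !addr0.
by rewrite f1 !add0r.
Qed.

Lemma tfun_ses TK T T' (i : tmor TK T) (p : tmor T T') :
  tuple_ses i p <-> short_exact (tfun i) (tfun p).
Proof.
split=> [[h1 h2]|h].
  split.
  - by move=> [x y] [x' y'] [/(ses_inj h1) -> /(ses_inj h2) ->].
  - move=> [x y]; split=> [[]|[[x' y'] [<- <-]]].
      move=> /(ses_exact h1)[x' <-] /(ses_exact h2)[y' <-].
      by exists (x', y').
    by rewrite tfunE (ses_comp0 _ h1) (ses_comp0 _ h2).
  - move=> [x y]; have [x' <-] := ses_surj h1 x.
    by have [y' <-] := ses_surj h2 y; exists (x', y').
split; split.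
- move=> x x' xx'; have := @ses_inj _ _ _ _ _ _ h (x, 0) (x', 0).
  by rewrite !tfunE xx' => /(_ erefl)[].
- move=> x; split=> [px|[k <-]].
    have /(ses_exact h)[[k k'] [<- _]] : tfun p (x, 0) = 0.
      by rewrite tfunE px linear0.
    by exists k.
  by have := ses_comp0 ((k, 0) : tmod TK) h; rewrite !tfunE => -[].
- by move=> x; have [[k k'] [<- _]] := ses_surj h (x, 0); exists k.
- move=> x x' xx'; have := @ses_inj _ _ _ _ _ _ h (0, x) (0, x').
  by rewrite !tfunE xx' => /(_ erefl)[].
- move=> x; split=> [px|[k <-]].
    have /(ses_exact h)[[k' k] [_ <-]] : tfun p (0, x) = 0.
      by rewrite tfunE px linear0.
    by exists k.
  by have := ses_comp0 ((0, k) : tmod TK) h; rewrite !tfunE => -[].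
- by move=> x; have [[k' k] [_ <-]] := ses_surj h (0, x); exists k.
Qed.

(** Transport along the three isomorphisms. *)
Lemma ses_tuples (K L M : lmodType S) (f : {linear K -> L}) (g : {linear L -> M})
    TK TL TM :
  short_exact f g -> isomorphic K (tmod TK) -> isomorphic L (tmod TL) ->
  isomorphic M (tmod TM) ->
  exists (i : tmor TK TL) (p : tmor TL TM), tuple_ses i p.
Proof.
move=> h [eK eKb] [eL eLb] [eM eMb].
have [eK' [eKK eKK']] := iso_inverse eKb.
have [eL' [eLK eLK']] := iso_inverse eLb.
have [eM' [eMK eMK']] := iso_inverse eMb.
have [i iE] := tmod_hom (eL \o f \o eK' : {linear _ -> _}).
have [p pE] := tmod_hom (eM \o g \o eL' : {linear _ -> _}).
exists i, p; apply/tfun_ses; split.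
- move=> x y; rewrite -!iE => /(bij_inj eLb)/(ses_inj h).
  exact: (can_inj eKK').
- move=> x; split=> [|[k <-]].
    rewrite -pE -[0](linear0 eM) => /(bij_inj eMb)/(ses_exact h)[k kE].
    by exists (eK k); rewrite -iE /= eKK kE eLK'.
  by rewrite -pE -iE /= eLK (ses_comp0 _ h) linear0.
- move=> m; have [l lE] := ses_surj h (eM' m).
  by exists (eL l); rewrite -pE /= eLK lE eMK'.
Qed.

Lemma tuple_iso T T' : isomorphic (tmod T) (tmod T') ->
  isomorphic (tup_X T) (tup_X T').
Proof.
move=> [e eb]; have [p pE] := tmod_hom e; exists (tm1 p).
have [e' eK e'K] := eb; apply: linear_bij.
  move=> x y xy; have : e (x, 0) = e (y, 0) by rewrite !pE !tfunE xy.
  by move=> /(bij_inj eb)[].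
move=> x; exists (e' (x, 0)).1.
have := e'K (x, 0); rewrite pE; case: (e' _) => a b.
by rewrite tfunE => -[].
Qed.

Lemma tuple_kernel T T' (p : tmor T T') :
  surjective_map (tm1 p) -> surjective_map (tm2 p) ->
  exists TK (i : tmor TK T), tuple_ses i p.
Proof.
move=> p1 p2; have ps : surjective_map (tfun p).
  by move=> [x y]; have [a <-] := p1 x; have [b <-] := p2 y; exists (a, b).
have [TK kK] := ess_surj (ker_module (tfun p)).
have [i [q h]] := ses_tuples (ker_ses ps) kK (iso_refl _) (iso_refl _).
have [e eb] := kK; have [e' [eK eK']] := iso_inverse eb.
have [j jE] := tmod_hom (@ker_val _ _ _ (tfun p) \o e' : {linear _ -> _}).
exists TK, j; apply/tfun_ses; split=> //.
- by move=> x y; rewrite -!jE => /ker_val_inj/(can_inj eK').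
- move=> x; split=> [/ker_intro[k <-]|[k <-]]; last first.
    by rewrite -jE; apply: ker_valE.
  by exists (e k); rewrite -jE /= eK.
Qed.

Lemma tmod_ind_projective (P : lmodType A) (Q : lmodType B) :
  projective_module P -> projective_module Q ->
  projective_module (tmod (ind V U P Q)).
Proof.
move=> PP PQ M N p f ps.
have [TM [eM eMb]] := ess_surj M; have [TN [eN eNb]] := ess_surj N.
have [eM' [eMK eMK']] := iso_inverse eMb.
have [eN' [eNK eNK']] := iso_inverse eNb.
have [q qE] := tmod_hom (eN \o p \o eM' : {linear _ -> _}).
have [g gE] := tmod_hom (eN \o f : {linear _ -> _}).
have qs : surjective_map (tfun q).
  move=> y; have [x xE] := ps (eN' y); exists (eM x).
  by rewrite -qE /= eMK xE eNK'.
have q1 : surjective_map (tm1 q).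
  by move=> x; have [[a b] [<- _]] := qs (x, 0); exists a.
have q2 : surjective_map (tm2 q).
  by move=> x; have [[a b] [_ <-]] := qs (0, x); exists b.
have [a aE] := PP _ _ (tm1 q) (tm1 g \o inl_lin _ _ : {linear _ -> _}) q1.
have [b bE] := PQ _ _ (tm2 q) (tm2 g \o inr_lin _ _ : {linear _ -> _}) q2.
pose h := ind_hom a b.
have cf u x : tup_f TN (tpure u (tm1 q (tm1 h x)))
    = tm2 q (tm2 h (tup_f (ind V U P Q) (tpure u x))).
  by rewrite tm_f tm_f.
have cg v y : tup_g TN (tpure v (tm2 q (tm2 h y)))
    = tm1 q (tm1 h (tup_g (ind V U P Q) (tpure v y))).
  by rewrite tm_g tm_g.
pose qh := @Tmor _ _ _ _ _ _ (tm1 q \o tm1 h) (tm2 q \o tm2 h) cf cg.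
have [|| e1 e2] := @ind_ext _ _ _ _ _ _ _ qh g.
- move=> x; apply: (etrans (congr1 (tm1 q) (ind_hom1E a b x))); exact: aE.
- move=> x; apply: (etrans (congr1 (tm2 q) (ind_hom2E a b x))); exact: bE.
exists (eM' \o tfun h : {linear _ -> _}) => -[x y].
apply: (bij_inj eNb); rewrite [RHS]gE.
by rewrite [LHS]qE !tfunE; congr pair; [apply: e1 | apply: e2].
Qed.

(** ** Ext over the Morita ring *)

Lemma ind_cover T : exists (p : tmor (ind V U (free_cover (tup_X T))
    (free_cover (tup_Y T))) T),
  surjective_map (tm1 p) /\ surjective_map (tm2 p).
Proof.
exists (ind_hom (cover_map _) (cover_map _)).
by apply: ind_hom_surj; apply: cover_map_surj.
Qed.

Lemma tensor_zero_mod (t : tensor V (zero_mod B)) : t = 0.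
Proof.
elim/tens_ind: t => [|q r -> ->|w y] //; first by rewrite addr0.
by rewrite (zero_modP y) pure0r.
Qed.

Lemma zero_mod_projective : projective_module (zero_mod B).
Proof.
by move=> M N p f ps; exists (\0 : {linear _ -> _}) => x;
  rewrite (zero_modP x) !linear0.
Qed.

Section ExtCoinduced.
Variable C : lmodType A.
Local Notation HC := (coind V U C (zero_mod B)).

(** A map from the A-component of T to C is a map from T to the coinduced
    module. *)
Lemma coind_extends TK T (i : tmor TK T) :
  extends_to (tmod HC) (tfun i) -> extends_to C (tm1 i).
Proof.
move=> e phi; have [psi psiE] := e (tfun (coind_hom phi (\0 : {linear _ -> _}))).
have [q qE] := tmod_hom psi.
exists (fst \o tm1 q : {linear _ -> _}) => x.
have := psiE (x, 0); rewrite qE !tfunE => -[] /(congr1 fst) /= -> _.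
by [].
Qed.

(** This A-component is the sum of P and of copies of V. *)
Lemma ind_X_ext_vanishing j (P : lmodType A) (Y : lmodType B) :
  projective_module P -> ext_vanishing C j V ->
  ext_vanishing C j (tup_X (ind V U P (free_cover Y))).
Proof.
move=> PP v; apply: (ext_vanishing_mid (prod_ses _ _)).
  exact: ext_vanishing_projective.
apply: (vanishing_iso (tens_free_iso V Y)).
exact: fsum_ext_vanishing.
Qed.

(** Cover T by an induced tuple Q.  The syzygies over the Morita ring restrict
    to syzygies over A relative to the A-component of Q, which is acyclic for
    Hom(-, C). *)
Lemma coind_Ext j T : (forall k, (k <= j)%N -> ext_vanishing C k V) ->
  ext_vanishing (tmod HC) j (tmod T) -> ext_vanishing C j (tup_X T).
Proof.
elim: j T => [|j IH] T vV v.
all: have [p [p1 p2]] := ind_cover T.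
all: have [TK [i h]] := tuple_kernel p1 p2.
all: have PQ := tmod_ind_projective (@free_cover_projective _ (tup_X T))
  (@free_cover_projective _ (tup_Y T)).
all: have vQ := ind_X_ext_vanishing (tup_Y T)
  (@free_cover_projective _ (tup_X T)) (vV _ (leqnn _)).
all: have vK := v _ _ _ _ PQ (proj1 (tfun_ses i p) h).
  exact: (ext_vanishing_coker0 h.1 (coind_extends vK) vQ).
apply: (ext_vanishing_coker h.1 _ vQ).
by apply: IH => // k kj; apply: vV; apply: leqW.
Qed.

(** One degree is gained on a module concentrated in the corner A: the
    X-component of its projective cover is then projective. *)
Lemma coind_Ext_top j (X : lmodType A) :
  (forall k, (k <= j)%N -> ext_vanishing C k V) ->
  ext_vanishing (tmod HC) j.+1 (tmod (triv V U X (zero_mod B))) ->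
  ext_vanishing C j.+1 X.
Proof.
move=> vV v; set T := triv V U X (zero_mod B) in v.
pose Z := zero_mod B.
pose p : tmor (ind V U (free_cover X) Z) T :=
  ind_hom (T := T) (cover_map X) (idfun : {linear Z -> Z}).
have [p1 p2] : surjective_map (tm1 p) /\ surjective_map (tm2 p).
  by apply: ind_hom_surj; [exact: cover_map_surj | move=> y; exists y].
have [TK [i h]] := tuple_kernel p1 p2.
have PQ := tmod_ind_projective (@free_cover_projective _ X) zero_mod_projective.
have vK := coind_Ext vV (v _ _ _ _ PQ (proj1 (tfun_ses i p) h)).
apply: (ext_vanishing_coker h.1 vK).
apply: ext_vanishing_projective; apply: prod_projective.
  exact: free_cover_projective.
by move=> M N q f qs; exists (\0 : {linear _ -> _}) => x; rewrite
  (tensor_zero_mod x) !linear0.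
Qed.

End ExtCoinduced.

Section ExtInduced.
Variable C : lmodType A.
Local Notation Z := (zero_mod B).
Local Notation TX X := (ind V U X Z).
Local Notation ZC := (triv V U C Z).

Definition ind_map (X X' : lmodType A) (f : {linear X -> X'}) :
    tmor (TX X) (TX X') :=
  ind_hom (T := TX X') (inl_lin _ _ \o f : {linear _ -> (_ * _)%type})
    (\0 : {linear _ -> _}).

Lemma ind_map1E (X X' : lmodType A) (f : {linear X -> X'}) x :
  tm1 (ind_map f) x = (f x.1, 0).
Proof.
case: x => x w; rewrite (tensor_zero_mod w).
exact: ind_hom1E.
Qed.

Lemma ind_map2E (X X' : lmodType A) (f : {linear X -> X'}) y :
  tm2 (ind_map f) y = (tens_map U f y.1, 0).
Proof.
case: y => t z; rewrite /= addr0 -(tens_map_comp (h := f)) //.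
Qed.

Lemma ses_pad (R : pzRingType) (K L M E F G : lmodType R)
    (f : {linear K -> L}) (g : {linear L -> M})
    (f' : {linear (K * E)%type -> (L * F)%type})
    (g' : {linear (L * F)%type -> (M * G)%type}) :
  zero_module E -> zero_module F -> zero_module G ->
  (forall x, f' x = (f x.1, 0)) -> (forall x, g' x = (g x.1, 0)) ->
  short_exact f g -> short_exact f' g'.
Proof.
move=> E0 F0 G0 fE gE h; split.
- move=> [x e] [x' e']; rewrite !fE /= => -[/(ses_inj h) ->].
  by rewrite (E0 e) (E0 e').
- move=> [x e]; split=> [|[k <-]]; last by rewrite gE fE /= (ses_comp0 _ h).
  rewrite gE => -[/(ses_exact h)[k <-]]; exists (k, 0).
  by rewrite fE (F0 e).
- move=> [x e]; have [y <-] := ses_surj h x; exists (y, 0).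
  by rewrite gE (G0 e).
Qed.

Lemma ind_ses (K P X : lmodType A) (f : {linear K -> P}) (g : {linear P -> X}) :
  short_exact f g -> tor_vanishing U 0 X ->
  tuple_ses (ind_map f) (ind_map g).
Proof.
move=> h v; split.
  apply: (ses_pad _ _ _ (ind_map1E f) (ind_map1E g) h); exact: tensor_zero_mod.
apply: (ses_pad _ _ _ (ind_map2E f) (ind_map2E g) (tor_vanishing_ses h v));
  exact: zero_modP.
Qed.

Lemma ind_map_surj (P X : lmodType A) (g : {linear P -> X}) :
  surjective_map g ->
  surjective_map (tm1 (ind_map g)) /\ surjective_map (tm2 (ind_map g)).
Proof.
move=> gs; split=> [[x w]|[t z]].
  have [y <-] := gs x; exists (y, 0).
  by rewrite ind_map1E (tensor_zero_mod w).
have [y <-] := tens_map_surj U gs t; exists (y, 0).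
by rewrite ind_map2E (zero_modP z).
Qed.

(** Cover X by a projective P.  In degree one, a map from the syzygy of X to C
    is a map to Z(C) from the kernel of T(P) -> T(X), because the structure map
    from the B-component of T(P) to P is zero.  In higher degrees, vanishing
    Tor makes T(K) -> T(P) -> T(X) exact. *)
Lemma ind_Ext j (X : lmodType A) : (forall k, (k < j)%N -> tor_vanishing U k X) ->
  ext_vanishing (tmod ZC) j (tmod (TX X)) -> ext_vanishing C j X.
Proof.
elim: j X => [|j IH] X vU v K P f g PP h; last first.
  apply: IH => [k kj|]; first exact: (vU k.+1 kj _ _ _ _ PP h).
  apply: v (tmod_ind_projective PP zero_mod_projective) _.
  exact: (proj1 (tfun_ses _ _) (ind_ses h (vU 0%N isT))).
have [p1 p2] := ind_map_surj (ses_surj h).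
have [TK [i ip]] := tuple_kernel p1 p2.
have e := v _ _ _ _ (tmod_ind_projective PP zero_mod_projective)
  (proj1 (tfun_ses _ _) ip).
have [k kE] : exists k : {linear tup_X TK -> K}, forall x, f (k x) = (tm1 i x).1.
  apply: (factor_inj (f := fst \o tm1 i)); first exact: ses_inj h.
  move=> x; apply/(ses_exact h).
  by have := ses_comp0 x ip.1; rewrite ind_map1E => -[].
move=> phi.
have cf u x : tup_f ZC (tpure u (phi (k x)))
    = (\0 : {linear tup_Y TK -> Z}) (tup_f TK (tpure u x)) by [].
have cg v' y : tup_g ZC (tpure v' ((\0 : {linear tup_Y TK -> Z}) y))
    = phi (k (tup_g TK (tpure v' y))).
  (* P receives nothing from the B-component of the induced tuple. *)
  have -> : k (tup_g TK (tpure v' y)) = 0.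
    apply: (ses_inj h); rewrite kE -tm_g linear0.
    by rewrite (ind_gE (X := P) (Y := Z)).
  by rewrite linear0.
have [psi psiE] := e (tfun (@Tmor _ _ _ _ TK ZC (phi \o k) (\0) cf cg)).
have [q qE] := tmod_hom psi.
exists (tm1 q \o inl_lin P (tensor V Z) : {linear _ -> _}) => x.
have [x' x'E] : exists x', tm1 i x' = (f x, 0).
  by apply/(ses_exact ip.1); rewrite ind_map1E /= (ses_comp0 _ h).
have := psiE (x', 0); rewrite qE !tfunE x'E => -[] /= -> _.
by congr (phi _); apply: (ses_inj h); rewrite kE x'E.
Qed.

End ExtInduced.

(** ** Approximations *)

(** The classes U, B and J of the Morita ring, read over S. *)
Definition tclass_U (C : lmodType A -> Prop) (D : lmodType B -> Prop)
    (M : lmodType S) : Prop :=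
  exists T, [/\ isomorphic M (tmod T), C (tup_X T) & D (tup_Y T)].

Definition tclass_B (C : lmodType A -> Prop) (D : lmodType B -> Prop)
    (M : lmodType S) : Prop :=
  exists T, [/\ isomorphic M (tmod T),
    coker_in D (tup_f T), coker_in C (tup_g T),
    exact_at (tens_map V (tup_f T)) (tup_g T)
    & exact_at (tens_map U (tup_g T)) (tup_f T)].

Definition tclass_J (C : lmodType A -> Prop) (D : lmodType B -> Prop)
    (M : lmodType S) : Prop :=
  exists T, [/\ isomorphic M (tmod T),
    ker_in C (adj (tup_f T)), ker_in D (adj (tup_g T)),
    exact_at (adj (tup_f T)) (hom_map U (adj (tup_g T)))
    & exact_at (adj (tup_g T)) (hom_map V (adj (tup_f T)))].

Lemma tclass_B_iso C D M N : isomorphic M N -> tclass_B C D M -> tclass_B C D N.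
Proof.
move=> /iso_sym e [T [e' *]]; exists T; split=> //; exact: iso_trans e e'.
Qed.

Lemma tclass_J_iso C D M N : isomorphic M N -> tclass_J C D M -> tclass_J C D N.
Proof.
move=> /iso_sym e [T [e' *]]; exists T; split=> //; exact: iso_trans e e'.
Qed.

Lemma triv_class C D X : C X -> D (zero_mod B) ->
  tclass_U C D (tmod (triv V U X (zero_mod B))).
Proof.
by move=> CX D0; exists (triv V U X (zero_mod B)); split=> //; apply: iso_refl.
Qed.

Lemma coind_class (C : lmodType A -> Prop) (D : lmodType B -> Prop) X Y :
  C X -> D Y -> tclass_J C D (tmod (coind V U X Y)).
Proof.
move=> CX DY; exists (coind V U X Y); split; first exact: iso_refl.
- exists X, (inl_lin X (hom_module U Y)); split=> //; first by move=> x y [].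
  move=> [x h]; split=> [fx|[k [<- <-]]]; last first.
    by apply: homP => u; rewrite [LHS]coind_fE.
  exists x; congr pair; apply: homP => u.
  by have := adj0 fx u; rewrite coind_fE => -[].
- exists Y, (inr_lin (hom_module V X) Y); split=> //; first by move=> x y [].
  move=> [h y]; split=> [fy|[k [<- <-]]]; last first.
    by apply: homP => u; rewrite [LHS]coind_gE.
  exists y; congr pair; apply: homP => v.
  by have := adj0 fy v; rewrite coind_gE => -[].
- move=> k; split=> [gk|[x <-]]; last exact: adj_comp0.
  have lk : linear (fun u => (k u).2) by move=> a u u'; rewrite linearP.
  exists (0, HomModule lk); apply: homP => u; rewrite [LHS]coind_fE.
  rewrite [RHS]surjective_pairing; congr pair; apply: homP => v.
  have := congr1 (fun h : hom_module U _ => h u) gk.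
  by move/adj0/(_ v); rewrite coind_gE => -[].
- move=> k; split=> [gk|[x <-]]; last exact: (adj_comp0 (T := swap (coind V U X Y)) x).
  have lk : linear (fun v => (k v).1) by move=> a v v'; rewrite linearP.
  exists (HomModule lk, 0); apply: homP => v; rewrite [LHS]coind_gE.
  rewrite [RHS]surjective_pairing; congr pair; apply: homP => u.
  have := congr1 (fun h : hom_module V _ => h v) gk.
  by move/adj0/(_ u); rewrite coind_fE => -[].
Qed.

Lemma ind_exact_g X Y : exact_at (tens_map V (ind_f V U X Y)) (ind_g V U X Y).
Proof.
move=> z; split=> [gz|[x <-]]; last exact: ind_gf.
have : tens_map V (snd : {linear (tensor U X * Y)%type -> Y}) z = 0.
  by move: gz => [].
move=> /(tens_exact V (ses_surj (prod_ses _ _)) (ses_exact (prod_ses _ _))).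
move=> [w <-]; exists (tens_map V (tens_map U (inl_lin X (tensor V Y))) w).
rewrite -(tens_map_comp (h := inl_lin _ _)) // => t.
by rewrite /= -(tens_map_comp (h := idfun)) // tens_map_id.
Qed.

Lemma ind_exact_f X Y : exact_at (tens_map U (ind_g V U X Y)) (ind_f V U X Y).
Proof.
move=> z; split=> [gz|[x <-]]; last exact: ind_fg.
have : tens_map U (fst : {linear (X * tensor V Y)%type -> X}) z = 0.
  by move: gz => [].
move=> /(tens_exact U (ses_surj (prod_ses_sym _ _))
  (ses_exact (prod_ses_sym _ _))).
move=> [w <-]; exists (tens_map U (tens_map V (inr_lin (tensor U X) Y)) w).
rewrite -(tens_map_comp (h := inr_lin _ _)) // => t.
by rewrite /= -(tens_map_comp (h := idfun)) // tens_map_id.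
Qed.

Lemma ind_class (C : lmodType A -> Prop) (D : lmodType B -> Prop) X Y :
  C X -> D Y -> tclass_B C D (tmod (ind V U X Y)).
Proof.
move=> CX DY; exists (ind V U X Y); split; first exact: iso_refl.
- exists Y, (snd : {linear (tensor U X * Y)%type -> Y}); split=> //.
    by move=> y; exists (0, y).
  move=> [t y]; split=> [/= ->|[x <-]] //.
  exists (tens_map U (inl_lin X (tensor V Y)) t).
  by rewrite /= -(tens_map_comp (h := idfun)) // tens_map_id.
- exists X, (fst : {linear (X * tensor V Y)%type -> X}); split=> //.
    by move=> y; exists (y, 0).
  move=> [x t]; split=> [/= ->|[y <-]] //.
  exists (tens_map V (inr_lin (tensor U X) Y) t).
  by rewrite /= -(tens_map_comp (h := idfun)) // tens_map_id.
- exact: ind_exact_g.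
- exact: ind_exact_f.
Qed.

(** Each step of the J-resolution gives short exact sequences of kernels.  A
    step costs one degree of vanishing of Ext(U, -) and Ext(V, -), and m < n
    leaves Ext^1 available throughout. *)
Lemma coind_wedge (n : nat) (C : lmodType A -> Prop) (D : lmodType B -> Prop) :
  (forall M N, isomorphic M N -> C M -> C N) ->
  (forall M N, isomorphic M N -> D M -> D N) ->
  (forall i, (1 <= i <= n)%N -> forall X, C X -> Ext_eq0 i V X) ->
  (forall i, (1 <= i <= n)%N -> forall Y, D Y -> Ext_eq0 i U Y) ->
  forall m K, wedge_class (tclass_J C D) m K -> (m < n)%N ->
    tclass_J (wedge_class C m) (wedge_class D m) K.
Proof.
move=> isoC isoD vV vU; apply: wedge_ind.
- exact: tclass_J_iso.
- move=> m M [T [e [K [k [ki ke CK]]] [L [l [li le DL]]] e1 e2]] _.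
  exists T; split=> //.
    by exists K, k; split=> //; apply: wedge_base.
  by exists L, l; split=> //; apply: wedge_base.
move=> m K L M f g h [TL [eL fL gL xL yL]] _ IH mn.
have [TK [eK fK gK xK yK]] := IH (ltnW mn).
have [TM eM] := ess_surj M.
have [i [p ip]] := ses_tuples h eK eL eM.
have [a [b [hab bE]]] := kerf_ses ip xK.
have [c [d [hcd dE]]] := kerf_ses (swap_ses ip) yK.
have CK := proj1 (ker_inP (@wedge_iso _ _ _) _) fK.
have DK := proj1 (ker_inP (@wedge_iso _ _ _) _) gK.
exists TM; split=> //.
- apply/ker_inP; first exact: wedge_iso.
  by apply: wedge_step hab _ CK; apply/(ker_inP isoC).
- apply/ker_inP; first exact: wedge_iso.
  by apply: wedge_step hcd _ DK; apply/(ker_inP isoD).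
- apply: (coind_exact hcd dE xL).
  exact: (Ext_wedge isoD vU DK (i := 0%N) (ltnW mn)).
- apply: (coind_exact (TK := swap TK) (p := swap_tmor p) hab bE yL).
  exact: (Ext_wedge isoC vV CK (i := 0%N) (ltnW mn)).
Qed.

(** Dual to [coind_wedge]: the kernels of the maps between cokernels form the
    next cokernels. *)
Lemma ind_vee (n : nat) (C : lmodType A -> Prop) (D : lmodType B -> Prop) :
  (forall M N, isomorphic M N -> C M -> C N) ->
  (forall M N, isomorphic M N -> D M -> D N) ->
  (forall i, (1 <= i <= n)%N -> forall X, C X -> Tor_eq0 i U X) ->
  (forall i, (1 <= i <= n)%N -> forall Y, D Y -> Tor_eq0 i V Y) ->
  forall m K, vee_class (tclass_B C D) m K -> (m < n)%N ->
    tclass_B (vee_class C m) (vee_class D m) K.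
Proof.
move=> isoC isoD vU vV; apply: vee_ind.
- exact: tclass_B_iso.
- move=> m M [T [e [K [k [ki ke CK]]] [L [l [li le DL]]] e1 e2]] _.
  exists T; split=> //.
    by exists K, k; split=> //; apply: vee_base.
  by exists L, l; split=> //; apply: vee_base.
move=> m Q L N f g h [TL [eL [GL [dL [dLs dLe DL]]] [FL [cL [cLs cLe CL]]] xL yL]].
move=> _ IH mn.
have [TQ [eQ [GQ [dQ [dQs dQe DQ]]] [FQ [cQ [cQs cQe CQ]]] xQ yQ]] := IH (ltnW mn).
have [TN eN] := ess_surj N.
have [i [p ip]] := ses_tuples h eN eL eQ.
have sip := swap_ses ip.
have [q [qs qE]] := coker_map ip cLs cQs cLe cQe.
have [c [cs cE]] := coker_ker ip cLs cLe cQe qE.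
have [r [rs rE]] := coker_map sip dLs dQs dLe dQe.
have [d [ds dE]] := coker_ker sip dLs dLe dQe rE.
have ce := coker_exact ip cLe dLs dLe dQe rs rE ds dE xL xQ cE.
have de := coker_exact sip dLe cLs cLe cQe qs qE cs cE yL yQ dE.
exists TN; split=> //.
- exists (ker_module r), d; split=> //.
  exact: vee_step (ker_ses rs) DL DQ.
- exists (ker_module q), c; split=> //.
  exact: vee_step (ker_ses qs) CL CQ.
- apply: (ind_exact ip dLe rs ds dE xL de).
  exact: (Tor_vee isoD vV DQ (i := 0%N) (ltnW mn)).
- apply: (ind_exact sip cLe qs cs cE yL ce).
  exact: (Tor_vee isoC vU CQ (i := 0%N) (ltnW mn)).
Qed.

(** ** Cotorsion pairs in A-modules *)

Section Transfer.
Variables (n : nat) (C1 C2 : lmodType A -> Prop) (D1 D2 : lmodType B -> Prop).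
Hypotheses (hC1 : module_class C1) (hC2 : module_class C2).
Hypotheses (hD1 : module_class D1) (hD2 : module_class D2).

Definition triv_map (X X' : lmodType A) (f : {linear X -> X'}) :
    tmor (triv V U X (zero_mod B)) (triv V U X' (zero_mod B)) :=
  @Tmor _ _ _ _ (triv V U X _) (triv V U X' _) f idfun (fun _ _ => erefl)
    (fun _ _ => esym (linear0 f)).

(** M |-> (M, 0) preserves direct sum decompositions. *)
Lemma class_U_summands (C : lmodType A -> Prop) (D : lmodType B -> Prop) :
  module_class C -> module_class D ->
  closed_under_summands (tclass_U C D) -> closed_under_summands C.
Proof.
move=> [_ isoC] [D0 _] cs M N N' [e eb] CM.
pose Z := zero_mod B.
pose h : {linear tmod (triv V U M Z) ->
    (tmod (triv V U N Z) * tmod (triv V U N' Z))%type} :=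
  pair_lin (tfun (triv_map (fst \o e))) (tfun (triv_map (snd \o e))).
have [|T [/tuple_iso/iso_sym eT CT _]] := cs (tmod (triv V U M Z))
    (tmod (triv V U N Z)) (tmod (triv V U N' Z)) _
    (triv_class CM (D0 _ (@zero_modP B))); last first.
  exact: isoC eT CT.
exists h; have [e' eK e'K] := eb; apply: linear_bij.
  move=> [x z] [x' z'] [e1 _ e2 _]; congr pair;
    last by rewrite (zero_modP z) (zero_modP z').
  apply: (bij_inj eb); rewrite [LHS]surjective_pairing e1 e2.
  by rewrite -surjective_pairing.
move=> [[x z] [y z']]; exists (e' (x, y), 0).
by rewrite /h /= e'K /= (zero_modP z) (zero_modP z').
Qed.

Lemma triv_ses (M : lmodType A) (K L : lmodType S) (f : {linear K -> L})
    (g : {linear L -> tmod (triv V U M (zero_mod B))}) TK TL :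
  short_exact f g -> isomorphic K (tmod TK) -> isomorphic L (tmod TL) ->
  exists (f' : {linear tup_X TK -> tup_X TL}) (g' : {linear tup_X TL -> M}),
    short_exact f' g'.
Proof.
move=> h eK eL; have [i [p [ip _]]] := ses_tuples h eK eL (iso_refl _).
by exists (tm1 i), (tm1 p).
Qed.

Lemma triv_ses_r (M : lmodType A) (K L : lmodType S)
    (f : {linear tmod (triv V U M (zero_mod B)) -> L}) (g : {linear L -> K}) TK TL :
  short_exact f g -> isomorphic K (tmod TK) -> isomorphic L (tmod TL) ->
  exists (f' : {linear M -> tup_X TL}) (g' : {linear tup_X TL -> tup_X TK}),
    short_exact f' g'.
Proof.
move=> h eK eL; have [i [p [ip _]]] := ses_tuples h (iso_refl _) eL eK.
by exists (tm1 i), (tm1 p).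
Qed.

Lemma coind_Ext_range i X Y : (0 < n)%N -> (0 < i <= n.+1)%N ->
  (forall i, (1 <= i <= n)%N -> Ext_eq0 i V Y) ->
  Ext_eq0 i (tmod (triv V U X (zero_mod B))) (tmod (coind V U Y (zero_mod B))) ->
  Ext_eq0 i X Y.
Proof.
move=> n0 + vV; case: i => [//|i] /= im /Ext_vanishing v; apply/Ext_vanishing.
have vk k : (k < n)%N -> ext_vanishing Y k V by move=> kn; apply/Ext_vanishing/vV.
move: im; rewrite ltnS leq_eqVlt => /orP[/eqP ni|im].
  case: i ni v => [|i] ni v; first by rewrite -ni in n0.
  by apply: coind_Ext_top v => k ki; apply: vk; rewrite -ni ltnS.
apply: (coind_Ext (T := triv V U X (zero_mod B))) v => k ki.
by apply: vk; apply: leq_ltn_trans im.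
Qed.

Lemma ind_Ext_range i X Y : (0 < i <= n.+1)%N ->
  (forall i, (1 <= i <= n)%N -> Tor_eq0 i U X) ->
  Ext_eq0 i (tmod (ind V U X (zero_mod B))) (tmod (triv V U Y (zero_mod B))) ->
  Ext_eq0 i X Y.
Proof.
move=> + vU; case: i => [//|i] /= im /Ext_vanishing v; apply/Ext_vanishing.
apply: ind_Ext v => k ki; apply/Tor_vanishing/vU => /=.
by apply: leq_trans ki _; rewrite -ltnS.
Qed.

(** The kernel term of the approximation of (M, 0) is an extension of two
    modules with finite C2-resolutions. *)
Lemma left_pair : (0 < n)%N ->
  hereditary_left_cotorsion_pair n (tclass_U C1 D1) (tclass_J C2 D2) ->
  (forall i, (1 <= i <= n)%N -> forall X, C2 X -> Ext_eq0 i V X) ->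
  (forall i, (1 <= i <= n)%N -> forall Y, D2 Y -> Ext_eq0 i U Y) ->
  (forall Y, D2 Y -> C2 (hom_module U Y)) ->
  closed_under_extensions (wedge_class C2 n.-1) ->
  hereditary_left_cotorsion_pair n C1 C2.
Proof.
move=> n0 [[cs ext app] her] vV vU DC ce.
have C1U X : C1 X -> tclass_U C1 D1 (tmod (triv V U X (zero_mod B))).
  by move=> CX; apply: triv_class => //; apply: hD1.1; apply: zero_modP.
have C2J Y : C2 Y -> tclass_J C2 D2 (tmod (coind V U Y (zero_mod B))).
  by move=> CY; apply: coind_class => //; apply: hD2.1; apply: zero_modP.
split; first split.
- exact: class_U_summands cs.
- move=> i im X Y CX CY.
  apply: coind_Ext_range n0 _ _ (ext _ im _ _ (C1U _ CX) (C2J _ CY)).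
    by case/andP: im => -> /leqW ->.
  by move=> k kn; apply: vV.
- move=> M; have [K [L [f [g [h [TL [eL CL _]] wK]]]]] :=
    app (tmod (triv V U M (zero_mod B))).
  have n1 : (n.-1 < n)%N by rewrite prednK.
  have [TK [eK fK gK xK yK]] := coind_wedge hC2.2 hD2.2 vV vU wK n1.
  have [f' [g' h']] := triv_ses h eK eL.
  exists (tup_X TK), (tup_X TL), f', g'; split=> //.
  have [b hb] := coind_extension xK.
  apply: ce hb _ _; first exact/(ker_inP (@wedge_iso _ _ _)).
  apply: (hom_wedge hD2.2 vU DC) (leq_pred _).
  exact/(ker_inP (@wedge_iso _ _ _)).
- move=> X Y CX CY; apply: coind_Ext_range n0 _ _ (her _ _ (C1U _ CX) (C2J _ CY)).
    by rewrite /= leqnn.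
  by move=> k kn; apply: vV.
Qed.

(** The cokernel term of the approximation of (M, 0) is an extension of two
    modules with finite C1-coresolutions. *)
Lemma right_pair : (0 < n)%N ->
  hereditary_right_cotorsion_pair n (tclass_B C1 D1) (tclass_U C2 D2) ->
  (forall i, (1 <= i <= n)%N -> forall X, C1 X -> Tor_eq0 i U X) ->
  (forall i, (1 <= i <= n)%N -> forall Y, D1 Y -> Tor_eq0 i V Y) ->
  (forall Y, D1 Y -> C1 (tensor V Y)) ->
  closed_under_extensions (vee_class C1 n.-1) ->
  hereditary_right_cotorsion_pair n C1 C2.
Proof.
move=> n0 [[cs ext app] her] vU vV DC ce.
have C2U X : C2 X -> tclass_U C2 D2 (tmod (triv V U X (zero_mod B))).
  by move=> CX; apply: triv_class => //; apply: hD2.1; apply: zero_modP.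
have C1B Y : C1 Y -> tclass_B C1 D1 (tmod (ind V U Y (zero_mod B))).
  by move=> CY; apply: ind_class => //; apply: hD1.1; apply: zero_modP.
split; first split.
- exact: class_U_summands cs.
- move=> i im X Y CX CY; apply: ind_Ext_range (ext _ im _ _ (C1B _ CX) (C2U _ CY)).
    by case/andP: im => -> /leqW ->.
  by move=> k kn; apply: vU.
- move=> M; have [L [K [f [g [h [TL [eL CL _]] wK]]]]] :=
    app (tmod (triv V U M (zero_mod B))).
  have n1 : (n.-1 < n)%N by rewrite prednK.
  have [TK [eK [G [d [ds de DG]]] [F [c [cs' c'e CF]]] xK yK]] :=
    ind_vee hC1.2 hD1.2 vU vV wK n1.
  have [f' [g' h']] := triv_ses_r h eK eL.
  exists (tup_X TL), (tup_X TK), f', g'; split=> //.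
  have [b hb] := ind_extension cs' c'e ds de xK.
  apply: ce hb _ CF; exact: (tens_vee hD1.2 vV DC) DG (leq_pred _).
- move=> X Y CX CY; apply: ind_Ext_range (her _ _ (C1B _ CX) (C2U _ CY)).
    by rewrite /= leqnn.
  by move=> k kn; apply: vU.
Qed.

End Transfer.

End Pairs.

(** * The two corners *)

Section Corners.
Variables (A B : pzRingType) (V : bimodule A B) (U : bimodule B A).

Definition exchange (p : morita V U) : morita U V :=
  Morita (m22 p) (m21 p) (m12 p) (m11 p).

Lemma exchange_is_additive : additive exchange.
Proof. by move=> p q. Qed.

Lemma exchange_is_monoid_morphism : monoid_morphism exchange.
Proof.
by split=> // p q; congr Morita; rewrite /= addrC.
Qed.

HB.instance Definition _ := GRing.isZmodMorphism.Build _ _ exchange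
  exchange_is_additive.
HB.instance Definition _ := GRing.isMonoidMorphism.Build _ _ exchange
  exchange_is_monoid_morphism.

Lemma exchange_surj : surjective_map exchange.
Proof. by case=> b u v a; exists (Morita a v u b). Qed.

Local Notation idL := (idfun : {rmorphism morita V U -> morita V U}).

Lemma tmod_id_linear T : linear (fun z : tuple_module T => z : tmod idL T).
Proof. by []. Qed.

Lemma tmod_id T : isomorphic (tuple_module T) (tmod idL T).
Proof. by exists (mklin (@tmod_id_linear T)); exists id. Qed.

Lemma tmod_exchange_linear T :
  linear (fun z : tuple_module T => (z.2, z.1) : tmod exchange (swap T)).
Proof.
by move=> p [x y] [x' y']; congr pair => /=; congr (_ + _); apply: addrC.
Qed.

Lemma tmod_exchange T : isomorphic (tuple_module T) (tmod exchange (swap T)).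
Proof.
by exists (mklin (@tmod_exchange_linear T)); exists (fun z => (z.2, z.1)); case.
Qed.

Lemma swapK (T : morita_tuple U V) : swap (swap T) = T.
Proof. by case: T. Qed.

Lemma id_ess_surj (M : lmodType (morita V U)) :
  exists T, isomorphic M (tmod idL T).
Proof.
have [T e] := tuple_of_module M; exists T.
exact: iso_trans e (tmod_id T).
Qed.

Lemma exchange_ess_surj (M : lmodType (morita V U)) :
  exists T, isomorphic M (tmod exchange T).
Proof.
have [T e] := tuple_of_module M; exists (swap T).
exact: iso_trans e (tmod_exchange T).
Qed.

Section Classes.
Variables (C : lmodType A -> Prop) (D : lmodType B -> Prop).

Lemma id_iso_iff (M : lmodType (morita V U)) T :
  isomorphic M (tuple_module T) <-> isomorphic M (tmod idL T).
Proof.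
split=> e; first exact: iso_trans e (tmod_id T).
exact: iso_trans e (iso_sym (tmod_id T)).
Qed.

Lemma exchange_iso_iff (M : lmodType (morita V U)) T :
  isomorphic M (tuple_module T) <-> isomorphic M (tmod exchange (swap T)).
Proof.
split=> e; first exact: iso_trans e (tmod_exchange T).
exact: iso_trans e (iso_sym (tmod_exchange T)).
Qed.

Lemma class_U_id : class_U V U C D = tclass_U idL C D.
Proof.
apply/funext => M; apply/propext.
by split=> -[T [/id_iso_iff e c d]]; exists T; split.
Qed.

Lemma class_B_id : class_B V U C D = tclass_B idL C D.
Proof.
apply/funext => M; apply/propext.
by split=> -[T [/id_iso_iff e c d e1 e2]]; exists T; split.
Qed.

Lemma class_J_id : class_J V U C D = tclass_J idL C D.
Proof.
apply/funext => M; apply/propext.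
by split=> -[T [/id_iso_iff e c d e1 e2]]; exists T; split.
Qed.

Lemma class_U_exchange : class_U V U C D = tclass_U exchange D C.
Proof.
apply/funext => M; apply/propext.
split=> -[T [e c d]]; exists (swap T); split=> //; first exact/exchange_iso_iff.
by apply/exchange_iso_iff; rewrite swapK.
Qed.

Lemma class_B_exchange : class_B V U C D = tclass_B exchange D C.
Proof.
apply/funext => M; apply/propext.
split=> -[T [e c d e1 e2]]; exists (swap T); split=> //; first exact/exchange_iso_iff.
by apply/exchange_iso_iff; rewrite swapK.
Qed.

Lemma class_J_exchange : class_J V U C D = tclass_J exchange D C.
Proof.
apply/funext => M; apply/propext.
split=> -[T [e c d e1 e2]]; exists (swap T); split=> //; first exact/exchange_iso_iff.
by apply/exchange_iso_iff; rewrite swapK.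
Qed.

End Classes.

Lemma id_surj : surjective_map idL.
Proof. by move=> p; exists p. Qed.

End Corners.

Theorem proposition4p14
  (A B : pzRingType) (V : bimodule A B) (U : bimodule B A)
  (n : nat) (hn : (1 <= n)%N)
  (C1 C2 : lmodType A -> Prop) (D1 D2 : lmodType B -> Prop)
  (hC1 : module_class C1) (hC2 : module_class C2)
  (hD1 : module_class D1) (hD2 : module_class D2) :
  (hereditary_left_cotorsion_pair n
     (class_U V U C1 D1) (class_J V U C2 D2) ->
   (forall i, (1 <= i <= n)%N -> forall X, C2 X -> Ext_eq0 i V X) ->
   (forall i, (1 <= i <= n)%N -> forall Y, D2 Y -> Ext_eq0 i U Y) ->
   (forall Y X, D2 Y -> C2 X -> Ext_eq0 1 (hom_module U Y) X) ->
   (forall X Y, C2 X -> D2 Y -> Ext_eq0 1 (hom_module V X) Y) ->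
   (forall X, C2 X -> D2 (hom_module V X)) ->
   (forall Y, D2 Y -> C2 (hom_module U Y)) ->
   closed_under_extensions (wedge_class C2 n.-1) ->
   closed_under_extensions (wedge_class D2 n.-1) ->
   hereditary_left_cotorsion_pair n C1 C2 /\
   hereditary_left_cotorsion_pair n D1 D2)
  /\
  (hereditary_right_cotorsion_pair n
     (class_B V U C1 D1) (class_U V U C2 D2) ->
   (forall i, (1 <= i <= n)%N -> forall X, C1 X -> Tor_eq0 i U X) ->
   (forall i, (1 <= i <= n)%N -> forall Y, D1 Y -> Tor_eq0 i V Y) ->
   (forall X Y, C1 X -> D1 Y -> Ext_eq0 1 X (tensor V Y)) ->
   (forall Y X, D1 Y -> C1 X -> Ext_eq0 1 Y (tensor U X)) ->
   (forall Y, D1 Y -> C1 (tensor V Y)) ->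
   (forall X, C1 X -> D1 (tensor U X)) ->
   closed_under_extensions (vee_class C1 n.-1) ->
   closed_under_extensions (vee_class D1 n.-1) ->
   hereditary_right_cotorsion_pair n C1 C2 /\
   hereditary_right_cotorsion_pair n D1 D2).
Proof.
split=> [h vV vU _ _ CD DC ceC ceD|h vU vV _ _ DC CD ceC ceD]; split.
- rewrite class_U_id class_J_id in h.
  by apply: (left_pair (@id_surj _ _ V U) (@id_ess_surj _ _ V U) _ _ _ _ hn h).
- rewrite class_U_exchange class_J_exchange in h.
  by apply: (left_pair (@exchange_surj _ _ V U) (@exchange_ess_surj _ _ V U)
    _ _ _ _ hn h).
- rewrite class_B_id class_U_id in h.
  by apply: (right_pair (@id_surj _ _ V U) (@id_ess_surj _ _ V U) _ _ _ _ hn h).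
- rewrite class_B_exchange class_U_exchange in h.
  by apply: (right_pair (@exchange_surj _ _ V U) (@exchange_ess_surj _ _ V U)
    _ _ _ _ hn h).
Qed.
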